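(* Let $\mathbb{G}$ be a stratified group, let $\Omega\subset\mathbb{G}$ be open and let $u:\Omega\to\mathbb{R}$ be an h-convex function. Then for every $x\in\Omega$ and every $h$ such that $[0,h]\subseteq H_1\cap x^{-1}\Omega$, there exist $t\in[0,1]$ and $p\in\partial_Hu(x\delta_th)$ such that $$u(xh)-u(x)=\langle p,h\rangle.$$
   Context: Stratified group: $\mathbb{G}=H_1\oplus\cdots\oplus H_\iota$ is a finite dimensional graded vector space with a polynomial group operation given by the Baker-Campbell-Hausdorff formula (so $\mathbb{G}$ is identified with its stratified Lie algebra via exponential coordinates; the unit element is $0$, and the first layer $H_1$ generates the Lie algebra). Dilations: $\delta_r(x)=\sum_jr^jx_{(j)}$ if $x=\sum_jx_{(j)}$, $x_{(j)}\in H_j$. A scalar product $\langle\cdot,\cdot\rangle$ is fixed on $\mathbb{G}$ making the $H_j$ mutually orthogonal. For $h\in H_1$ put $[0,h]=\{th:0\le t\le1\}$ and $x\cdot[0,h]=\{x\delta_th:0\le t\le1\}$. A function $u:\Omega\to\mathbb{R}$ is h-convex if for all $x,y\in\Omega$ with $x^{-1}y\in H_1$ and $x\cdot[0,x^{-1}y]\subset\Omega$ one has $u(x\delta_\lambda(x^{-1}y))\le\lambda u(y)+(1-\lambda)u(x)$ for all $\lambda\in[0,1]$. All h-convex functions are assumed measurable; they are then locally Lipschitz with respect to any homogeneous distance (Rickly). The h-subdifferential $\partial_Hu(x)$ is the set of $p\in H_1$ such that $u(xh)\ge u(x)+\langle p,h\rangle$ whenever $h\in H_1$ and $[0,h]\subset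 x^{-1}\Omega$. *)

(* Defs.v *)
From HB Require Import structures.
From mathcomp Require Import all_boot all_order all_algebra sesquilinear.
From mathcomp Require Import all_classical all_reals all_analysis.

Set Implicit Arguments.
Unset Strict Implicit.
Unset Printing Implicit Defensive.

Import Order.TTheory GRing.Theory Num.Theory.
Import numFieldNormedType.Exports.

Local Open Scope classical_set_scope.
Local Open Scope ring_scope.

(* The Baker-Campbell-Hausdorff series in Dynkin's form,
     \sum_(k >= 1) (-1)^(k-1)/k \sum_((r_i,s_i))
        [x^(r_1) y^(s_1) ... x^(r_k) y^(s_k)]
          / ((\sum_i (r_i + s_i)) \prod_i (r_i! s_i!)),
   where the r_i + s_i are positive and the brackets are nested to the right.
   It is truncated to k <= N and r_i, s_i <= N; all the omitted terms are
   brackets of more than N letters, which vanish in a Lie algebra of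
   nilpotency step at most N. *)
Section BCH.
Variables (R : fieldType) (V : lmodType R) (br : V -> V -> V).

Fixpoint nested_bracket (w : seq V) : V :=
  match w with
  | [::] => 0
  | [:: a] => a
  | a :: w' => br a (nested_bracket w')
  end.

Definition bch_word (t : seq (nat * nat)) (x y : V) : seq V :=
  flatten [seq nseq rs.1 x ++ nseq rs.2 y | rs <- t].

Definition bch_coef (t : seq (nat * nat)) : R :=
  (-1) ^+ (size t).-1 /
  (size t * (\sum_(rs <- t) (rs.1 + rs.2)) *
     \prod_(rs <- t) (rs.1`! * rs.2`!))%:R.

Definition bch_exponents N k (t : k.-tuple ('I_N.+1 * 'I_N.+1)) :
    seq (nat * nat) :=
  [seq (val rs.1, val rs.2) | rs <- t].

Definition bch (N : nat) (x y : V) : V :=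
  \sum_(1 <= k < N.+1)
    \sum_(t : k.-tuple ('I_N.+1 * 'I_N.+1)
         | all (fun rs => 0 < rs.1 + rs.2)%N (bch_exponents t))
      bch_coef (bch_exponents t) *:
        nested_bracket (bch_word (bch_exponents t) x y).

End BCH.

(* The underlying vector space is R^n, with an arbitrary grading and an
   arbitrary scalar product. The layers H_1, ..., H_step are indexed from 1,
   the value [sg_layer 0] is never used. *)
Record stratified_group (R : realType) (n : nat) := StratifiedGroup {
  sg_step : nat ;
  sg_layer : nat -> {vspace 'rV[R]_n} ;
  sg_step_gt0 : (0 < sg_step)%N ;
  sg_layer_direct : directv (\sum_(j < sg_step) sg_layer j.+1) ;
  sg_layer_full : (\sum_(j < sg_step) sg_layer j.+1 = fullv)%VS ;
  sg_layer_gt_step : forall j, (sg_step < j)%N -> sg_layer j = 0%VS ;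
  (* the graded Lie algebra, generated by its first layer *)
  sg_bracket : {bilinear 'rV[R]_n -> 'rV[R]_n -> 'rV[R]_n} ;
  sg_bracket_alt : forall x, sg_bracket x x = 0 ;
  sg_bracket_jacobi : forall x y z,
    sg_bracket x (sg_bracket y z) + sg_bracket y (sg_bracket z x)
      + sg_bracket z (sg_bracket x y) = 0 ;
  sg_bracket_graded : forall i j x y, (0 < i)%N -> (0 < j)%N ->
    x \in sg_layer i -> y \in sg_layer j ->
    sg_bracket x y \in sg_layer (i + j) ;
  sg_generated : forall U : {vspace 'rV[R]_n}, (sg_layer 1 <= U)%VS ->
    (forall x y, x \in U -> y \in U -> sg_bracket x y \in U) -> U = fullv ;
  (* the group operation, in exponential coordinates *)
  sg_mul : 'rV[R]_n -> 'rV[R]_n -> 'rV[R]_n ;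
  sg_inv : 'rV[R]_n -> 'rV[R]_n ;
  sg_mulA : associative sg_mul ;
  sg_mul0g : left_id 0 sg_mul ;
  sg_mulVg : left_inverse 0 sg_inv sg_mul ;
  sg_mul_bch : forall x y, sg_mul x y = bch sg_bracket sg_step x y ;
  sg_dot : {dot 'rV[R]_n for idfun} ;
  sg_dot_layer : forall i j x y, (0 < i)%N -> (0 < j)%N -> i <> j ->
    x \in sg_layer i -> y \in sg_layer j -> sg_dot x y = 0
}.

(* Measurability with respect to the Lebesgue (i.e. Haar) measure of R^n *)
Section LebesgueMeasurability.
Variables (R : realType) (n : nat).
Implicit Types A N : set 'rV[R]_n.

Definition lebesgue_null A : Prop :=
  forall e : R, 0 < e ->
  exists (D : set nat) (a b : nat -> 'rV[R]_n),
    [/\ forall k i, a k 0 i <= b k 0 i,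
        A `<=` \bigcup_(k in D)
                 [set x | forall i, a k 0 i <= x 0 i <= b k 0 i] &
        (\esum_(k in D) (\prod_(i < n) (b k 0 i - a k 0 i))%:E <= e%:E)%E].

Definition lebesgue_measurable A : Prop :=
  exists2 B, <<s @open 'rV[R]_n >> B & lebesgue_null ((A `\` B) `|` (B `\` A)).

Definition lebesgue_measurable_fun A (f : 'rV[R]_n -> R) : Prop :=
  forall Y : set R, measurable Y -> lebesgue_measurable (A `&` f @^-1` Y).

End LebesgueMeasurability.

Section HConvexity.
Variables (R : realType) (n : nat) (G : stratified_group R n).
Implicit Types (x y h p : 'rV[R]_n) (Omega : set 'rV[R]_n).

Definition horizontal : set 'rV[R]_n := [set h | h \in sg_layer G 1].

Definition dilation (r : R) x : 'rV[R]_n :=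
  \sum_(j < sg_step G)
    r ^+ j.+1 *: sumv_pi (\sum_(i < sg_step G) sg_layer G i.+1)%VS j x.

Definition left_translate x (A : set 'rV[R]_n) : set 'rV[R]_n := sg_mul G x @` A.

(* [0,h] *)
Definition segment h : set 'rV[R]_n := [set t *: h | t in `[0, 1]].

(* x.[0,h] *)
Definition hsegment x h : set 'rV[R]_n :=
  [set sg_mul G x (dilation t h) | t in `[0, 1]].

(* Functions on Omega are total functions, of which only the values on Omega
   matter. *)
Definition h_convex Omega (u : 'rV[R]_n -> R) : Prop :=
  forall x y, Omega x -> Omega y ->
    let h := sg_mul G (sg_inv G x) y in
    horizontal h -> hsegment x h `<=` Omega ->
    forall l : R, 0 <= l <= 1 ->
      u (sg_mul G x (dilation l h)) <= l * u y + (1 - l) * u x.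

Definition h_subdifferential Omega (u : 'rV[R]_n -> R) x : set 'rV[R]_n :=
  [set p | horizontal p /\
     forall h, horizontal h ->
       segment h `<=` left_translate (sg_inv G x) Omega ->
       u (sg_mul G x h) >= u x + sg_dot G p h].

End HConvexity.

(* Main.v *)
Require Import Defs.
From HB Require Import structures.
From mathcomp Require Import all_boot all_order all_algebra sesquilinear.
From mathcomp Require Import all_classical all_reals all_analysis.
From mathcomp Require Import measurable_realfun ring lra.

(** Fix a point y. Along every horizontal line through y the function u is convex,
so it has a one-sided derivative D(h) in every horizontal direction h, and D is
positively homogeneous. If D is also subadditive, the Hahn-Banach theorem gives,
for every c between - D(- h) and D(h), a linear form <p, .> below D with
<p, h> = c; as D(k) <= u(yk) - u(y), this p belongs to the h-subdifferential at
y. The mean value theorem for the convex function t -> u(x (t h)) provides a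
point of the segment at which c = u(xh) - u(x) lies in that interval
([horizontal_mean_value], [subdifferential_support]).

Subadditivity ([hderiv_subadditive]) rests on a comparison at a large scale. For
a fixed word w, a small s and a large M, convexity along z (t k), with
z = y delta_s(w), bounds u(z (s k)) - u(z) by (u(z (Ms k)) - u(z)) / M. The far
point z (Ms k) is y (Ms k) multiplied on the right by the dilation by s of the
conjugate of w by Mk. That conjugate has homogeneous size o(M), because
delta_(1/M) maps it to the conjugate of delta_(1/M)(w) by k, which tends to 0.
If u is locally Lipschitz for the homogeneous distance, it follows that
u(z (s k)) <= u(z) + s (D(k) + o(1)), so that along a word the increments of u
are at most the sum of the D of its letters ([hderiv_word]). Finally
(h/m k/m)^m = delta_(1/m)(m (hk)) tends to the first-layer part h + k of hk.

The Lipschitz property comes from the geometry of horizontal words. The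
conjugates (-c) X c of horizontal vectors X by products c of horizontal vectors
span the Lie algebra, since (-tY) (tv) (tY) = t v + t^2 [v, Y] + O(t^3)
([orbit_span]). Hence, with enough letters, the product of the t_i X_i is, around
a suitable parameter and after selecting n of the t_i, a map whose linear part is
invertible. It is then onto a neighbourhood, so that all points near 0 are
products of a bounded number of short horizontal vectors ([reach_neighborhood]);
an upper bound on u therefore yields a lower bound and Lipschitz bounds
([horizontal_lipschitz]). It is also expanding: preimages of sets of small measure
have small measure.

The latter is where measurability enters ([locally_bounded_above]). Iterating
u(z) <= (u(zh) + u(z(-h))) / 2, the value u(z) is at most the largest value of u
at the points obtained from z by a word with all choices of signs of its letters.
For large M the set where u > M has small measure near y; since the word maps are
expanding for every choice of signs, some word avoids this set for all signs at
once, and u(z) <= M. The outer measure is generated by cubes, so that it can be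
compared under Lipschitz maps. *)

Set Implicit Arguments.
Unset Strict Implicit.
Unset Printing Implicit Defensive.

Import Order.TTheory GRing.Theory Num.Theory.
Import numFieldNormedType.Exports.

Local Open Scope classical_set_scope.
Local Open Scope ring_scope.

(** * An outer measure on row vectors, generated by cubes *)

Lemma norm_coord_le (R : realType) (n : nat) (v : 'rV[R]_n) i : `|v 0 i| <= `|v|.
Proof.
by rewrite [leRHS]/Num.norm/= mx_normrE; apply/bigmax_geP; right; exists (0, i).
Qed.

(** A copy of the space of row vectors that carries the algebra of all subsets,
so that the coverings in [mu_ext] may consist of arbitrary sets. *)
Definition powerset_rV (R : realType) (n : nat) := 'rV[R]_n.

Section PowersetAlgebra.
Variables (R : realType) (n : nat).
HB.instance Definition _ := Pointed.on (powerset_rV R n).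
HB.instance Definition _ := @isMeasurable.Build default_measure_display
  (powerset_rV R n) setT I (fun _ _ => I) (fun _ _ => I).
End PowersetAlgebra.

Section CubeMeasure.
Variables (R : realType) (n : nat).
Implicit Types (A B : set 'rV[R]_n) (a b x : 'rV[R]_n) (r : R).
Local Open Scope ereal_scope.

Definition cube a r : set 'rV[R]_n :=
  [set x | forall i, (a 0 i <= x 0 i <= a 0 i + r)%R].

Definition box a b : set 'rV[R]_n :=
  [set x | forall i, (a 0 i <= x 0 i <= b 0 i)%R].

(** Arbitrary sets are allowed as covering sets, weighted by the n-th power of
the side of a cube around them: a Lipschitz map then changes the weights by a
constant factor, whereas images of boxes are not boxes. The empty set is singled
out because r ^+ n is 1 when n = 0. *)
Definition cube_gauge A : \bar R :=
  if pselect (A = set0) then 0 else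
  ereal_inf [set (r ^+ n)%:E | r in [set r | (0 <= r)%R /\ exists a, A `<=` cube a r]].

Lemma cube_gauge0 : cube_gauge set0 = 0.
Proof. by rewrite /cube_gauge; case: pselect. Qed.

Lemma cube_gauge_ge0 A : 0 <= cube_gauge A.
Proof.
rewrite /cube_gauge; case: pselect => //= _.
by apply: le_ereal_inf_tmp => z [r [r0 _] <-{z}]; rewrite lee_fin exprn_ge0.
Qed.

Lemma cube_gauge_le A a r : (0 <= r)%R -> A `<=` cube a r ->
  cube_gauge A <= (r ^+ n)%:E.
Proof.
move=> r0 Ar; rewrite /cube_gauge; case: pselect => /= [_|_].
  by rewrite lee_fin exprn_ge0.
by apply: ereal_inf_lbound; exists r => //; split => //; exists a.
Qed.

Definition cube_measure A : \bar R :=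
  @mu_ext _ (powerset_rV R n) R cube_gauge A.

HB.instance Definition _ := isOuterMeasure.Build R 'rV[R]_n cube_measure
  (@mu_ext0 _ (powerset_rV R n) R _ cube_gauge0 cube_gauge_ge0)
  (@mu_ext_ge0 _ (powerset_rV R n) R _ cube_gauge_ge0)
  (@le_mu_ext _ (powerset_rV R n) R _)
  (@mu_ext_sigma_subadditive _ (powerset_rV R n) R _ cube_gauge_ge0).

Lemma cube_measure_le_gauge A : cube_measure A <= cube_gauge A.
Proof.
apply: ereal_inf_lbound; exists (fun k : nat => if k is 0%N then (A : set (powerset_rV R n)) else set0).
  by split=> // x Ax; exists 0%N.
rewrite nneseries_recl//; last by move=> k _; exact: cube_gauge_ge0.
rewrite eseries_cond/= eseries0 ?adde0// => -[|]//= k _ _.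
exact: cube_gauge0.
Qed.

Lemma cube_measure_fin_subadditive (I : finType) (P : pred I)
    (F : I -> set 'rV[R]_n) A :
  A `<=` [set x | exists2 i, P i & F i x] ->
  cube_measure A <= \sum_(i | P i) cube_measure (F i).
Proof.
move=> AF; pose U := \big[setU/set0]_(i | P i) F i.
apply: (@le_trans _ _ (cube_measure U)).
  apply: le_outer_measure => x /AF[i Pi Fix].
  by rewrite /U (bigD1 i)//=; left.
rewrite /U; apply: (big_ind2 (fun X z => cube_measure X <= z)) => //.
  by rewrite outer_measure0.
move=> X z Y w hz hw; apply: le_trans (leeD hz hw); exact: outer_measureU2.
Qed.

Lemma cube_measure_cube_le a r : (0 <= r)%R ->
  cube_measure (cube a r) <= (r ^+ n)%:E.
Proof.
move=> r0; apply: le_trans (cube_measure_le_gauge _) _.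
exact: (@cube_gauge_le _ a).
Qed.

Lemma prod_shift_cvg (l : 'I_n -> R) :
  (\prod_i (l i + t))%R @[t --> (0:R)%R] --> (\prod_i l i)%R.
Proof.
apply: (@cvg_big _ _ _ _ _ (@mul_continuous R)) => i _.
rewrite -[X in _ --> X]addr0.
by apply: cvgD; [exact: cvg_cst|exact: cvg_id].
Qed.

(** A grid of cubes of side eta covers the box and overshoots it by at most eta
in each direction, hence by an arbitrarily small volume. *)
Lemma cube_measure_box a b : (forall i, a 0 i <= b 0 i)%R ->
  cube_measure (box a b) <= (\prod_i (b 0 i - a 0 i))%:E.
Proof.
move=> ab; apply/lee_addgt0Pr => e e0; rewrite -EFinD.
have [eta eta0 etaP] : exists2 eta : R, (0 < eta)%R &
    (\prod_i (b 0 i - a 0 i + eta) <= \prod_i (b 0 i - a 0 i) + e)%R.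
  have /cvgrPdist_lt/(_ e e0)[d /= d0 dP] := @prod_shift_cvg (fun i => b 0 i - a 0 i)%R.
  have d20 : (0 < d / 2)%R by rewrite divr_gt0.
  exists (d / 2)%R => //.
  have := dP (d / 2)%R; rewrite /= sub0r normrN gtr0_norm//.
  rewrite ltr_pdivrMr// ltr_pMr// ltr1n => /(_ isT).
  by rewrite ltr_distlC => /andP[_ /ltW].
pose k (i : 'I_n) := (Num.truncn ((b 0 i - a 0 i) / eta)%R).+1.
pose K := (\max_i k i)%N.
pose corner (f : {ffun 'I_n -> 'I_K}) : 'rV[R]_n := (\row_i (a 0 i + (f i)%:R * eta))%R.
pose Q i (j : 'I_K) := (j < k i)%N.
have l0 i : (0 <= b 0 i - a 0 i)%R by rewrite subr_ge0.
have k_le i : ((k i)%:R * eta <= b 0 i - a 0 i + eta)%R.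
  have : ((Num.truncn ((b 0 i - a 0 i) / eta)%R)%:R <= (b 0 i - a 0 i) / eta)%R.
    by rewrite truncn_le// divr_ge0// ltW.
  rewrite ler_pdivlMr// /k; set t := Num.truncn _.
  by rewrite -natr1 [((_ + 1) * _)%R]mulrDl mul1r lerD2r.
have cover : box a b `<=` [set x | exists2 f, f \in family Q & cube (corner f) eta x].
  move=> x xab /=.
  have x0 i : (0 <= (x 0 i - a 0 i) / eta)%R.
    by apply: divr_ge0; [rewrite subr_ge0; have /andP[] := xab i|exact: ltW].
  have jk i : (Num.truncn ((x 0 i - a 0 i) / eta)%R < k i)%N.
    rewrite /k ltnS le_truncn// ler_pM2r ?invr_gt0// lerD2r.
    by have /andP[] := xab i.
  have jK i : (Num.truncn ((x 0 i - a 0 i) / eta)%R < K)%N.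
    by rewrite (leq_trans (jk i))//; exact: leq_bigmax.
  exists [ffun i => Ordinal (jK i)].
    by apply/familyP => i; rewrite ffunE; exact: jk.
  move=> i; rewrite mxE ffunE /=.
  have /andP[h1 h2] := truncn_itv (x0 i).
  move: h1 h2; rewrite ler_pdivlMr// ltr_pdivrMr//; set t := Num.truncn _.
  rewrite -natr1 [((_ + 1) * _)%R]mulrDl mul1r => h1 h2.
  by apply/andP; split; lra.
apply: le_trans (cube_measure_fin_subadditive cover) _.
apply: (@le_trans _ _ (\sum_(f in family Q) (eta ^+ n)%:E)).
  by apply: lee_sum => f _; apply: cube_measure_cube_le; exact: ltW.
rewrite sumEFin lee_fin; apply: le_trans etaP.
rewrite (_ : \sum_(_ in _) _ = \prod_(i < n) \sum_(j < K | Q i j) eta)%R; last first.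
  rewrite bigA_distr_big_dep; apply: eq_bigr => f _.
  by rewrite prodr_const card_ord.
apply: ler_prod => i _; rewrite sumr_const.
have -> : #|[pred j | Q i j]| = k i.
  rewrite -sum1_card -(big_ord_widen_cond _ xpredT (fun=> 1%N)) ?sum1_card ?card_ord//.
  exact: leq_bigmax.
rewrite -mulr_natl; apply/andP; split; last exact: k_le.
by apply: mulr_ge0; [exact: ler0n|exact: ltW].
Qed.

End CubeMeasure.

Section CubeCovers.
Variable R : realType.
Local Open Scope ereal_scope.
(** A cube is not covered by countably many cubes of smaller total volume. The
induction slices along the first coordinate: the cubes that meet a slice cover
it, and the lower bound in dimension m is then integrated over the slices. The
predicate P is there to select these cubes. *)
Lemma cube_cover_lower_bound m (P : nat -> bool) (A : nat -> nat -> R)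
    (r : nat -> R) (q : nat -> R) (rho : R) :
  (0 <= rho)%R -> (forall k, 0 <= r k)%R ->
  (forall x : nat -> R, (forall i, (i < m)%N -> (q i <= x i <= q i + rho)%R) ->
    exists2 k, P k & forall i, (i < m)%N -> (A k i <= x i <= A k i + r k)%R) ->
  (rho ^+ m)%:E <= \sum_(k <oo) ((P k)%:R * r k ^+ m)%:E.
Proof.
move=> rho0 r0; elim: m P A q => [|m IH] P A q cover.
  have [//|k Pk _] := cover (fun=> 0%R).
  have ge0 j : 0 <= ((P j)%:R * r j ^+ 0)%:E.
    by rewrite lee_fin expr0 mulr1 ler0n.
  apply: le_trans (nneseries_lim_ge k.+1 _) => //.
  rewrite big_nat_recr//= Pk !expr0 mulr1 leeDr//.
  by apply: sume_ge0 => j _; have := ge0 j; rewrite expr0.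
pose J k : set R := `[A k 0%N, (A k 0%N + r k)%R]%classic.
pose D : set R := `[q 0%N, (q 0%N + rho)%R]%classic.
pose c k := ((P k)%:R * r k ^+ m)%R.
have c0 k : (0 <= c k)%R by rewrite mulr_ge0 ?ler0n// exprn_ge0.
have mJ k : measurable (J k) by exact: measurable_itv.
have mD : measurable D by exact: measurable_itv.
pose f k x := (c k)%:E * (\1_(J k) x)%:E.
have f0 k x : 0 <= f k x by rewrite mule_ge0// lee_fin.
have mf k : measurable_fun D (f k).
  by apply: measurable_funeM; apply/measurable_EFinP; exact: measurable_indic.
have slice x : D x -> (rho ^+ m)%:E <= \sum_(k <oo) f k x.
  move=> Dx.
  have := IH (fun k => P k && (x \in J k)) (fun k i => A k i.+1) (fun i => q i.+1).
  have E k : f k x = ((P k && (x \in J k))%:R * r k ^+ m)%:E.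
    rewrite /f /c indicE -EFinM; congr _%:E.
    by case: (P k) => /=; case: (x \in J k); rewrite !(mul0r,mul1r,mulr1,mulr0).
  rewrite [X in _ -> _ <= X](eq_eseriesr (fun k _ => E k)); apply => y hy.
  have [|k Pk hk] := cover (fun i => if i is j.+1 then y j else x).
    by case=> [_|i hi]; [move: Dx; rewrite /D/= in_itv|exact: hy].
  exists k; last by move=> i hi; exact: (hk i.+1).
  by rewrite Pk/= inE /J /= in_itv/=; exact: (hk 0%N).
have lhs : \int[lebesgue_measure]_(x in D) (rho ^+ m)%:E = (rho ^+ m.+1)%:E.
  rewrite integral_cst//= /D lebesgue_measure_itv/= lte_fin ltrDl.
  case: ltP => [_|h]; first by rewrite -EFinD addrC addKr -EFinM exprSr.
  have -> : rho = 0%R by apply/eqP; rewrite eq_le h.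
  by rewrite mule0 exprS mul0r.
rewrite -lhs.
apply: (@le_trans _ _ (\int[lebesgue_measure]_(x in D) \sum_(k <oo) f k x)).
  apply: ge0_le_integral => //.
  - by move=> x _; rewrite lee_fin exprn_ge0.
  - by apply: ge0_emeasurable_sum => [|k _]; last exact: mf; move=> *; exact: f0.
rewrite integral_nneseries//; apply: lee_nneseries => k _.
  by move=> _; apply: integral_ge0 => x _; exact: f0.
have mi : measurable_fun D (EFin \o (\1_(J k) : R -> R)).
  by apply/measurable_EFinP; exact: measurable_indic.
rewrite ge0_integralZl_EFin//.
rewrite integral_indic//.
have -> : ((P k)%:R * r k ^+ m.+1)%:E = (c k)%:E * (r k)%:E by rewrite -EFinM exprSr mulrA.
apply: lee_wpmul2l; first by rewrite lee_fin.
apply: (@le_trans _ _ (lebesgue_measure (J k))).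
  by apply: le_measure; [apply: mem_set; exact: measurableI (mJ k) mD|apply: mem_set; exact: mJ|move=> y []].
rewrite /J lebesgue_measure_itv/= lte_fin ltrDl; case: ltP => _; rewrite ?lee_fin//.
  by rewrite addrAC subrr add0r.
exact: mJ.
Qed.

End CubeCovers.

Section Halfspaces.
Variables (R : realType) (n : nat).
Implicit Types (A B : set 'rV[R]_n) (a b x : 'rV[R]_n) (r : R).
Local Open Scope ereal_scope.

Lemma cube_gaugeP A (e : R) : (0 < e)%R -> cube_gauge A < +oo -> A !=set0 ->
  exists a r, [/\ (0 <= r)%R, A `<=` cube a r & (r ^+ n)%:E <= cube_gauge A + e%:E].
Proof.
move=> e0; rewrite /cube_gauge; case: pselect => /= [->|_]; first by move=> _ [].
set S := (X in ereal_inf X) => Soo A0.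
have fS : ereal_inf S \is a fin_num.
  rewrite ge0_fin_numE//; apply: le_ereal_inf_tmp => z [r [r0 _] <-{z}].
  by rewrite lee_fin exprn_ge0.
have [z [r [r0 [a Ar]] <-{z}] /ltW rS] := lb_ereal_inf_adherent e0 fS.
by exists a, r.
Qed.

(** Covering sets are replaced by cubes around them. An empty covering set is
dropped by the predicate of [cube_cover_lower_bound], since its gauge is 0 while
a cube of side 0 has volume 1 when n = 0. *)
Lemma cube_measure_cube_ge a r : (0 <= r)%R -> (r ^+ n)%:E <= cube_measure (cube a r).
Proof.
move=> r0; apply: le_ereal_inf_tmp => z [F [_ cover] <-{z}].
have [[k koo]|Foo] := pselect (exists k, cube_gauge (F k) = +oo).
  rewrite (eseries_pinfty _ _ koo) ?leey// => i _.
  by rewrite -ltNye (lt_le_trans _ (cube_gauge_ge0 _)).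
apply/lee_addgt0Pr => e e0.
apply: le_trans (epsilon_trick xpredT (fun k => cube_gauge_ge0 (F k)) (ltW e0)).
have [c cP] : {c : nat -> 'rV[R]_n * R & forall k, [/\ (0 <= (c k).2)%R,
    F k `<=` cube (c k).1 (c k).2 &
    ((`[< F k !=set0 >])%:R * (c k).2 ^+ n)%:E <=
      cube_gauge (F k) + (e / (2 ^ k.+1)%:R)%:E]}.
  apply: (@choice _ _ (fun k c => [/\ (0 <= c.2)%R, F k `<=` cube c.1 c.2 & 
     ((`[< F k !=set0 >])%:R * c.2 ^+ n)%:E <=
      cube_gauge (F k) + (e / (2 ^ k.+1)%:R)%:E])) => k.
  have ek : (0 < e / (2 ^ k.+1)%:R)%R by rewrite divr_gt0// ltr0n expn_gt0.
  have [/asboolT Fk0|Fk0] := pselect (F k !=set0).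
    have [||b [s [s0 Fs hs]]] := cube_gaugeP (A := F k) ek.
    - by rewrite ltey; apply/eqP => h; apply: Foo; exists k.
    - exact/asboolP.
    by exists (b, s); split => //=; rewrite Fk0 mul1r.
  exists (0%R, 0%R); split => //=; first by move=> x Fx; case: Fk0; exists x.
  by rewrite asboolF// mul0r adde_ge0 ?cube_gauge_ge0// lee_fin ltW.
pose ext (v : 'rV[R]_n) i := if insub i is Some j then v 0%R j else 0%R.
have extE v (i : nat) (hi : (i < n)%N) : ext v i = v 0%R (Ordinal hi).
  by rewrite /ext insubT.
apply: (@le_trans _ _ (\sum_(k <oo) ((`[< F k !=set0 >])%:R * (c k).2 ^+ n)%:E)).
  apply: (@cube_cover_lower_bound _ _ _ (fun k => ext (c k).1) _ (ext a)) => //.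
    by move=> k; have [] := cP k.
  move=> x xa; pose y : 'rV[R]_n := \row_i x i.
  have [i|k _ Fky] := cover y.
    have := xa i (ltn_ord i); rewrite mxE extE.
    by rewrite (_ : Ordinal (ltn_ord i) = i)//; exact: val_inj.
  exists k; first by apply/asboolP; exists y.
  move=> i hi; have [_ /(_ _ Fky)/(_ (Ordinal hi)) + _] := cP k.
  by rewrite !extE mxE.
apply: lee_nneseries => k _; last by have [] := cP k.
move=> _; have [c0 _ _] := cP k.
by rewrite lee_fin mulr_ge0 ?ler0n// exprn_ge0.
Qed.

Definition lower_halfspace (i : 'I_n) (c : R) : set 'rV[R]_n := [set x | (x 0 i <= c)%R].

(** The hyperplane cuts a cube around A into two boxes whose volumes add up to
that of the cube; d is the height of the cut, clamped to the side of the cube. *)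
Lemma cube_gauge_halfspace i c A :
  cube_measure (A `&` lower_halfspace i c) + cube_measure (A `&` ~` lower_halfspace i c)
    <= cube_gauge A.
Proof.
rewrite /cube_gauge; case: pselect => /= [->|_].
  by rewrite !set0I !outer_measure0 adde0.
apply: le_ereal_inf_tmp => z [r [r0 [a Ar]] <-{z}].
pose d := Num.min (Num.max c (a 0%R i)) (a 0%R i + r)%R.
have d1 : (a 0%R i <= d)%R by rewrite /d le_min le_max lexx orbT/= lerDl.
have d2 : (d <= a 0%R i + r)%R by rewrite /d ge_min lexx orbT.
pose b1 : 'rV[R]_n := (\row_j if j == i then d else a 0 j + r)%R.
pose a2 : 'rV[R]_n := (\row_j if j == i then d else a 0 j)%R.
pose ar : 'rV[R]_n := (\row_j (a 0 j + r))%R.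
have h1 : A `&` lower_halfspace i c `<=` box a b1.
  move=> x [/Ar xa xc] j; have /andP[-> xr]/= := xa j.
  rewrite mxE; case: eqP => [->|//]; have /andP[_ xi] := xa i.
  by rewrite /d le_min le_max xi andbT; apply/orP; left.
have h2 : A `&` ~` lower_halfspace i c `<=` box a2 ar.
  move=> x [/Ar xa /negP]; rewrite -ltNge => xc j; have /andP[xl xr] := xa j.
  rewrite !mxE; case: eqP => [->|_]; last exact/andP.
  have /andP[xil ->] := xa i; rewrite andbT /d ge_min ge_max xil (ltW xc)//.
have v1 : (\prod_j (b1 0 j - a 0 j) = (d - a 0 i) * r ^+ n.-1)%R.
  rewrite (bigD1 i)//= mxE eqxx; congr (_ * _)%R.
  rewrite (eq_bigr (fun=> r)) => [|j /negbTE ji]; last by rewrite mxE ji addrAC subrr add0r.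
  by rewrite prodr_const cardC1 card_ord.
have v2 : (\prod_j (ar 0 j - a2 0 j) = (a 0 i + r - d) * r ^+ n.-1)%R.
  rewrite (bigD1 i)//= !mxE eqxx; congr (_ * _)%R.
  rewrite (eq_bigr (fun=> r)) => [|j /negbTE ji]; last by rewrite !mxE ji addrAC subrr add0r.
  by rewrite prodr_const cardC1 card_ord.
apply: le_trans (leeD (le_outer_measure _ _ _ h1) (le_outer_measure _ _ _ h2)) _.
apply: (@le_trans _ _ ((\prod_j (b1 0 j - a 0 j))%:E + (\prod_j (ar 0 j - a2 0 j))%:E)).
  apply: leeD; apply: cube_measure_box => j; rewrite !mxE; case: eqP => [->|_]//.
  - by rewrite lerDl.
  - by rewrite lerDl.
rewrite -EFinD lee_fin v1 v2 -mulrDl (_ : (d - a 0 i) + (a 0 i + r - d) = r)%R; last by ring.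
by rewrite -exprS prednK// (leq_ltn_trans _ (ltn_ord i)).
Qed.

Lemma caratheodory_halfspace i c :
  caratheodory_measurable (@cube_measure R n) (lower_halfspace i c).
Proof.
apply: le_caratheodory_measurable => X.
apply: le_ereal_inf_tmp => z [F [_ XF] <-{z}].
set H := lower_halfspace i c.
apply: (@le_trans _ _ (\sum_(k <oo) (cube_measure (F k `&` H) + cube_measure (F k `&` ~` H)))).
  rewrite nneseriesD//; last 2 first.
  - by move=> k _ _; exact: outer_measure_ge0.
  - by move=> k _ _; exact: outer_measure_ge0.
  apply: leeD; apply: le_trans (outer_measure_sigma_subadditive _ _);
    by rewrite -setI_bigcupl; apply: le_outer_measure; exact: setSI.
apply: lee_nneseries => k _; last exact: cube_gauge_halfspace.
by move=> _; apply: adde_ge0; exact: outer_measure_ge0.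
Qed.

End Halfspaces.

(** * Lebesgue measurable sets are Caratheodory measurable *)

Section LebesgueMeasurableSets.
Variables (R : realType) (n : nat).
Implicit Types (A B : set 'rV[R]_n) (a b x : 'rV[R]_n) (r : R).
Local Notation cara := (caratheodory_type (@cube_measure R n)).

(** An open set is a union of half-open boxes with rational centres and sides,
and these boxes are intersections of differences of half-spaces. *)
Lemma caratheodory_open (U : set 'rV[R]_n) : open U ->
  measurable (U : set cara).
Proof.
move=> oU.
pose hcube (a b : 'rV[R]_n) : set cara := [set x | forall i, a 0 i < x 0 i <= b 0 i].
have mh a b : measurable (hcube a b).
  have -> : hcube a b = \bigcap_(i in [set: 'I_n])
      (lower_halfspace i (b 0 i) `\` lower_halfspace i (a 0 i) : set cara).
    apply/seteqP; split => x /=.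
      move=> h i _; have /andP[h1 h2] := h i; split => //.
      by apply/negP; rewrite -ltNge.
    move=> h i; have [/= h1 /negP] := h i I.
    by rewrite -ltNge => h2; rewrite h2.
  apply: fin_bigcap_measurable => [|i _]; first exact: finite_finset.
  by apply: measurableD; exact: caratheodory_halfspace.
pose lo (p : 'rV[rat]_n * nat) : 'rV[R]_n := \row_i (ratr (p.1 0 i) - p.2.+1%:R^-1).
pose hi (p : 'rV[rat]_n * nat) : 'rV[R]_n := \row_i (ratr (p.1 0 i) + p.2.+1%:R^-1).
pose F p : set cara := if pselect (hcube (lo p) (hi p) `<=` U)
                       then hcube (lo p) (hi p) else set0.
have -> : U = \bigcup_p F p; last first.
  apply: countable_bigcupT_measurable; first exact: countableP.
  by move=> p; rewrite /F; case: pselect => /= _; [exact: mh|exact: measurable0].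
apply/seteqP; split => x; last first.
  by move=> [p _]; rewrite /F; case: pselect => //= h; exact: h.
move=> Ux; have /nbhs_ballP[e /= e0 eU] : nbhs x U by exact: open_nbhs_nbhs.
pose k := Num.truncn (2 / e).
have k1 : (k.+1%:R^-1 : R) < e / 2.
  rewrite -[e / 2]invrK invf_div ltf_pV2 ?posrE ?divr_gt0// ?ltr0n//.
  by rewrite truncnS_gt.
have k0 : 0 < (k.+1%:R^-1 : R) by rewrite invr_gt0 ltr0n.
have qx i : exists q : rat, x 0 i - k.+1%:R^-1 < ratr q < x 0 i + k.+1%:R^-1.
  have [|q] := @rat_in_itvoo R (x 0 i - k.+1%:R^-1) (x 0 i + k.+1%:R^-1).
    by rewrite ltrBlDr -addrA ltrDl addr_gt0.
  by rewrite in_itv/= => h; exists q.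
have [q qP] := choice qx.
exists (\row_i q i, k) => //; rewrite /F; case: pselect => /= [_|] /=.
  move=> i; rewrite !mxE/=; have := qP i.
  by set d := (_.+1%:R^-1 : R) => /andP[h1 h2]; apply/andP; split; lra.
apply; move=> y hy; apply: eU; split => // i j; rewrite ord1 /ball/=.
have := hy j; have := qP j; rewrite !mxE/=; move: k1 k0.
set d := (_.+1%:R^-1 : R) => k1 k0 /andP[h3 h4] /andP[h1 h2].
by rewrite ltr_distlC; apply/andP; split; lra.
Qed.

Lemma cube_measure_null A : lebesgue_null A -> cube_measure A = 0%E.
Proof.
move=> Anull; apply/eqP; rewrite eq_le outer_measure_ge0 andbT.
apply/lee_addgt0Pr => e e0; rewrite add0e.
have [D [a [b [ab cover vol]]]] := Anull e e0.
apply: le_trans vol.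
pose F k := if k \in D then box (a k) (b k) else set0.
have v0 k : (0 <= (\prod_(i < n) (b k 0 i - a k 0 i))%:E)%E.
  by rewrite lee_fin; apply: prodr_ge0 => i _; rewrite subr_ge0.
apply: (@le_trans _ _ (\sum_(k <oo) cube_measure (F k))%E).
  apply: le_trans (outer_measure_sigma_subadditive _ _).
  apply: le_outer_measure => x /cover[k Dk xk].
  by exists k => //; rewrite /F mem_set.
rewrite nneseries_esumT; last by move=> k; exact: outer_measure_ge0.
rewrite [leRHS]esum_mkcond; apply: le_esum => k _; rewrite /F.
by case: ifPn => _; [exact: cube_measure_box|rewrite outer_measure0].
Qed.

Lemma caratheodory_lebesgue A : lebesgue_measurable A -> measurable (A : set cara).
Proof.
move=> [B mB nAB].
have mB' : measurable (B : set cara).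
  move: B mB {nAB}; apply: smallest_sub; last exact: caratheodory_open.
  split; first exact: measurable0.
  - by move=> X mX; rewrite setTD; exact: measurableC.
  - by move=> F mF; exact: bigcupT_measurable.
have nullm C : lebesgue_null C -> measurable (C : set cara).
  move=> /cube_measure_null C0; apply: le_caratheodory_measurable => X.
  change (cube_measure (X `&` C) + cube_measure (X `&` ~` C) <= cube_measure X)%E.
  have -> : cube_measure (X `&` C) = 0%E.
    apply/eqP; rewrite eq_le outer_measure_ge0 andbT -C0.
    by apply: le_outer_measure => x [].
  by rewrite add0e; apply: le_outer_measure => x [].
have sub C D : lebesgue_null D -> C `<=` D -> lebesgue_null C.
  move=> h CD e e0; have [E [a [b [h1 h2 h3]]]] := h e e0.
  by exists E, a, b; split => //; exact: subset_trans h2.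
have -> : A = (B `\` (B `\` A)) `|` (A `\` B).
  apply/seteqP; split => x.
    by move=> Ax; have [Bx|Bx] := pselect (B x); [left; split => // -[]|right].
  by move=> [[Bx /not_andP[//|/contrapT]]|[]].
apply: measurableU; last by apply: nullm; apply: sub nAB _ => x; left.
by apply: measurableD => //; apply: nullm; apply: sub nAB _ => x; right.
Qed.

Lemma caratheodory_cube a r : measurable (cube a r : set cara).
Proof.
have -> : cube a r = \bigcap_(i in [set: 'I_n])
    ((lower_halfspace i (a 0 i + r) : set cara) `&` ~` [set x : 'rV[R]_n | x 0 i < a 0 i]).
  apply/seteqP; split => x /=.
    by move=> h i _; have /andP[h1 h2] := h i; split => //; apply/negP; rewrite -leNgt.
  by move=> h i; have [/= h1 /negP] := h i I; rewrite -leNgt => h2; rewrite h2.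
apply: fin_bigcap_measurable => [|i _]; first exact: finite_finset.
apply: measurableI; first exact: caratheodory_halfspace.
apply: measurableC; apply: caratheodory_open.
rewrite (_ : [set _ | _] = (fun x : 'rV[R]_n => x 0 i) @^-1` [set y | y < a 0 i])//.
apply: open_comp; last exact: open_lt.
by move=> x _; exact: coord_continuous.
Qed.

(** The sets where u is at least k decrease to the empty set, so continuity from
above applies in a cube, which has finite measure. *)
Lemma superlevel_measure_small (Omega : set 'rV[R]_n) (u : 'rV[R]_n -> R) a r e :
  lebesgue_measurable_fun Omega u -> 0 <= r -> cube a r `<=` Omega -> 0 < e ->
  exists M : R, (cube_measure (cube a r `&` [set x | (M < u x)%R]) < e%:E)%E.
Proof.
move=> mu r0 QO e0.
pose F k : set cara := cube a r `&` (Omega `&` u @^-1` `]k%:R, +oo[).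
have mF k : measurable (F k).
  apply: measurableI; first exact: caratheodory_cube.
  by apply: caratheodory_lebesgue; apply: mu; exact: measurable_itv.
have F0 : \bigcap_k F k = set0.
  apply/seteqP; split => // x h.
  have := h (Num.truncn `|u x|).+1 I; move=> [_ [_ /=]]; rewrite in_itv/= andbT.
  by apply/negP; rewrite -leNgt (le_trans (ler_norm _))// ltW// truncnS_gt.
have mF0 : measurable (\bigcap_k F k) by rewrite F0.
have : (@cube_measure R n : set cara -> _) \o F @ \oo --> cube_measure (\bigcap_k F k).
  pose om : {outer_measure set 'rV[R]_n -> \bar R} := @cube_measure R n.
  apply: (@nonincreasing_cvg_mu _ cara R (om : {measure set (caratheodory_type om) -> \bar R})) => //.
    apply: (@le_lt_trans _ _ (r ^+ n)%:E); last exact: ltry.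
    apply: le_trans (cube_measure_cube_le a r0).
    by apply: le_outer_measure => x [].
  apply/nonincreasing_seqP => k; apply/subsetPset => x [xQ [xO]].
  rewrite /= !in_itv/= !andbT => h; split => //; split => //=.
  by rewrite in_itv/= andbT (lt_trans _ h)// ltr_nat.
rewrite F0 outer_measure0 => cv.
have : nbhs (0%E : \bar R) [set y | (y < e%:E)%E] by exact: (@nbhs_open_ereal_lt _ 0 (fun=> e)).
move=> /cv[k _ /(_ k (leqnn k))] /= hk.
exists k%:R; apply: le_lt_trans hk; apply: le_outer_measure => x [xQ /= h].
by split => //; split; [exact: QO|rewrite /= in_itv/= andbT].
Qed.

(** The inverse of f is C-Lipschitz, so the points of S sent into a cube of side
r lie within C r of any of them, hence in a cube of side 2 C r. *)
Lemma expanding_preimage_measure (S B : set 'rV[R]_n) (f : 'rV[R]_n -> 'rV[R]_n) (C : R) :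
  0 < C -> (forall s s', S s -> S s' -> `|s - s'| <= C * `|f s - f s'|) ->
  (cube_measure (S `&` f @^-1` B) <= ((2 * C) ^+ n)%:E * cube_measure B)%E.
Proof.
move=> C0 fS.
have K0 : 0 < (2 * C) ^+ n by rewrite exprn_gt0// mulr_gt0.
have gauge A : (cube_measure (S `&` f @^-1` A) <= ((2 * C) ^+ n)%:E * cube_gauge A)%E.
  rewrite -lee_pdivrMl// /cube_gauge; case: pselect => /= [->|_].
    by rewrite preimage_set0 setI0 outer_measure0 mule0.
  apply: le_ereal_inf_tmp => z [r [r0 [a Ar]] <-{z}].
  rewrite lee_pdivrMl// -EFinM -exprMn_comm; last exact: mulrC.
  have [->|/set0P[s0 [Ss0 As0]]] := eqVneq (S `&` f @^-1` A) set0.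
    by rewrite outer_measure0 lee_fin exprn_ge0// !mulr_ge0// ltW.
  have Cr0 : 0 <= C * r by rewrite mulr_ge0// ltW.
  apply: le_trans (cube_measure_cube_le (s0 - const_mx (C * r)) _); last first.
    by rewrite -mulrA mulr_ge0.
  apply: le_outer_measure => s [Ss As] i; rewrite !mxE.
  have : `|s 0 i - s0 0 i| <= C * r.
    have := norm_coord_le (s - s0) i; rewrite !mxE => /le_trans; apply.
    apply: le_trans (fS _ _ Ss Ss0) _; rewrite ler_pM2l//.
    rewrite [leLHS]/Num.norm/= mx_normrE; apply/bigmax_leP; split => // -[i' j] _ /=.
    rewrite ord1 !mxE ler_distl.
    have /andP[h1 h2] := Ar _ As j; have /andP[h3 h4] := Ar _ As0 j.
    by apply/andP; split; lra.
  by rewrite ler_distl => /andP[h1 h2]; apply/andP; split; lra.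
rewrite -lee_pdivrMl//; apply: le_ereal_inf_tmp => z [F [_ BF] <-{z}].
rewrite lee_pdivrMl//.
apply: (@le_trans _ _ (\sum_(k <oo) cube_measure (S `&` f @^-1` (F k)))%E).
  apply: le_trans (outer_measure_sigma_subadditive _ _).
  apply: le_outer_measure => s [Ss /BF[k _ Fk]].
  by exists k.
rewrite -nneseriesZl; last by move=> k _; exact: cube_gauge_ge0.
by apply: lee_nneseries => k _; [move=> _; exact: outer_measure_ge0|exact: gauge].
Qed.

End LebesgueMeasurableSets.

(** * Low-order terms of the Baker-Campbell-Hausdorff product *)

Section TupleSums.
Variables (V : nmodType) (T : finType).

Lemma big_tuple1 (P : pred (1.-tuple T)) (F : 1.-tuple T -> V) :
  \sum_(t | P t) F t = \sum_(a | P [tuple a]) F [tuple a].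
Proof.
rewrite (reindex (fun a : T => [tuple a])) //.
exists (@thead 0 T) => [a _|t _]; first exact: theadE.
by apply: val_inj; case: t => -[|a []].
Qed.

Lemma big_tuple2 (P : pred (2.-tuple T)) (F : 2.-tuple T -> V) :
  \sum_(t | P t) F t =
  \sum_(a | P [tuple a.1; a.2]) F [tuple a.1; a.2].
Proof.
rewrite (reindex (fun a : T * T => [tuple a.1; a.2])) //.
exists (fun t => (tnth t 0, tnth t 1)) => [[a b] _|t _] //=.
by apply: val_inj; case: t => -[|a [|b []]]//= h; rewrite !(tnth_nth a).
Qed.

End TupleSums.

Section BCHLowOrder.
Variables (R : fieldType) (V : lmodType R) (br : V -> V -> V).

(** These brackets are of order three in (x, y), one more than the terms
x + y + [x, y] / 2 that determine the conjugates of a vector to second order. *)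
Definition bch_high N (x y : V) : V :=
  \sum_(1 <= k < N.+1)
    \sum_(t : k.-tuple ('I_N.+1 * 'I_N.+1)
         | all (fun rs => 0 < rs.1 + rs.2)%N (bch_exponents t) &&
           (2 < size (bch_word (bch_exponents t) x y))%N)
      bch_coef R (bch_exponents t) *:
        nested_bracket br (bch_word (bch_exponents t) x y).

Hypothesis br_alt : forall x, br x x = 0.
Hypothesis brN : forall x y, br y x = - br x y.

Lemma size_bch_word (x y : V) t : (all (fun rs => 0 < rs.1 + rs.2)%N t ->
  size t <= size (bch_word t x y))%N.
Proof.
elim: t => //= a t IH /andP[a0 /IH h].
by rewrite /bch_word/= size_cat -/(bch_word t x y) -add1n leq_add// size_cat !size_nseq.
Qed.

Definition exponent_pair N (i j : nat) : 'I_N.+2 * 'I_N.+2 := (inord i, inord j).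

(** The pairs of exponents of total degree at most 2; the pairs (2, 0) and
(0, 2) give the brackets [x, x] and [y, y]. *)
Lemma big_low (N : nat) (F : 'I_N.+2 * 'I_N.+2 -> V) :
  (forall a, nat_of_ord a.1 = 2 -> nat_of_ord a.2 = 0 -> F a = 0) ->
  (forall a, nat_of_ord a.1 = 0 -> nat_of_ord a.2 = 2 -> F a = 0) ->
  \sum_(a | (0 < val a.1 + val a.2)%N && (val a.1 + val a.2 <= 2)%N) F a =
  F (exponent_pair N 1 0) + F (exponent_pair N 0 1) + F (exponent_pair N 1 1).
Proof.
move=> F20 F02.
have v (i : nat) : (i <= 1)%N -> val (inord i : 'I_N.+2) = i.
  by move=> hi; rewrite /= inordK// ltnS (leq_trans hi).
rewrite (bigD1 (exponent_pair N 1 0)) ?v//= -addrA; congr (_ + _).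
rewrite (bigD1 (exponent_pair N 0 1)) ?v//=; last first.
  by rewrite xpair_eqE negb_and -val_eqE/= !inordK.
congr (_ + _).
rewrite (bigD1 (exponent_pair N 1 1)) ?v//=; last first.
  by rewrite !xpair_eqE !negb_and -!val_eqE/= !inordK.
rewrite big1 ?addr0// => -[i j] /=.
rewrite !xpair_eqE -!val_eqE/= !inordK//.
case: i => -[|[|[|i]]] hi; case: j => -[|[|[|j]]] hj //= _.
- exact: F02.
- exact: F20.
Qed.


Lemma bch_low1 N (x y : V) :
  \sum_(t : 1.-tuple ('I_N.+2 * 'I_N.+2)
       | all (fun rs => 0 < rs.1 + rs.2)%N (bch_exponents t) &&
         ~~ (2 < size (bch_word (bch_exponents t) x y))%N)
    bch_coef R (bch_exponents t) *: nested_bracket br (bch_word (bch_exponents t) x y)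
  = x + y + 2^-1 *: br x y.
Proof.
rewrite big_tuple1.
rewrite (eq_bigl (fun a => (0 < val a.1 + val a.2)%N && (val a.1 + val a.2 <= 2)%N)); last first.
  by move=> a; rewrite /= andbT -leqNgt /bch_word/= cats0 size_cat !size_nseq.
rewrite big_low.
- rewrite /bch_exponents /bch_word /bch_coef /= !inordK//= !big_cons !big_nil /=.
  by rewrite !(expr0, mul1n, muln1, addn0, invr1, mul1r, scale1r).
- by case=> a b /= h1 h2; rewrite /bch_word /bch_exponents /= h1 h2 /= br_alt scaler0.
- by case=> a b /= h1 h2; rewrite /bch_word /bch_exponents /= h1 h2 /= br_alt scaler0.
Qed.

(** Only the words xy and yx of two letters matter, and they have the same
coefficient and opposite brackets. *)
Lemma bch_low2 N (x y : V) :
  \sum_(t : 2.-tuple ('I_N.+2 * 'I_N.+2)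
       | all (fun rs => 0 < rs.1 + rs.2)%N (bch_exponents t) &&
         ~~ (2 < size (bch_word (bch_exponents t) x y))%N)
    bch_coef R (bch_exponents t) *: nested_bracket br (bch_word (bch_exponents t) x y)
  = 0.
Proof.
rewrite big_tuple2.
pose low (a : 'I_N.+2 * 'I_N.+2) := (0 < val a.1 + val a.2)%N && (val a.1 + val a.2 <= 2)%N.
pose F p q := bch_coef R (bch_exponents [tuple p; q]) *:
  nested_bracket br (bch_word (bch_exponents ([tuple p; q] : 2.-tuple ('I_N.+2 * 'I_N.+2))) x y).
rewrite (eq_bigl (fun a => low a.1 && (low a.2 && ((val a.1.1 + val a.1.2) + (val a.2.1 + val a.2.2) <= 2)%N))); last first.
  move=> [[a b] [c d]]; rewrite /low /= -leqNgt /bch_word/= cats0 !size_cat !size_nseq.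
  by case: (val a + val b)%N => [|[|[|m]]]; case: (val c + val d)%N => [|[|[|m']]].
rewrite -(pair_big_dep low (fun p q => low q && ((val p.1 + val p.2) + (val q.1 + val q.2) <= 2)%N) F).
under eq_bigr do rewrite big_mkcondr.
have z p : (2 <= val p.1 + val p.2)%N -> \sum_(q | low q)
    (if ((val p.1 + val p.2) + (val q.1 + val q.2) <= 2)%N then F p q else 0) = 0.
  move=> hp; apply: big1 => q /andP[q0 _]; rewrite ifF//; apply/negbTE.
  by rewrite -ltnNge -addn1 (leq_ltn_trans _ (_ : 2 + (val q.1 + val q.2) <= _)%N)// ?leq_add2r// addn1 -addn1 leq_add2l.
rewrite big_low; last 2 first.
- by move=> p h1 h2; apply: z; rewrite /= h1 h2.
- by move=> p h1 h2; apply: z; rewrite /= h1 h2.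
rewrite (z (exponent_pair N 1 1)); last by rewrite /= !inordK.
rewrite addr0 !big_low.
- rewrite /F /bch_exponents /bch_word /bch_coef /= !inordK//= !big_cons !big_nil /=.
  rewrite !br_alt (brN x y) !(scaler0, add0r, addr0) scalerN.
  by rewrite !(mul1n, muln1, addn0, add0n) subrr.
all: by move=> a h1 h2; rewrite /= h1 h2 !inordK.
Qed.

(** The terms with k >= 3 involve words of at least three letters, so only k = 1
and k = 2 contribute to the low order. *)
Lemma bchE N (x y : V) : (0 < N)%N ->
  bch br N x y = x + y + 2^-1 *: br x y + bch_high N x y.
Proof.
case: N => [|N]// _; rewrite /bch /bch_high.
under eq_bigr => k _ do rewrite (bigID (fun t => (2 < size (bch_word (bch_exponents t) x y))%N))/=.
rewrite big_split/= addrC; congr (_ + _).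
rewrite big_ltn// bch_low1 big_nat big1 ?addr0// => k /andP[].
rewrite leq_eqVlt => /orP[/eqP<- _|k2 _]; first exact: bch_low2.
rewrite big_pred0// => t; apply/negbTE/negP => /andP[/(size_bch_word x y) h /negP]; apply.
by apply: leq_trans h; rewrite size_map size_tuple.
Qed.


Hypothesis br0 : forall x, br x 0 = 0.

Lemma nested_bracket_commuting (x y : V) w : br x y = 0 -> {subset w <= [:: x; y]} ->
  (1 < size w)%N -> nested_bracket br w = 0.
Proof.
move=> xy; have yx : br y x = 0 by rewrite brN xy oppr0.
elim: w => [//|a w IH] sw; case: w IH sw => [//|b w] IH sw _ /=.
have ha : a \in [:: x; y] by apply: sw; rewrite mem_head.
have sw' : {subset b :: w <= [:: x; y]} by move=> c hc; apply: sw; rewrite in_cons hc orbT.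
case: w IH sw sw' => [|c w] IH _ sw'; last by move: (IH sw' isT) => /= ->.
have hb : b \in [:: x; y] by apply: sw'; rewrite mem_head.
by move: ha hb; rewrite !inE => /orP[]/eqP-> /orP[]/eqP->.
Qed.

Lemma bch_high_commuting N (x y : V) : br x y = 0 -> bch_high N x y = 0.
Proof.
move=> xy; apply: big1_seq => k _; apply: big1 => t /andP[_ h].
rewrite (nested_bracket_commuting xy) ?scaler0//; last exact: ltnW.
move=> a /flattenP[s /mapP[[i j] _ ->]]; rewrite mem_cat /= !inE.
by case/orP => /nseqP[-> _]; rewrite eqxx ?orbT.
Qed.

Lemma bch_commuting N (x y : V) : (0 < N)%N -> br x y = 0 -> bch br N x y = x + y.
Proof.
by move=> N0 xy; rewrite bchE// xy scaler0 addr0 bch_high_commuting// addr0.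
Qed.

End BCHLowOrder.

(** * The group law in exponential coordinates *)

Section GroupLaw.
Variables (R : realType) (n : nat) (G : stratified_group R n).
Implicit Types x y z : 'rV[R]_n.
Local Notation "x ** y" := (sg_mul G x y) (at level 40, left associativity).
Local Notation "[[ x , y ]]" := (sg_bracket G x y).
Local Notation N := (sg_step G).

Lemma sg_bracketC x y : [[ y, x ]] = - [[ x, y ]].
Proof.
apply/eqP; rewrite -addr_eq0 addrC; apply/eqP.
by have := sg_bracket_alt G (x + y); rewrite linearDl !linearDr/= !sg_bracket_alt add0r addr0.
Qed.

Lemma sg_bracket0r x : [[ x, 0 ]] = 0. Proof. exact: linear0r. Qed.

Lemma sg_mul_commuting x y : [[ x, y ]] = 0 -> x ** y = x + y.
Proof.
move=> xy; rewrite sg_mul_bch; apply: bch_commuting => //.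
- exact: sg_bracket_alt.
- exact: sg_bracketC.
- exact: sg_bracket0r.
- exact: sg_step_gt0.
Qed.

Lemma sg_mulE x y : x ** y = x + y + 2^-1 *: [[ x, y ]] + bch_high (sg_bracket G) N x y.
Proof.
by rewrite sg_mul_bch bchE//; [exact: sg_bracket_alt|exact: sg_bracketC|exact: sg_step_gt0].
Qed.

Lemma sg_mulg0 x : x ** 0 = x.
Proof. by rewrite sg_mul_commuting ?addr0// sg_bracket0r. Qed.

Lemma sg_mulZZ (s t : R) x : (s *: x) ** (t *: x) = (s + t) *: x.
Proof.
rewrite sg_mul_commuting ?scalerDl//.
by rewrite linearZl_LR/= linearZr_LR/= sg_bracket_alt !scaler0.
Qed.

Lemma sg_mulNg x : (- x) ** x = 0.
Proof. by have := sg_mulZZ (-1) 1 x; rewrite scaleN1r scale1r addNr scale0r. Qed.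

Lemma sg_mulgN x : x ** (- x) = 0.
Proof. by have := sg_mulNg (- x); rewrite opprK. Qed.

Lemma sg_invE x : sg_inv G x = - x.
Proof.
by rewrite -[LHS]sg_mulg0 -(sg_mulgN x) sg_mulA sg_mulVg sg_mul0g.
Qed.

Lemma sg_mulKg x y : (- x) ** (x ** y) = y.
Proof. by rewrite sg_mulA sg_mulNg sg_mul0g. Qed.

Lemma sg_mulNKg x y : x ** ((- x) ** y) = y.
Proof. by rewrite sg_mulA sg_mulgN sg_mul0g. Qed.

Lemma sg_mulgI x y z : x ** y = x ** z -> y = z.
Proof. by move=> /(congr1 (sg_mul G (- x))); rewrite !sg_mulKg. Qed.

Lemma sg_oppM x y : - (x ** y) = (- y) ** (- x).
Proof.
apply: (@sg_mulgI (x ** y)).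
by rewrite sg_mulgN -sg_mulA (sg_mulA G y) sg_mulgN sg_mul0g sg_mulgN.
Qed.

End GroupLaw.

(** * Lipschitz estimates for maps built from the bracket *)

Section BracketBound.
Variables (R : realType) (n : nat) (G : stratified_group R n).

Lemma norm_bracket_le : exists2 C : R, 0 <= C &
  forall x y : 'rV[R]_n, `|sg_bracket G x y| <= C * `|x| * `|y|.
Proof.
pose C := \sum_i \sum_j `|sg_bracket G (delta_mx 0 i) (delta_mx 0 j)|.
exists C; first by apply: sumr_ge0 => i _; apply: sumr_ge0.
move=> x y.
rewrite {1}(row_sum_delta x) linear_sumlz.
apply: le_trans (ler_norm_sum _ _ _) _; rewrite !mulr_suml; apply: ler_sum => i _.
rewrite {1}(row_sum_delta y) linear_sumr.
apply: le_trans (ler_norm_sum _ _ _) _; rewrite !mulr_suml; apply: ler_sum => j _.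
rewrite linearZl_LR/= linearZr_LR/= !normrZ mulrA mulrC -mulrA.
by apply: ler_wpM2l => //; apply: ler_pM => //; exact: norm_coord_le.
Qed.

End BracketBound.

Section PolynomialEstimates.
Variables (R : realType) (n : nat) (G : stratified_group R n).
Variables (T : Type) (D : set T) (nrm : T -> R) (dst : T -> T -> R) (rho : R).
Hypothesis nrm_ge0 : forall p, D p -> 0 <= nrm p.
Hypothesis nrm_le : forall p, D p -> nrm p <= rho.
Hypothesis rho_ge0 : 0 <= rho.
Hypothesis dst_ge0 : forall p q, D p -> D q -> 0 <= dst p q.
Implicit Types F H : T -> 'rV[R]_n.

(** A family F p of vectors that is of the size of the parameter, measured by
nrm, and Lipschitz for the distance dst. *)
Definition small F := exists2 C : R, 0 <= C &
  (forall p, D p -> `|F p| <= C * nrm p) /\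
  (forall p q, D p -> D q -> `|F p - F q| <= C * dst p q).

(** The remainders admitted by the inverse function theorem: their Lipschitz
constant tends to 0 with the parameters. Brackets of two [small] families are such
remainders. *)
Definition quad F := exists2 C : R, 0 <= C &
  (forall p, D p -> `|F p| <= C * nrm p) /\
  (forall p q, D p -> D q -> `|F p - F q| <= C * (nrm p + nrm q) * dst p q).

Definition vanishing_order d F := exists2 C : R, 0 <= C &
  forall p, D p -> `|F p| <= C * nrm p ^+ d.

Lemma quad_small F : quad F -> small F.
Proof.
move=> [C C0 [h1 h2]]; exists (C + C * (rho + rho)).
  by rewrite addr_ge0// mulr_ge0// addr_ge0.
split=> [p Dp|p q Dp Dq].
  apply: le_trans (h1 p Dp) _; rewrite ler_wpM2r ?nrm_ge0//.
  by rewrite lerDl mulr_ge0// addr_ge0.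
apply: le_trans (h2 p q Dp Dq) _; rewrite ler_wpM2r ?dst_ge0//.
apply: (@le_trans _ _ (C * (rho + rho))); last by rewrite lerDr.
by rewrite ler_wpM2l// lerD// nrm_le.
Qed.

Lemma small0 : small (fun=> 0).
Proof. by exists 0 => //; split=> *; rewrite ?subrr normr0 mul0r. Qed.

Lemma quad0 : quad (fun=> 0).
Proof. by exists 0 => //; split=> *; rewrite ?subrr normr0 !mul0r. Qed.

Lemma order0 d : vanishing_order d (fun=> 0).
Proof. by exists 0 => //; move=> *; rewrite normr0 mul0r. Qed.

Lemma smallD F H : small F -> small H -> small (fun p => F p + H p).
Proof.
move=> [C C0 [h1 h2]] [C' C'0 [h1' h2']]; exists (C + C'); first exact: addr_ge0.
split=> [p Dp|p q Dp Dq]; rewrite mulrDl.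
  by apply: le_trans (ler_normD _ _) _; rewrite lerD ?h1 ?h1'.
by rewrite opprD addrACA; apply: le_trans (ler_normD _ _) _; rewrite lerD ?h2 ?h2'.
Qed.

Lemma quadD F H : quad F -> quad H -> quad (fun p => F p + H p).
Proof.
move=> [C C0 [h1 h2]] [C' C'0 [h1' h2']]; exists (C + C'); first exact: addr_ge0.
split=> [p Dp|p q Dp Dq]; rewrite !mulrDl.
  by apply: le_trans (ler_normD _ _) _; rewrite lerD ?h1 ?h1'.
by rewrite opprD addrACA; apply: le_trans (ler_normD _ _) _; rewrite lerD ?h2 ?h2'.
Qed.

Lemma orderD d F H : vanishing_order d F -> vanishing_order d H -> vanishing_order d (fun p => F p + H p).
Proof.
move=> [C C0 h1] [C' C'0 h1']; exists (C + C'); first exact: addr_ge0.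
move=> p Dp; rewrite mulrDl.
by apply: le_trans (ler_normD _ _) _; rewrite lerD ?h1 ?h1'.
Qed.

Lemma quadZ (c : R) F : quad F -> quad (fun p => c *: F p).
Proof.
move=> [C C0 [h1 h2]]; exists (`|c| * C); first by rewrite mulr_ge0.
split=> [p Dp|p q Dp Dq]; rewrite -?scalerBr normrZ -!mulrA ler_wpM2l//.
  exact: h1.
by rewrite mulrA; exact: h2.
Qed.

Lemma orderZ d (c : R) F : vanishing_order d F -> vanishing_order d (fun p => c *: F p).
Proof.
move=> [C C0 h1]; exists (`|c| * C); first by rewrite mulr_ge0.
by move=> p Dp; rewrite normrZ -!mulrA ler_wpM2l// h1.
Qed.

Lemma quad_bracket F H : small F -> small H -> quad (fun p => sg_bracket G (F p) (H p)).
Proof.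
move=> [C C0 [h1 h2]] [C' C'0 [h1' h2']].
have [B B0 brB] := norm_bracket_le G.
have K0 : 0 <= B * C * C' by rewrite !mulr_ge0.
exists (B * C * C' + B * C * C' * rho); first by rewrite addr_ge0// mulr_ge0.
have bnd x y a b : `|x| <= C * a -> `|y| <= C' * b ->
    `|sg_bracket G x y| <= B * C * C' * (a * b).
  move=> xa yb; apply: le_trans (brB _ _) _.
  rewrite [leRHS](_ : _ = B * (C * a) * (C' * b)); last by ring.
  by apply: ler_pM => //; [exact: mulr_ge0|exact: ler_wpM2l].
split=> [p Dp|p q Dp Dq].
  apply: le_trans (bnd _ _ _ _ (h1 p Dp) (h1' p Dp)) _.
  rewrite mulrA ler_wpM2r ?nrm_ge0//.
  by apply: (@le_trans _ _ (B * C * C' * rho)); rewrite ?ler_wpM2l ?nrm_le// lerDr.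
rewrite (_ : _ - _ = sg_bracket G (F p) (H p - H q) + sg_bracket G (F p - F q) (H q)); last first.
  by rewrite linearBr linearBl/= addrA subrK.
apply: le_trans (ler_normD _ _) _.
apply: (@le_trans _ _ (B * C * C' * (nrm p * dst p q) + B * C * C' * (dst p q * nrm q))).
  by apply: lerD; apply: bnd; [exact: h1|exact: h2'|exact: h2|exact: h1'].
set K := B * C * C'.
rewrite (_ : _ + _ = K * (nrm p + nrm q) * dst p q); last by ring.
rewrite ler_wpM2r ?dst_ge0// ler_wpM2r ?addr_ge0 ?nrm_ge0//.
by rewrite lerDl mulr_ge0.
Qed.

Lemma order_bracket d e F H : vanishing_order d F -> vanishing_order e H ->
  vanishing_order (d + e) (fun p => sg_bracket G (F p) (H p)).
Proof.
move=> [C C0 h] [C' C'0 h'].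
have [B B0 brB] := norm_bracket_le G.
exists (B * C * C'); first by rewrite !mulr_ge0.
move=> p Dp; apply: le_trans (brB _ _) _.
rewrite exprD [leRHS](_ : _ = B * (C * nrm p ^+ d) * (C' * nrm p ^+ e)); last by ring.
by apply: ler_pM; rewrite ?mulr_ge0 ?ler_wpM2l ?h ?h'.
Qed.

Lemma orderS d F : vanishing_order d.+1 F -> vanishing_order d F.
Proof.
move=> [C C0 h]; exists (C * rho); first exact: mulr_ge0.
move=> p Dp; apply: le_trans (h p Dp) _; rewrite exprS mulrA.
by rewrite ler_wpM2r ?exprn_ge0 ?nrm_ge0// ler_wpM2l ?nrm_le.
Qed.

Lemma small_order F : small F -> vanishing_order 1 F.
Proof. by move=> [C C0 [h _]]; exists C. Qed.

Lemma small_nested F H (b : seq bool) : small F -> small H ->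
  small (fun p => nested_bracket (sg_bracket G) [seq if c then F p else H p | c <- b]).
Proof.
move=> sF sH; elim: b => [|a b IH]; first exact: small0.
have sa : small (fun p => if a then F p else H p) by case: a.
case: b IH => [|c b] IH //.
apply: quad_small; exact: quad_bracket sa IH.
Qed.

Lemma quad_nested F H (b : seq bool) : small F -> small H -> (1 < size b)%N ->
  quad (fun p => nested_bracket (sg_bracket G) [seq if c then F p else H p | c <- b]).
Proof.
move=> sF sH; case: b => [|a [|c b]]// _.
have sa : small (fun p => if a then F p else H p) by case: a.
exact: quad_bracket sa (small_nested (c :: b) sF sH).
Qed.

Lemma order_nested F H (b : seq bool) : small F -> small H -> (0 < size b)%N ->
  vanishing_order (size b) (fun p => nested_bracket (sg_bracket G) [seq if c then F p else H p | c <- b]).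
Proof.
move=> sF sH; elim: b => [//|a b IH] _.
have sa : small (fun p => if a then F p else H p) by case: a.
case: b IH => [|c b] IH; first exact: small_order.
exact: (order_bracket (small_order sa) (IH isT)).
Qed.

(** The pattern of a word in two letters, kept apart from the values of the
letters so that estimates can be proved by induction on the pattern. *)
Definition word_letters (t : seq (nat * nat)) : seq bool :=
  flatten [seq nseq rs.1 true ++ nseq rs.2 false | rs <- t].

Lemma bch_word_letters t (x y : 'rV[R]_n) :
  bch_word t x y = [seq if c then x else y | c <- word_letters t].
Proof.
rewrite /bch_word /word_letters map_flatten -map_comp; congr flatten.
by apply: eq_map => rs /=; rewrite map_cat !map_nseq.
Qed.

Lemma quad_bch_high F H N : small F -> small H ->
  quad (fun p => bch_high (sg_bracket G) N (F p) (H p)).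
Proof.
move=> sF sH; rewrite /bch_high.
have qsum (I : Type) (r : seq I) (P : I -> T -> 'rV[R]_n) :
    (forall i, quad (P i)) -> quad (fun p => \sum_(i <- r) P i p).
  move=> qP; elim: r => [|i r IH].
    by under eq_fun do rewrite big_nil; exact: quad0.
  by under eq_fun do rewrite big_cons; exact: quadD.
apply: (qsum) => k; under eq_fun do rewrite big_mkcond/=; apply: (qsum) => t.
under eq_fun do rewrite bch_word_letters size_map.
case: (boolP (all (fun rs => 0 < rs.1 + rs.2)%N (bch_exponents t) && 
  (2 < size (word_letters (bch_exponents t)))%N)) => [/andP[_ s]|_]; last exact: quad0.
by apply: quadZ; apply: quad_nested => //; exact: ltnW.
Qed.

Lemma order_bch_high F H N : small F -> small H ->
  vanishing_order 3 (fun p => bch_high (sg_bracket G) N (F p) (H p)).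
Proof.
move=> sF sH; rewrite /bch_high.
have qsum (I : Type) (r : seq I) (P : I -> T -> 'rV[R]_n) :
    (forall i, vanishing_order 3 (P i)) -> vanishing_order 3 (fun p => \sum_(i <- r) P i p).
  move=> qP; elim: r => [|i r IH].
    by under eq_fun do rewrite big_nil; exact: order0.
  by under eq_fun do rewrite big_cons; exact: orderD.
apply: (qsum) => k; under eq_fun do rewrite big_mkcond/=; apply: (qsum) => t.
under eq_fun do rewrite bch_word_letters size_map.
case: (boolP (all (fun rs => 0 < rs.1 + rs.2)%N (bch_exponents t) && 
  (2 < size (word_letters (bch_exponents t)))%N)) => [/andP[_ s]|_]; last exact: order0.
apply: orderZ.
have := order_nested sF sH (ltnW (ltnW s)).
move: (word_letters _) s => b; elim: (size b) => // m IH.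
by rewrite ltnS leq_eqVlt => /orP[/eqP<-//|/IH h /orderS/h].
Qed.

(** The group law differs from the addition by brackets of at least two letters. *)
Lemma quad_mul F H : small F -> small H ->
  quad (fun p => sg_mul G (F p) (H p) - (F p + H p)).
Proof.
move=> sF sH; rewrite (_ : (fun p => _) = fun p => 2^-1 *: sg_bracket G (F p) (H p) +
    bch_high (sg_bracket G) (sg_step G) (F p) (H p)); last first.
  by apply/funext => p; rewrite sg_mulE -(addrA (F p + H p)) addrAC subrr add0r.
by apply: quadD; [apply: quadZ; exact: quad_bracket|exact: quad_bch_high].
Qed.

Lemma small_mul F H : small F -> small H -> small (fun p => sg_mul G (F p) (H p)).
Proof.
move=> sF sH; rewrite (_ : (fun p => _) = fun p => (sg_mul G (F p) (H p) - (F p + H p)) + (F p + H p)); last first.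
  by apply/funext => p; rewrite subrK.
by apply: smallD; [apply: quad_small; exact: quad_mul|exact: smallD].
Qed.

Lemma order_mul F H : small F -> small H ->
  vanishing_order 3 (fun p => sg_mul G (F p) (H p) - (F p + H p + 2^-1 *: sg_bracket G (F p) (H p))).
Proof.
move=> sF sH; rewrite (_ : (fun p => _) = fun p => bch_high (sg_bracket G) (sg_step G) (F p) (H p)).
  exact: order_bch_high.
by apply/funext => p; rewrite sg_mulE addrAC subrr add0r.
Qed.

End PolynomialEstimates.

(** * Dilations and the horizontal projection *)

Lemma norm_linear_le (R : realType) (n m : nat) (f : {linear 'rV[R]_n -> 'rV[R]_m}) :
  exists2 C : R, 0 <= C & forall x, `|f x| <= C * `|x|.
Proof.
exists (\sum_i `|f (delta_mx 0 i)|); first exact: sumr_ge0.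
move=> x; rewrite {1}(row_sum_delta x) linear_sum.
apply: le_trans (ler_norm_sum _ _ _) _; rewrite mulr_suml; apply: ler_sum => i _.
rewrite linearZ/= normrZ mulrC ler_wpM2l//.
exact: norm_coord_le.
Qed.

Section Dilation.
Variables (R : realType) (n : nat) (G : stratified_group R n).
Implicit Types (x y z w h : 'rV[R]_n) (r s t : R).
Local Notation "x ** y" := (sg_mul G x y) (at level 40, left associativity).
Local Notation "[[ x , y ]]" := (sg_bracket G x y).
Local Notation N := (sg_step G).
Local Notation dil := (dilation G).

Definition layer_proj (j : 'I_N) : 'End('rV[R]_n) :=
  sumv_pi (\sum_(i < sg_step G) sg_layer G i.+1)%VS j.
Local Notation pi := layer_proj.

Lemma layer_proj_in j x : pi j x \in sg_layer G j.+1.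
Proof. exact: memv_sum_pi. Qed.

Lemma layer_proj_sum x : \sum_(j < N) pi j x = x.
Proof. by apply: sumv_pi_sum; rewrite sg_layer_full memvf. Qed.

Lemma layer_proj_unique (w : 'I_N -> 'rV[R]_n) :
  (forall j, w j \in sg_layer G j.+1) -> forall j, pi j (\sum_i w i) = w j.
Proof.
move=> wl j; apply/eqP.
have /directv_sum_unique := sg_layer_direct G.
move=> /(_ (fun j => pi j (\sum_i w i)) w); rewrite layer_proj_sum eqxx.
by move=> /(_ (fun i _ => layer_proj_in i _) (fun i _ => wl i))/esym/forall_inP/(_ j isT).
Qed.

Lemma layer_proj_layer (i j : 'I_N) x : x \in sg_layer G i.+1 ->
  pi j x = if j == i then x else 0.
Proof.
move=> xi.
have {1}-> : x = \sum_(k < N) (if k == i then x else 0).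
  by rewrite -big_mkcond big_pred1_eq.
rewrite layer_proj_unique// => k; case: eqP => [->//|_]; exact: mem0v.
Qed.

Lemma dilationE r x : dil r x = \sum_(j < N) r ^+ j.+1 *: pi j x. Proof. by []. Qed.

Lemma dilation_is_linear r : linear (dil r).
Proof.
move=> a x y; rewrite !dilationE scaler_sumr -big_split; apply: eq_bigr => j _ /=.
by rewrite linearP scalerDr !scalerA mulrC.
Qed.
HB.instance Definition _ r := GRing.isLinear.Build R 'rV[R]_n 'rV[R]_n *:%R (dil r)
  (dilation_is_linear r).

Lemma dilation_layer r j x : (0 < j)%N -> x \in sg_layer G j -> dil r x = r ^+ j *: x.
Proof.
case: j => // j _; have [jN|Nj] := ltnP j N; last first.
  by rewrite sg_layer_gt_step// memv0 => /eqP->; rewrite linear0 scaler0.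
move=> xj; rewrite dilationE (bigD1 (Ordinal jN))//= big1 ?addr0.
  by rewrite (@layer_proj_layer (Ordinal jN))// eqxx.
by move=> k /negbTE kj; rewrite (@layer_proj_layer (Ordinal jN))// kj scaler0.
Qed.

Lemma dilation_horizontal r h : horizontal G h -> dil r h = r *: h.
Proof. by move=> hh; rewrite (dilation_layer _ (ltn0Sn 0))// expr1. Qed.

Lemma dilation1 x : dil 1 x = x.
Proof. by rewrite dilationE; under eq_bigr do rewrite expr1n scale1r; exact: layer_proj_sum. Qed.

Lemma dilationM r s x : dil r (dil s x) = dil (r * s) x.
Proof.
rewrite [dil s x]dilationE linear_sum; apply: eq_bigr => j _.
by rewrite linearZ/= (dilation_layer _ _ (layer_proj_in _ _))// scalerA exprMn mulrC.
Qed.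

Lemma dilation_bracket r x y : dil r [[ x, y ]] = [[ dil r x, dil r y ]].
Proof.
rewrite -{1}(layer_proj_sum x) -{1}(layer_proj_sum y) !linear_sumlz linear_sum.
apply: eq_bigr => i _; rewrite !linear_sumr linear_sum.
apply: eq_bigr => j _.
rewrite linearZl_LR/= linearZr_LR/= scalerA -exprD.
by apply: dilation_layer => //; apply: sg_bracket_graded => //; exact: layer_proj_in.
Qed.

Lemma dilation_nested r (x y : 'rV[R]_n) (t : seq (nat * nat)) :
  dil r (nested_bracket (sg_bracket G) (bch_word t x y)) =
  nested_bracket (sg_bracket G) (bch_word t (dil r x) (dil r y)).
Proof.
rewrite !bch_word_letters; elim: (word_letters t) => [|a b IH] /=; first exact: linear0.
case: b IH => [|c b] IH; first by case: a.
by rewrite /= dilation_bracket -[in RHS]/(nested_bracket _ (_ :: _)) -IH; case: a.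
Qed.

(** Dilations are automorphisms of the Lie algebra, hence of the group, whose law
is a combination of brackets. *)
Lemma dilation_mul r x y : dil r (x ** y) = dil r x ** dil r y.
Proof.
rewrite !sg_mul_bch /bch linear_sum; apply: eq_bigr => k _.
by rewrite linear_sum; apply: eq_bigr => t _; rewrite linearZ/= dilation_nested.
Qed.

Lemma dilationN r x : dil r (- x) = - dil r x. Proof. exact: linearN. Qed.

Definition hproj : 'End('rV[R]_n) := pi (Ordinal (sg_step_gt0 G)).

Lemma hproj_horizontal x : horizontal G (hproj x).
Proof. exact: (layer_proj_in (Ordinal (sg_step_gt0 G))). Qed.

Lemma hproj_id h : horizontal G h -> hproj h = h.
Proof.
by move=> hh; rewrite /hproj (@layer_proj_layer (Ordinal (sg_step_gt0 G)))// eqxx.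
Qed.

Lemma hproj_bracket x y : hproj [[ x, y ]] = 0.
Proof.
rewrite -(layer_proj_sum x) -(layer_proj_sum y) !linear_sumlz linear_sum big1// => i _.
rewrite linear_sumr linear_sum big1// => j _.
have := sg_bracket_graded (ltn0Sn i) (ltn0Sn j) (layer_proj_in i x) (layer_proj_in j y).
rewrite addSn; have [ijN|Nij] := ltnP (i + j.+1) N => hb.
  have := @layer_proj_layer (Ordinal ijN) (Ordinal (sg_step_gt0 G)) _ hb.
  by rewrite ifF//; apply/negP => /eqP/(congr1 (@nat_of_ord N))/=; rewrite addnS.
by move: hb; rewrite sg_layer_gt_step// memv0 => /eqP->; rewrite linear0.
Qed.

(** All the brackets lie in the layers of degree at least 2. *)
Lemma hproj_mul x y : hproj (x ** y) = hproj x + hproj y.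
Proof.
rewrite sg_mulE !linearD/= linearZ/= hproj_bracket scaler0 addr0.
rewrite /bch_high linear_sum big1 ?addr0// => k _; rewrite linear_sum big1// => t /andP[_ h].
rewrite linearZ/=; case: (bch_word _ _ _) h => [|a [|b s] ]// _.
by rewrite -/(nested_bracket _ (b :: s)) [nested_bracket _ _]/= hproj_bracket scaler0.
Qed.

(** The layers of degree at least 2 are scaled at least quadratically. *)
Lemma dilation_near_hproj : exists2 C : R, 0 <= C &
  forall r x, 0 <= r <= 1 -> `|dil r x - r *: hproj x| <= C * r ^+ 2 * `|x|.
Proof.
have : forall j : 'I_N, exists C : R, 0 <= C /\ forall x, `|pi j x| <= C * `|x|.
  by move=> j; have [C C0 h] := norm_linear_le (pi j); exists C.
move=> /choice[C CP]; exists (\sum_j C j).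
  by apply: sumr_ge0 => j _; have [] := CP j.
move=> r x /andP[r0 r1].
rewrite dilationE (bigD1 (Ordinal (sg_step_gt0 G)))//= expr1 addrAC subrr add0r.
apply: le_trans (ler_norm_sum _ _ _) _.
rewrite -mulrA mulr_suml [leRHS](bigD1 (Ordinal (sg_step_gt0 G)))//= -[leLHS]add0r.
apply: lerD.
  by have [C0 _] := CP (Ordinal (sg_step_gt0 G)); rewrite !mulr_ge0// exprn_ge0.
apply: ler_sum => j j0; have [C0 h] := CP j.
rewrite normrZ ger0_norm ?exprn_ge0// mulrCA.
apply: ler_pM => //; first exact: exprn_ge0.
have j1 : (0 < j)%N by rewrite lt0n; apply: contra j0 => /eqP j0; apply/eqP/val_inj.
exact: ler_wiXn2l.
Qed.

Lemma dilation_contract : exists2 C : R, 0 <= C &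
  forall r x, 0 <= r <= 1 -> `|dil r x| <= C * r * `|x|.
Proof.
have [C C0 h] := dilation_near_hproj.
have [C' C'0 h'] := norm_linear_le hproj.
exists (C + C'); first exact: addr_ge0.
move=> r x r01; have /andP[r0 r1] := r01.
rewrite -[dil r x](subrK (r *: hproj x)); apply: le_trans (ler_normD _ _) _.
rewrite !mulrDl; apply: lerD.
  apply: le_trans (h _ _ r01) _; rewrite ler_wpM2r// ler_wpM2l//.
  by rewrite expr2 ler_piMr.
by rewrite normrZ ger0_norm// (_ : C' * r * _ = r * (C' * `|x|)); [rewrite ler_wpM2l ?h'|ring].
Qed.

End Dilation.

(** * Conjugation *)

Lemma horner_eq0 (R : realType) (p : {poly R}) : (forall s, p.[s] = 0) -> p = 0.
Proof.
move=> p0; apply: (@roots_geq_poly_eq0 _ _ [seq i%:R | i <- iota 0 (size p)]).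
- by apply/allP => s _; apply/rootP.
- by rewrite map_inj_uniq ?iota_uniq// => i j /eqP; rewrite eqr_nat => /eqP.
- by rewrite size_map size_iota.
Qed.

(** Comparing coefficients gives 2^i p_i = 2 p_i, so p_i = 0 unless i = 1. *)
Lemma horner_double_linear (R : realType) (p : {poly R}) :
  (forall s, p.[2 * s] = 2 * p.[s]) -> forall s, p.[s] = s * p.[1].
Proof.
move=> p2.
have q0 : \poly_(i < size p) (2 ^+ i * p`_i) - 2 *: p = 0.
  apply: horner_eq0 => s; rewrite hornerD hornerN hornerZ -p2 horner_poly.
  apply/eqP; rewrite subr_eq0 [eqbRHS]horner_coef; apply/eqP; apply: eq_bigr => i _.
  by rewrite exprMn; ring.
have p1 i : i != 1%N -> p`_i = 0.
  move=> i1; have /(congr1 (fun q : {poly R} => q`_i)) := q0.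
  rewrite coefB coef_poly coefZ coef0; case: ltnP => [_|/(nth_default 0)->//].
  rewrite -mulrBl => /eqP; rewrite mulf_eq0 subr_eq0 => /orP[|/eqP//].
  have two1 : (2 : R) != 1 by rewrite (eqr_nat R 2 1).
  move=> /eqP h; case/eqP: i1; apply: (ieexprIn (ltr0Sn R 1) two1).
  by rewrite h expr1.
have pE : p = p`_1 *: 'X.
  apply/polyP => i; rewrite coefZ coefX.
  by case: eqP => [->|/eqP/p1->]; rewrite ?mulr1 ?mulr0.
by move=> s; rewrite pE !hornerZ !hornerX mulr1 mulrC.
Qed.

Section PolynomialCurves.
Variables (R : realType) (n : nat) (G : stratified_group R n).
Implicit Types F H : R -> 'rV[R]_n.

Definition polycurve F := exists P : 'I_n -> {poly R}, forall s i, F s 0 i = (P i).[s].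

Lemma polycurve_cst x : polycurve (fun=> x).
Proof. by exists (fun i => (x 0 i)%:P) => s i; rewrite hornerC. Qed.

Lemma polycurve_line x : polycurve (fun s => s *: x).
Proof. by exists (fun i => x 0 i *: 'X) => s i; rewrite mxE hornerZ hornerX mulrC. Qed.

Lemma polycurveD F H : polycurve F -> polycurve H -> polycurve (fun s => F s + H s).
Proof.
by move=> [P FP] [Q HQ]; exists (fun i => P i + Q i) => s i; rewrite mxE hornerD FP HQ.
Qed.

Lemma polycurveZ c F : polycurve F -> polycurve (fun s => c *: F s).
Proof. by move=> [P FP]; exists (fun i => c *: P i) => s i; rewrite mxE hornerZ FP. Qed.

Lemma polycurveN F : polycurve F -> polycurve (fun s => - F s).
Proof. by move=> [P FP]; exists (fun i => - P i) => s i; rewrite mxE hornerN FP. Qed.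

Lemma polycurve_bracket F H : polycurve F -> polycurve H ->
  polycurve (fun s => sg_bracket G (F s) (H s)).
Proof.
move=> [P FP] [Q HQ].
exists (fun k => \sum_i \sum_j (sg_bracket G (delta_mx 0 i) (delta_mx 0 j) 0 k) *: (P i * Q j)).
move=> s k; rewrite (row_sum_delta (F s)) (row_sum_delta (H s)).
rewrite linear_sumlz summxE horner_sum; apply: eq_bigr => i _.
rewrite linear_sumr summxE horner_sum; apply: eq_bigr => j _.
by rewrite linearZl_LR/= linearZr_LR/= !mxE hornerZ hornerM FP HQ mulrA mulrC.
Qed.

Lemma polycurve_sum (I : Type) (r : seq I) (P : pred I) (F : I -> R -> 'rV[R]_n) :
  (forall i, polycurve (F i)) -> polycurve (fun s => \sum_(i <- r | P i) F i s).
Proof.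
move=> FP; elim: r => [|i r IH].
  by under eq_fun do rewrite big_nil; exact: polycurve_cst.
under eq_fun do rewrite big_cons; case: (P i) => //; exact: polycurveD.
Qed.

Lemma polycurve_mul F H : polycurve F -> polycurve H ->
  polycurve (fun s => sg_mul G (F s) (H s)).
Proof.
move=> FP HP; under eq_fun do rewrite sg_mul_bch /bch.
apply: polycurve_sum => k; apply: polycurve_sum => t; apply: polycurveZ.
under eq_fun do rewrite bch_word_letters.
elim: (word_letters _) => [|a b IH] /=; first exact: polycurve_cst.
have sa : polycurve (fun s => if a then F s else H s) by case: a.
by case: b IH => [|c b] IH //; exact: polycurve_bracket sa IH.
Qed.

End PolynomialCurves.

Section Conjugation.
Variables (R : realType) (n : nat) (G : stratified_group R n).
Implicit Types (x y z c X Y : 'rV[R]_n) (s t : R).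
Local Notation "x ** y" := (sg_mul G x y) (at level 40, left associativity).
Local Notation "[[ x , y ]]" := (sg_bracket G x y).

Definition sg_conj c x := (- c) ** x ** c.

Lemma sg_conj_mul c x y : sg_conj c (x ** y) = sg_conj c x ** sg_conj c y.
Proof.
rewrite /sg_conj -!(sg_mulA G); congr (_ ** (_ ** _)).
by rewrite sg_mulNKg.
Qed.

Lemma sg_conjM c d x : sg_conj (c ** d) x = sg_conj d (sg_conj c x).
Proof. by rewrite /sg_conj sg_oppM -!(sg_mulA G). Qed.

(** Conjugation is an automorphism and y y = 2 y in the group, so the polynomial
curve s -> sg_conj c (s x) doubles with s; such a curve is linear. *)
Lemma sg_conjZ c s x : sg_conj c (s *: x) = s *: sg_conj c x.
Proof.
have [P gP] : polycurve (fun s => sg_conj c (s *: x)).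
  apply: polycurve_mul; last exact: polycurve_cst.
  by apply: polycurve_mul; [exact: polycurve_cst|exact: polycurve_line].
have double t i : (P i).[2 * t] = 2 * (P i).[t].
  have dbl y : y ** y = 2 *: y.
    by have := sg_mulZZ G 1 1 y; rewrite scale1r -[1 + 1]/(2 : R).
  by rewrite -!gP -scalerA -dbl sg_conj_mul dbl mxE.
apply/rowP => i; rewrite gP (horner_double_linear (double^~ i)) -gP scale1r mxE.
by [].
Qed.

Definition hword (a : seq 'rV[R]_n) : 'rV[R]_n := foldr (sg_mul G) 0 a.

Lemma hword_cat a b : hword (a ++ b) = hword a ** hword b.
Proof.
by elim: a => [|x a IH] /=; rewrite ?sg_mul0g// IH sg_mulA.
Qed.

(** Up to the factor t^2, the complementary component of w is that of an error
of order t^3; let t tend to 0. *)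
Lemma vspace_closed (W : {vspace 'rV[R]_n}) (w : 'rV[R]_n) (C : R) :
  (forall t, 0 < t <= 1 -> exists2 e, `|e| <= C * t ^+ 3 & e + t ^+ 2 *: w \in W) ->
  w \in W.
Proof.
move=> h; have [B B0 fB] := norm_linear_le (\1 - projv W)%VF.
suff fw0 : (\1 - projv W)%VF w = 0.
  have := memv_proj W w; rewrite (_ : projv W w = w)//.
  by move: fw0; rewrite lfunE/= lfunE/= lfunE/= => /eqP; rewrite subr_eq0 => /eqP.
set f := (\1 - projv W)%VF in fB *.
have f0 v : v \in W -> f v = 0.
  by move=> vW; rewrite /f lfunE/= lfunE/= lfunE/= projv_id// subrr.
have bnd t : 0 < t <= 1 -> `|f w| <= B * `|C| * t.
  move=> t01; have /andP[t0 t1] := t01; have [e eC /f0] := h t t01.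
  rewrite linearD linearZ/= addrC => /eqP; rewrite addr_eq0 => /eqP E.
  have : `|t ^+ 2 *: f w| <= B * (`|C| * t ^+ 3).
    rewrite E normrN; apply: le_trans (fB e) _; rewrite ler_wpM2l//.
    by apply: le_trans eC _; apply: ler_wpM2r; [rewrite exprn_ge0// ltW|exact: ler_norm].
  rewrite normrZ ger0_norm; last by rewrite exprn_ge0// ltW.
  rewrite (_ : B * _ = t ^+ 2 * (B * `|C| * t)); last by ring.
  by rewrite ler_pM2l// exprn_gt0.
apply/eqP; rewrite -normr_eq0 eq_le normr_ge0 andbT.
apply/ler_addgt0Pl => e e0; rewrite addr0.
pose K := B * `|C|; have K0 : 0 <= K by rewrite mulr_ge0.
pose t := Num.min 1 (e / (K + 1)).
have t0 : 0 < t by rewrite lt_min ltr01 divr_gt0// ltr_wpDl.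
have t1 : t <= 1 by rewrite ge_min lexx.
apply: le_trans (bnd t _) _; first by rewrite t0.
apply: (@le_trans _ _ ((K + 1) * t)).
  by apply: ler_wpM2r; [exact: ltW|rewrite lerDl].
by rewrite mulrC -ler_pdivlMr ?ltr_wpDl// ge_min lexx orbT.
Qed.

End Conjugation.

(** * Conjugates of horizontal vectors span the Lie algebra *)

Section OrbitSpan.
Variables (R : realType) (n : nat) (G : stratified_group R n).
Implicit Types (x y z c v X Y : 'rV[R]_n) (s t : R).
Local Notation "x ** y" := (sg_mul G x y) (at level 40, left associativity).
Local Notation bra := (sg_bracket G).

(** (-tY) (tv) (tY) = t v + t^2 [v, Y] + O(t^3), and t v lies in W. *)
Lemma conj_bracket_mem (W : {vspace 'rV[R]_n}) v Y :
  (forall t, sg_conj G (t *: Y) v \in W) -> bra v Y \in W.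
Proof.
move=> hW.
have vW : v \in W.
  by have := hW 0; rewrite /sg_conj scale0r oppr0 sg_mul0g sg_mulg0.
pose D : set R := [set t | 0 <= t <= 1]; pose nrm (t : R) := t.
pose dst (t t' : R) : R := `|t - t'|.
have n0 t : D t -> 0 <= nrm t by move=> /andP[].
have n1 t : D t -> nrm t <= 1 by move=> /andP[].
have d0 t t' : D t -> D t' -> 0 <= dst t t' by move=> _ _; exact: normr_ge0.
have lin x : small D nrm dst (fun t => t *: x).
  exists `|x| => //; split => [t /andP[t0 _]|t t' _ _].
    by rewrite normrZ ger0_norm// mulrC.
  by rewrite -scalerBl normrZ mulrC.
have sml := small_mul G n0 n1 ler01 d0.
have ord := order_mul (dst := dst) G n0 n1 ler01.
pose F t := (t *: v) ** (t *: Y).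
have sF : small D nrm dst F by exact: sml.
have oF := ord _ _ (lin v) (lin Y).
have linN : small D nrm dst (fun t => t *: - Y) by exact: lin.
have oH := ord _ _ linN sF.
(* The quadratic terms of the two products add up to t^2 [v, Y]. *)
have oE : vanishing_order D nrm 3 (fun t => (t *: - Y) ** F t - t *: v - t ^+ 2 *: bra v Y).
  have oB : vanishing_order D nrm 3 (fun t => 2^-1 *: bra (t *: - Y) (F t - (t *: v + t *: Y))).
    apply: orderZ; apply: (order_bracket G (d := 1) (e := 2)).
      exact: (small_order linN).
    rewrite (_ : (fun t => _) = fun t => (F t - (t *: v + t *: Y + 2^-1 *: bra (t *: v) (t *: Y)))
       + 2^-1 *: bra (t *: v) (t *: Y)); last first.
      by apply/funext => t; rewrite [in RHS]opprD addrA subrK.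
    apply: orderD; first exact: (orderS n0 n1 ler01 oF).
    by apply: orderZ; apply: (order_bracket G (d := 1) (e := 1)); apply: small_order; exact: lin.
  rewrite (_ : (fun t => _) = fun t =>
     ((t *: - Y) ** F t - (t *: - Y + F t + 2^-1 *: bra (t *: - Y) (F t))) +
     ((F t - (t *: v + t *: Y + 2^-1 *: bra (t *: v) (t *: Y))) +
      2^-1 *: bra (t *: - Y) (F t - (t *: v + t *: Y)))); last first.
    apply/funext => t.
    rewrite linearBr/= (linearDr bra (t *: - Y))/= !linearZl_LR/= !linearZr_LR/=.
    have -> : bra (- Y) v = bra v Y by rewrite linearNl/= (sg_bracketC G v Y) opprK.
    have -> : bra (- Y) Y = 0 by rewrite linearNl/= sg_bracket_alt oppr0.
    rewrite !scaler0 addr0 scalerBr !scalerA.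
    set b := bra v Y; set H := _ ** F t; set q := bra _ (F t); set f := F t.
    rewrite (_ : t ^+ 2 *: b = (2^-1 * (t * t)) *: b + (2^-1 * (t * t)) *: b); last first.
      by rewrite -scalerDl; congr (_ *: _); rewrite expr2; field.
    by apply/rowP => i; rewrite !mxE; ring.
  by apply: orderD => //; apply: orderD.
have [C C0 hC] := oE.
apply: (@vspace_closed _ _ _ _ C) => t t01.
have Dt : D t by move: t01 => /andP[/ltW h1 h2]; apply/andP.
exists ((t *: - Y) ** F t - t *: v - t ^+ 2 *: bra v Y).
  exact: hC.
rewrite subrK; apply: memvB; last exact: memvZ.
rewrite /F scalerN sg_mulA -/(sg_conj G (t *: Y) (t *: v)) sg_conjZ.
exact: memvZ.
Qed.

Definition horizontal_seq (a : seq 'rV[R]_n) := {in a, forall x, horizontal G x}.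

Definition orbit_in (W : {vspace 'rV[R]_n}) := forall a X,
  horizontal_seq a -> horizontal G X -> sg_conj G (hword G a) X \in W.

Lemma orbit_span_least : exists S, orbit_in S /\ forall W, orbit_in W -> (S <= W)%VS.
Proof.
pose P k := `[< exists W : {vspace 'rV[R]_n}, \dim W = k /\ orbit_in W >].
have exP : exists k, P k.
  by exists (\dim (fullv : {vspace 'rV[R]_n})); apply/asboolP; exists fullv; split => // a X _ _; exact: memvf.
case: (ex_minnP exP) => k /asboolP[S [dS oS]] kmin.
exists S; split => // W oW.
have oSW : orbit_in (S :&: W)%VS.
  by move=> a X ha hX; rewrite memv_cap oS// oW.
have := kmin (\dim (S :&: W)%VS); rewrite -dS => h.
have : (S :&: W == S)%VS.
  by rewrite eqEdim capvSl h//; apply/asboolP; exists (S :&: W)%VS.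
by move/eqP => <-; exact: capvSr.
Qed.

(** The least subspace S containing the conjugates is stable under bracketing
with horizontal vectors: if v is a conjugate, so are its conjugates by tY, and
[conj_bracket_mem] applies. By the Jacobi identity the elements w with
[S, w] in S form a subalgebra T; it contains the first layer, so it is everything,
and S itself is a subalgebra containing the first layer. *)
Lemma orbit_span (W : {vspace 'rV[R]_n}) : orbit_in W -> W = fullv.
Proof.
have [S [oS minS]] := orbit_span_least.
suff Sf : S = fullv.
  by move=> /minS; rewrite Sf => h; apply/eqP; rewrite eqEsubv subvf h.
have adS Y v : horizontal G Y -> v \in S -> bra v Y \in S.
  move=> hY vS; rewrite sg_bracketC rpredN.
  have : (S <= linfun (bra Y) @^-1: S)%VS.
    apply: minS => a X ha hX; rewrite -memv_preim lfunE/= sg_bracketC rpredN.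
    apply: conj_bracket_mem => t; rewrite -sg_conjM.
    have -> : hword G a ** (t *: Y) = hword G (a ++ [:: t *: Y]).
      by rewrite hword_cat/= sg_mulg0.
    apply: oS => // z; rewrite mem_cat inE => /orP[/ha//|/eqP->].
    by rewrite /horizontal/=; exact: memvZ.
  by move=> /subvP/(_ v vS); rewrite -memv_preim lfunE.
pose T := (\bigcap_(i < \dim S) (linfun (bra (vbasis S)`_i) @^-1: S))%VS.
have TP w : reflect (forall v, v \in S -> bra v w \in S) (w \in T).
  apply: (iffP idP) => [wT v vS|h].
    rewrite (coord_vbasis vS) linear_sumlz; apply: memv_suml => i _.
    rewrite linearZl_LR/=; apply: memvZ.
    have : (T <= linfun (bra (vbasis S)`_i) @^-1: S)%VS by exact: bigcapv_inf.
    by move=> /subvP/(_ w wT); rewrite -memv_preim lfunE.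
  rewrite /T memvE; apply/subv_bigcapP => i _; rewrite -memvE -memv_preim lfunE/=.
  by apply: h; apply: vbasis_mem; apply: mem_nth; rewrite size_tuple.
have Tf : T = fullv.
  apply: (sg_generated (s := G)).
    by apply/subvP => Y hY; apply/TP => v vS; exact: adS.
  move=> x y /TP hx /TP hy; apply/TP => v vS.
  have := sg_bracket_jacobi G v x y.
  move/eqP; rewrite -addrA addr_eq0 => /eqP->; rewrite rpredN; apply: memvD.
    by rewrite sg_bracketC rpredN; apply: hx; rewrite sg_bracketC rpredN; exact: hy.
  by rewrite sg_bracketC rpredN; apply: hy; exact: hx.
apply: (sg_generated (s := G)).
  apply/subvP => X hX; have := oS [::] X (fun _ => _) hX.
  by rewrite /sg_conj/= oppr0 sg_mul0g sg_mulg0; apply => z; rewrite in_nil.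
by move=> x y xS yS; move: (memvf y); rewrite -Tf => /TP; apply.
Qed.

End OrbitSpan.

(** * Words with real parameters *)

Section ParametrizedWords.
Variables (R : realType) (n : nat) (G : stratified_group R n).
Implicit Types (x y z c v X Y : 'rV[R]_n) (Xs : seq 'rV[R]_n) (s t : nat -> R).
Local Notation "x ** y" := (sg_mul G x y) (at level 40, left associativity).

Fixpoint pword Xs t : 'rV[R]_n :=
  if Xs is X :: Xs' then (t 0%N *: X) ** pword Xs' (fun i => t i.+1) else 0.

(** The directions in which [pword] moves, to the first order, when one of its
parameters is changed: X_i conjugated by the part of the word that follows it. *)
Fixpoint pvecs Xs t : seq 'rV[R]_n :=
  if Xs is X :: Xs' then
    sg_conj G (pword Xs' (fun i => t i.+1)) X :: pvecs Xs' (fun i => t i.+1)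
  else [::].

Lemma size_pvecs Xs t : size (pvecs Xs t) = size Xs.
Proof. by elim: Xs t => //= X Xs IH t; rewrite IH. Qed.

(** Each increment s_i X_i is moved to the right through the rest of the word,
which conjugates it. *)
Lemma pwordD Xs t s :
  pword Xs (fun i => t i + s i) = pword Xs t ** pword (pvecs Xs t) s.
Proof.
elim: Xs t s => [|X Xs IH] t s /=; first by rewrite sg_mul0g.
rewrite IH -(sg_mulZZ G) -sg_conjZ /sg_conj.
set g := pword Xs _; set P := pword _ (fun i => s i.+1).
by rewrite -!(sg_mulA G) sg_mulNKg.
Qed.

Lemma pword_hword Xs t :
  pword Xs t = hword G [seq t i *: nth 0 Xs i | i <- iota 0 (size Xs)].
Proof.
elim: Xs t => [|X Xs IH] t //=; rewrite IH (iotaDl 1 0 (size Xs)) -map_comp.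
by [].
Qed.

Definition letters_of (w : seq ('rV[R]_n * R)) := [seq p.1 | p <- w].
Definition params_of (w : seq ('rV[R]_n * R)) (i : nat) : R := nth 0 [seq p.2 | p <- w] i.

Lemma pword_cat w1 w2 : pword (letters_of (w1 ++ w2)) (params_of (w1 ++ w2)) =
  pword (letters_of w1) (params_of w1) ** pword (letters_of w2) (params_of w2).
Proof.
elim: w1 => [|p w1 IH] /=; first by rewrite sg_mul0g.
rewrite -(sg_mulA G); congr (_ ** _); exact: IH.
Qed.

Lemma pvecs_cat w1 w2 : {subset pvecs (letters_of w2) (params_of w2) <=
  pvecs (letters_of (w1 ++ w2)) (params_of (w1 ++ w2))}.
Proof.
move=> v hv; elim: w1 => [|p w1 IH] //=.
by rewrite in_cons; apply/orP; right; exact: IH.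
Qed.

Lemma pword_letters1 (a : seq 'rV[R]_n) :
  pword (letters_of [seq (x, 1) | x <- a]) (params_of [seq (x, 1) | x <- a]) = hword G a.
Proof.
by elim: a => [|x a IH] //=; rewrite /params_of/= scale1r; congr (_ ** _); exact: IH.
Qed.

Definition inverse_letters (a : seq 'rV[R]_n) := rev [seq - x | x <- a].

Lemma hword_inverse (a : seq 'rV[R]_n) : hword G (inverse_letters a) = - hword G a.
Proof.
rewrite /inverse_letters; elim: a => [|x a IH] /=; first by rewrite oppr0.
by rewrite rev_cons -cats1 hword_cat IH /= sg_mulg0 sg_oppM.
Qed.

Lemma horizontal_inverse (a : seq 'rV[R]_n) :
  horizontal_seq G a -> horizontal_seq G (inverse_letters a).
Proof.
move=> ha x; rewrite /inverse_letters mem_rev => /mapP[y /ha hy ->].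
by rewrite /horizontal/= rpredN.
Qed.

(** If the directions of w do not span, some conjugate of a horizontal vector X
by a word c is not among their combinations. Prefix w with X, c and the inverse of
w: the new word gives X the direction of that conjugate and keeps the directions
of w. The parameter of X itself is 0. *)
Lemma spanning_word_dim k : (k <= n)%N -> exists w,
  horizontal_seq G (letters_of w) /\
  (k <= \dim <<pvecs (letters_of w) (params_of w)>>)%N.
Proof.
elim: k => [_|k IH kn]; first by exists [::].
have [w [hw kw]] := IH (ltnW kn).
set W := <<_>>%VS in kw.
have dimf : \dim (fullv : {vspace 'rV[R]_n}) = n by rewrite dimvf/= dim_matrix mul1r.
have [/orbit_span Wf|] := pselect (orbit_in G W).
  by exists w; rewrite -/W Wf dimf.
move=> /existsNP[a] /existsNP[X] /not_implyP[ha] /not_implyP[hX] /negP vW.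
pose t := params_of w.
pose b := [seq t i *: nth 0 (letters_of w) i | i <- iota 0 (size (letters_of w))].
have hb : horizontal_seq G b.
  move=> x /mapP[i]; rewrite mem_iota add0n => /andP[_ iw] ->.
  by rewrite /horizontal/=; apply: memvZ; apply: hw; exact: mem_nth.
(* The value of e is that of a followed by the inverse of w. *)
pose e := [seq (x, 1 : R) | x <- a ++ inverse_letters b].
have we : pword (letters_of (e ++ w)) (params_of (e ++ w)) = hword G a.
  rewrite pword_cat pword_letters1 hword_cat hword_inverse -pword_hword -/t.
  by rewrite -(sg_mulA G) sg_mulNg sg_mulg0.
exists ((X, 0) :: e ++ w); split.
  move=> x; rewrite /letters_of/= in_cons map_cat mem_cat => /orP[/eqP->//|/orP[|/hw//]].
  by rewrite -map_comp map_id_in// mem_cat => /orP[/ha//|]; apply: horizontal_inverse.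
set w' := e ++ w.
have -> : pvecs (letters_of ((X, 0) :: w')) (params_of ((X, 0) :: w')) =
   sg_conj G (hword G a) X :: pvecs (letters_of w') (params_of w').
  by rewrite -we.
rewrite span_cons; apply: (@leq_trans (\dim (<[sg_conj G (hword G a) X]> + W)%VS)); last first.
  by apply: dimvS; apply: addvS => //; apply: sub_span; exact: pvecs_cat.
apply: leq_ltn_trans kw _.
rewrite ltn_neqAle dimvS ?addvSr// andbT.
apply: contra vW => /eqP dE.
have /eqP -> : W == (<[sg_conj G (hword G a) X]> + W)%VS.
  by rewrite eqEdim addvSr dE leqnn.
by rewrite memvE addvSl.
Qed.

Definition pframe Xs t (f : 'I_n -> nat) : 'M[R]_n :=
  \matrix_(k < n) nth 0 (pvecs Xs t) (f k).

Lemma spanning_word : exists Xs t (f : 'I_n -> nat),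
  [/\ horizontal_seq G Xs, exists B, forall i, `|t i| <= B,
      (forall k, (f k < size Xs)%N), injective f &
      pframe Xs t f \in unitmx].
Proof.
have [w [hw dw]] := spanning_word_dim (leqnn n).
set Xs := letters_of w in hw dw *; set t := params_of w in dw *.
pose A := \matrix_(i < size Xs) nth 0 (pvecs Xs t) i.
have dimf : \dim (fullv : {vspace 'rV[R]_n}) = n by rewrite dimvf/= dim_matrix mul1r.
have full : <<pvecs Xs t>>%VS = fullv.
  by apply/eqP; rewrite eqEdim subvf dimf.
have rA : row_full A.
  rewrite -sub1mx; apply/row_subP => j; rewrite rowE mulmx1.
  have : delta_mx 0 j \in <<pvecs Xs t>>%VS by rewrite full memvf.
  rewrite (_ : pvecs Xs t = in_tuple (pvecs Xs t))// => /coord_span->.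
  apply: summx_sub => i _; apply: scalemx_sub.
  have iX : (i < size Xs)%N by rewrite -(size_pvecs Xs t).
  by rewrite (_ : _`_i = row (Ordinal iX) A) ?row_sub// rowK.
exists Xs, t, (fun k => val (fullrankfun rA k)); split => //.
- exists (\sum_(p <- w) `|p.2|) => i; rewrite /t /params_of.
  have [iw|wi] := ltnP i (size w); last first.
    by rewrite nth_default ?size_map// normr0; apply: sumr_ge0.
  rewrite (nth_map (0, 0))// (big_nth (0, 0)) big_mkord.
  by rewrite (bigD1 (Ordinal iw))//= lerDl; apply: sumr_ge0.
- by move=> k; exact: ltn_ord.
- by move=> k l /val_inj/fullrankfun_inj.
- have := fullrowsub_unit rA; rewrite /pframe /A (_ : rowsub _ _ = \matrix_k nth 0 (pvecs Xs t) (val (fullrankfun rA k)))//.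
  by apply/matrixP => i j; rewrite !mxE.
Qed.

Lemma polycurve_pword Xs (a b : nat -> R) :
  polycurve (fun r => pword Xs (fun i => a i + r * b i)).
Proof.
elim: Xs a b => [|X Xs IH] a b /=; first exact: polycurve_cst.
apply: polycurve_mul; last exact: IH.
under eq_fun do rewrite scalerDl -scalerA.
by apply: polycurveD; [exact: polycurve_cst|exact: polycurve_line].
Qed.

Lemma polycurve_pvecs Xs (a b : nat -> R) k :
  polycurve (fun r => nth 0 (pvecs Xs (fun i => a i + r * b i)) k).
Proof.
elim: Xs a b k => [|X Xs IH] a b [|k] /=; try exact: polycurve_cst; last exact: IH.
apply: polycurve_mul; last exact: polycurve_pword.
by apply: polycurve_mul; [apply: polycurveN; exact: polycurve_pword|exact: polycurve_cst].
Qed.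

Lemma det_pframe_poly Xs (a b : nat -> R) f : exists q : {poly R},
  forall r, \det (pframe Xs (fun i => a i + r * b i) f) = q.[r].
Proof.
have /choice[Q QP] k := polycurve_pvecs Xs a b (f k).
pose M := \matrix_(k, j) Q k j.
exists (\det M) => r; rewrite -[RHS]/(horner_eval r (\det M)) -det_map_mx; congr (\det _).
by apply/matrixP => k j; rewrite !mxE QP /horner_eval.
Qed.

Definition flip_signs (e : seq bool) t (i : nat) : R := (-1) ^+ nth false e i * t i.

(** For a pattern e of signs, flipping the signs of t0 twice gives back t0, so the
determinant of the frame does not vanish identically on the line through e t and
t0. Along the segment from t to e t0 the finitely many determinants in question
are nonzero polynomials, so they are simultaneously nonzero at points arbitrarily
close to t. *)
Lemma generic_params Xs f t0 (es : seq (seq bool)) (rho B : R) : 0 < rho ->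
  pframe Xs t0 f \in unitmx -> (forall i, `|t0 i| <= B) ->
  exists t, (forall i, `|t i| < rho) /\
    forall e, e \in es -> pframe Xs (flip_signs e t) f \in unitmx.
Proof.
move=> + ut0 t0B; elim: es rho => [|e es IH] rho rho0.
  by exists (fun=> 0); split => // i; rewrite normr0.
have [t [trho tes]] := IH (rho / 2) (divr_gt0 rho0 (ltr0Sn _ 1)).
have uflip : pframe Xs (flip_signs e (flip_signs e t0)) f \in unitmx.
  rewrite (_ : flip_signs e _ = t0)//; apply/funext => i.
  by rewrite /flip_signs mulrA -expr2 sqrr_sign mul1r.
pose d i := flip_signs e t0 i - t i.
have /choice[q qP] (e' : seq bool) := det_pframe_poly Xs (flip_signs e' t) (flip_signs e' d) f.
(* The polynomial of e is nonzero at 1, the others are nonzero at 0. *)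
have q0 e' : e' \in e :: es -> q e' != 0.
  rewrite inE => /orP[/eqP->|/tes].
    apply/eqP => /(congr1 (fun p : {poly R} => p.[1])); rewrite horner0 -qP.
    move: uflip; rewrite unitmxE unitfE => /eqP h E; apply: h; rewrite -E.
    congr (\det (pframe _ _ _)); apply/funext => i.
    by rewrite mul1r /flip_signs /d /flip_signs mulrBr addrC subrK.
  rewrite unitmxE unitfE => /eqP h; apply/eqP => E; apply: h.
  have := qP e' 0; rewrite E horner0 => <-; congr (\det (pframe _ _ _)).
  by apply/funext => i; rewrite mul0r addr0.
pose p := \prod_(e' <- e :: es) q e'.
have p0 : p != 0 by rewrite prodf_seq_neq0; apply/allP => e' /q0 ->.
have B0 : 0 <= B by apply: le_trans (t0B 0%N).
pose r1 := rho / 2 / (B + rho).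
have Br : 0 < B + rho by rewrite ltr_wpDl.
have r10 : 0 < r1 by rewrite !divr_gt0.
have [r [r0 rr1 pr]] : exists r, [/\ 0 < r, r <= r1 & ~~ root p r].
  apply: contrapT => h.
  have : p = 0; last by move/eqP: p0.
  apply: (@roots_geq_poly_eq0 _ _ [seq r1 / i.+1%:R | i <- iota 0 (size p)]).
  - apply/allP => s /mapP[i _ ->]; apply: contrapT => /negP ns; apply: h.
    exists (r1 / i.+1%:R); split => //; first by rewrite divr_gt0.
    by rewrite ler_pdivrMr ?ltr0n//; apply: ler_peMr; [exact: ltW|rewrite ler1n].
  - rewrite map_inj_uniq ?iota_uniq// => i j /(mulfI (lt0r_neq0 r10))/invr_inj/eqP.
    by rewrite eqr_nat => /eqP[].
  - by rewrite size_map size_iota.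
exists (fun i => t i + r * d i); split.
  move=> i; apply: le_lt_trans (ler_normD _ _) _.
  rewrite [ltRHS](splitr rho); apply: ltr_leD => //.
  rewrite normrM gtr0_norm//; apply: (@le_trans _ _ (r1 * (B + rho))); last first.
    by rewrite /r1 divfK// gt_eqF.
  apply: ler_pM => //; first exact: ltW.
  apply: le_trans (ler_normB _ _) _; rewrite /flip_signs normrM normrX normrN1 expr1n mul1r.
  by apply: lerD => //; apply: le_trans (ltW (trho i)) _; rewrite ler_pdivrMr//; apply: ler_peMr; [exact: ltW|rewrite ler1n].
move=> e' ee'; rewrite unitmxE unitfE.
have -> : flip_signs e' (fun i => t i + r * d i) =
   (fun i => flip_signs e' t i + r * flip_signs e' d i).
  by apply/funext => i; rewrite /flip_signs mulrDr mulrCA.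
rewrite qP; move: pr; rewrite /root /p horner_prod prodf_seq_neq0 => /allP/(_ _ ee').
by [].
Qed.

End ParametrizedWords.

(** * Coordinates given by words *)

(** The join of the complete and normed structures on matrices, for the fixed
point theorem of contractions. *)
HB.instance Definition _ (R : realType) m n := Complete.on 'M[R]_(m, n).

Lemma contraction_fixed_point (R : realType) (n : nat) (f : 'rV[R]_n -> 'rV[R]_n) (rho : R) :
  0 <= rho -> (forall s, `|s| <= rho -> `|f s| <= rho) ->
  (forall s s', `|s| <= rho -> `|s'| <= rho -> `|f s - f s'| <= 2^-1 * `|s - s'|) ->
  exists2 s, `|s| <= rho & f s = s.
Proof.
move=> rho0 fU fL; pose U : set 'rV[R]_n := [set s | `|s| <= rho].
have fun_f : set_fun U U f by move=> s; exact: fU.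
pose g : {fun U >-> U} := mkfun fun_f.
have cg : is_contraction g.
  exists (2^-1)%:nng; split => /=; first by rewrite invf_lt1 ?ltr1n.
  by move=> [s s'] /= [Us Us']; exact: fL.
have clU : closed U.
  rewrite (_ : U = (fun s : 'rV[R]_n => `|s|) @^-1` [set y | y <= rho])//.
  by apply: closed_comp => [s _|]; [exact: norm_continuous|exact: closed_le].
have [|s Us Es] := banach_fixed_point cg clU; first by exists 0; rewrite /U/= normr0.
by exists s.
Qed.

Section WordCharts.
Variables (R : realType) (n : nat) (G : stratified_group R n).
Implicit Types (x y z v s : 'rV[R]_n) (t : nat -> R).
Local Notation "x ** y" := (sg_mul G x y) (at level 40, left associativity).

Let D : set 'rV[R]_n := [set s | `|s| <= 1].
Let nrm (s : 'rV[R]_n) : R := `|s|.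
Let dst (s s' : 'rV[R]_n) : R := `|s - s'|.
Let nrm_ge0 s : D s -> 0 <= nrm s. Proof. by move=> _; exact: normr_ge0. Qed.
Let nrm_le1 s : D s -> nrm s <= 1. Proof. exact. Qed.
Let dst_ge0 s s' : D s -> D s' -> 0 <= dst s s'. Proof. by move=> _ _; exact: normr_ge0. Qed.

(** By [quad_mul], a product of small vectors is their sum up to a [quad]
family. *)
Lemma quad_pword (vs : seq 'rV[R]_n) (c : nat -> {linear 'rV[R]_n -> R}) :
  quad D nrm dst (fun s => pword G vs (fun i => c i s) - \sum_(i < size vs) c i s *: nth 0 vs i).
Proof.
have lin (f : {linear 'rV[R]_n -> R}) v : small D nrm dst (fun s => f s *: v).
  pose K := \sum_i `|f (delta_mx 0 i)|.
  have fK s : `|f s| <= K * `|s|.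
    rewrite {1}(row_sum_delta s) linear_sum.
    apply: le_trans (ler_norm_sum _ _ _) _; rewrite mulr_suml; apply: ler_sum => i _.
    by rewrite linearZ/= normrM mulrC ler_wpM2l// norm_coord_le.
  have K0 : 0 <= K by exact: sumr_ge0.
  exists (K * `|v|); first exact: mulr_ge0.
  split=> [s _|s s' _ _]; rewrite -?scalerBl -?linearB normrZ mulrAC ler_wpM2r//; exact: fK.
elim: vs c => [|v vs IH] c /=.
  under eq_fun do rewrite big_ord0 subr0; exact: quad0.
pose F s := pword G vs (fun i => c i.+1 s).
pose L s := \sum_(i < size vs) c i.+1 s *: nth 0 vs i.
have qF : quad D nrm dst (fun s => F s - L s) by exact: (IH (fun i => c i.+1)).
have sL : small D nrm dst L.
  rewrite /L; elim: (size vs) => [|m IHm].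
    by under eq_fun do rewrite big_ord0; exact: small0.
  by under eq_fun do rewrite big_ord_recr; apply: smallD => //; exact: (lin (c m.+1)).
have sF : small D nrm dst F.
  rewrite (_ : F = fun s => (F s - L s) + L s); last by apply/funext => s; rewrite subrK.
  by apply: smallD => //; apply: (quad_small nrm_ge0 nrm_le1 ler01 dst_ge0).
have := quadD (quad_mul G nrm_ge0 nrm_le1 ler01 dst_ge0 (lin (c 0%N) v) sF) qF.
congr quad; apply/funext => s; rewrite big_ord_recl /=.
rewrite [X in _ = _ - (_ + X)](_ : _ = L s)//.
rewrite -/(F s); set a := _ ** F s; by apply/rowP => i; rewrite !mxE; ring.
Qed.

(** The coordinates of s are assigned, with signs, to the letters selected by f;
the other letters get the parameter 0. *)
Definition spread (e : seq bool) (f : 'I_n -> nat) (i : nat) (s : 'rV[R]_n) : R :=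
  (-1) ^+ nth false e i * \sum_(k | f k == i) s 0 k.

Lemma spread_is_linear e f i : linear_for *%R (spread e f i).
Proof.
move=> a x y; rewrite /spread mulrCA -mulrDr; congr (_ * _).
by rewrite mulr_sumr -big_split; apply: eq_bigr => k _ /=; rewrite !mxE.
Qed.
HB.instance Definition _ e f i := GRing.isLinear.Build R 'rV[R]_n R _ (spread e f i)
  (spread_is_linear e f i).

Definition sign_mx (e : seq bool) (f : 'I_n -> nat) : 'M[R]_n :=
  diag_mx (\row_k (-1) ^+ nth false e (f k)).

Lemma sign_mx_unit e f : sign_mx e f \in unitmx.
Proof.
rewrite unitmxE unitfE det_diag prodf_seq_neq0; apply/allP => k _ /=.
by rewrite mxE signr_eq0.
Qed.

Lemma sum_spread (Xs : seq 'rV[R]_n) t e (f : 'I_n -> nat) (s : 'rV[R]_n) :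
  (forall k, (f k < size Xs)%N) ->
  \sum_(i < size Xs) spread e f i s *: nth 0 (pvecs G Xs t) i =
  s *m (sign_mx e f *m pframe G Xs t f).
Proof.
move=> fX; rewrite /sign_mx mul_diag_mx; apply/rowP => j; rewrite !mxE summxE.
transitivity (\sum_(i < size Xs) \sum_(k | f k == i)
    s 0 k * ((-1) ^+ nth false e (f k) * nth 0 (pvecs G Xs t) (f k) 0 j)).
  apply: eq_bigr => i _; rewrite mxE /spread mulr_sumr mulr_suml.
  by apply: eq_bigr => k /eqP ->; ring.
under eq_bigr do rewrite big_mkcond.
rewrite exchange_big; apply: eq_bigr => k _ /=; rewrite !mxE.
rewrite (bigD1 (Ordinal (fX k)))//= eqxx big1 ?addr0// => i.
by rewrite eq_sym -val_eqE/= => /negbTE ->.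
Qed.

(** Exponential coordinates of the second kind along the directions of a word;
by [pwordD], the word with the perturbed parameters is the original one multiplied
by this chart. *)
Definition word_chart Xs t e f (s : 'rV[R]_n) :=
  pword G (pvecs G Xs t) (fun i => spread e f i s).

Lemma word_chart_linearization Xs t e f : (forall k, (f k < size Xs)%N) ->
  exists2 C : R, 0 <= C & forall s s', `|s| <= 1 -> `|s'| <= 1 ->
    `|(word_chart Xs t e f s - s *m (sign_mx e f *m pframe G Xs t f)) -
      (word_chart Xs t e f s' - s' *m (sign_mx e f *m pframe G Xs t f))|
      <= C * (`|s| + `|s'|) * `|s - s'|.
Proof.
move=> fX; have [C C0 [_ h]] := quad_pword (pvecs G Xs t) (fun i => spread e f i).
exists C => // s s' s1 s'1; have := h s s' s1 s'1.
by rewrite size_pvecs !sum_spread.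
Qed.

Lemma word_chart0 Xs t e f : word_chart Xs t e f 0 = 0.
Proof.
rewrite /word_chart; under [in LHS]eq_fun do rewrite linear0.
by elim: (pvecs _ _ _) => //= v vs IH; rewrite scale0r sg_mul0g.
Qed.

Lemma mulmx_bound (A : 'M[R]_n) : exists2 K : R, 0 < K & forall s : 'rV[R]_n, `|s *m A| <= K * `|s|.
Proof.
have [K K0 h] := norm_linear_le (mulmxr A : {linear 'rV[R]_n -> 'rV[R]_n}).
exists (K + 1); first by rewrite ltr_wpDl.
by move=> s; apply: le_trans (h s) _; rewrite ler_wpM2r// lerDl.
Qed.

(** The linear part of the chart is invertible and the rest has a small Lipschitz
constant near 0. *)
Lemma word_chart_expanding Xs t e f : (forall k, (f k < size Xs)%N) ->
  pframe G Xs t f \in unitmx ->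
  exists rho C : R, [/\ 0 < rho, rho <= 1, 0 < C & forall s s', `|s| <= rho -> `|s'| <= rho ->
    `|s - s'| <= C * `|word_chart Xs t e f s - word_chart Xs t e f s'|].
Proof.
move=> fX uM; have [C C0 hC] := word_chart_linearization t e fX.
set M := sign_mx e f *m _ in hC.
have uM' : M \in unitmx by rewrite unitmx_mul sign_mx_unit.
have [K K0 hK] := mulmx_bound (invmx M).
have KC0 : 0 <= K * C by rewrite mulr_ge0// ltW.
pose rho := Num.min 1 (1 / (4 * (K * C + 1))).
have rho0 : 0 < rho by rewrite lt_min ltr01 divr_gt0// mulr_gt0// ltr_wpDl.
have rho1 : rho <= 1 by rewrite ge_min lexx.
have KCrho : K * C * (rho + rho) <= 1 / 2.
  have : rho <= 1 / (4 * (K * C + 1)) by rewrite ge_min lexx orbT.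
  rewrite ler_pdivlMr; last by rewrite mulr_gt0// ltr_wpDl.
  by move=> h; nra.
exists rho, (2 * K); split => //; first by rewrite mulr_gt0.
move=> s s' hs hs'.
have := hC s s' (le_trans hs rho1) (le_trans hs' rho1).
set F := word_chart _ _ _ _ s; set F' := word_chart _ _ _ _ s'.
move=> hF.
have h1 : `|(s - s') *m M| <= `|F - F'| + C * (`|s| + `|s'|) * `|s - s'|.
  rewrite (_ : _ *m M = (F - F') - ((F - s *m M) - (F' - s' *m M))).
    by apply: le_trans (ler_normB _ _) _; rewrite lerD2l.
  by rewrite mulmxBl !opprB; apply/rowP => i; rewrite !mxE; ring.
have h2 : `|s - s'| <= K * `|(s - s') *m M|.
  by have := hK ((s - s') *m M); rewrite -mulmxA mulmxV// mulmx1.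
have h3 : K * (C * (`|s| + `|s'|) * `|s - s'|) <= 1 / 2 * `|s - s'|.
  rewrite !mulrA ler_wpM2r//; apply: le_trans KCrho.
  by rewrite ler_wpM2l// lerD.
have : K * `|(s - s') *m M| <= K * `|F - F'| + K * (C * (`|s| + `|s'|) * `|s - s'|).
  by rewrite -mulrDr ler_wpM2l// ltW.
by move=> h4; lra.
Qed.

(** With M the linear part of the chart and Q the rest, s -> (w - Q s) M^-1 is a
contraction of a small ball, and its fixed point is sent to w. *)
Lemma word_chart_onto Xs t f : (forall k, (f k < size Xs)%N) ->
  pframe G Xs t f \in unitmx ->
  exists2 rho : R, 0 < rho & forall w, `|w| <= rho ->
    exists2 s, `|s| <= 1 & word_chart Xs t [::] f s = w.
Proof.
move=> fX uM; have [C C0 hC] := word_chart_linearization t [::] fX.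
set M := sign_mx _ f *m _ in hC.
have uM' : M \in unitmx by rewrite unitmx_mul sign_mx_unit.
have [K K0 hK] := mulmx_bound (invmx M).
have KC0 : 0 <= K * C by rewrite mulr_ge0// ltW.
pose rho := Num.min 1 (1 / (4 * (K * C + 1))).
have rho0 : 0 < rho by rewrite lt_min ltr01 divr_gt0// mulr_gt0// ltr_wpDl.
have rho1 : rho <= 1 by rewrite ge_min lexx.
have KCrho : K * C * (rho + rho) <= 1 / 2.
  have : rho <= 1 / (4 * (K * C + 1)) by rewrite ge_min lexx orbT.
  rewrite ler_pdivlMr; last by rewrite mulr_gt0// ltr_wpDl.
  by move=> h; nra.
exists (rho / (2 * K)); first by rewrite divr_gt0// mulr_gt0.
move=> w hw; pose Q s := word_chart Xs t [::] f s - s *m M.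
have Q0 : Q 0 = 0 by rewrite /Q word_chart0 mul0mx subr0.
pose g s := (w - Q s) *m invmx M.
have hQ s s' : `|s| <= rho -> `|s'| <= rho -> K * `|Q s - Q s'| <= 2^-1 * `|s - s'|.
  move=> hs hs'; have := hC s s' (le_trans hs rho1) (le_trans hs' rho1) => h.
  apply: (@le_trans _ _ (K * (C * (`|s| + `|s'|) * `|s - s'|))).
    by rewrite ler_wpM2l// ltW.
  rewrite !mulrA ler_wpM2r//; apply: (@le_trans _ _ (K * C * (rho + rho))); last by rewrite -div1r.
  by rewrite ler_wpM2l// lerD.
have [||s hs gs] := @contraction_fixed_point _ _ g rho (ltW rho0).
- move=> s hs; apply: le_trans (hK _) _.
  have h1 := hQ s 0 hs; rewrite normr0 Q0 !subr0 in h1.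
  have h2 : K * `|w| <= rho / 2.
    by move: hw; rewrite ler_pdivlMr ?mulr_gt0// => hw; nra.
  have := h1 (ltW rho0) => {}h1.
  apply: (@le_trans _ _ (K * `|w| + K * `|Q s|)).
    by rewrite -mulrDr ler_wpM2l ?ler_normB// ltW.
  by lra.
- move=> s s' hs hs'; rewrite (_ : g s - g s' = (Q s' - Q s) *m invmx M).
    by apply: le_trans (hK _) _; rewrite distrC; exact: hQ.
  rewrite /g -mulmxBl; congr (_ *m _); move: (Q s) (Q s') => a b.
  by apply/rowP => i; rewrite !mxE; ring.
exists s; first exact: le_trans rho1.
have : s *m M = w - Q s by rewrite -{1}gs /g -mulmxA mulVmx// mulmx1.
rewrite /Q => E; apply/rowP => i; move/rowP: E => /(_ i).
by rewrite !mxE => E; lra.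
Qed.

End WordCharts.

(** * Points reached by short horizontal words *)

Section HorizontalReach.
Variables (R : realType) (n : nat) (G : stratified_group R n).
Implicit Types (x y z w h : 'rV[R]_n) (r s : R) (a : seq 'rV[R]_n).
Local Notation "x ** y" := (sg_mul G x y) (at level 40, left associativity).

Lemma sg_mul_lipschitz (rho : R) : 0 <= rho -> exists2 C : R, 0 < C &
  forall x x' y y', `|x| <= rho -> `|x'| <= rho -> `|y| <= rho -> `|y'| <= rho ->
  `|x ** y - x' ** y'| <= C * (`|x - x'| + `|y - y'|).
Proof.
move=> rho0.
pose D : set ('rV[R]_n * 'rV[R]_n) := [set p | `|p.1| <= rho /\ `|p.2| <= rho].
pose nrm (p : 'rV[R]_n * 'rV[R]_n) : R := 1.
pose dst (p q : 'rV[R]_n * 'rV[R]_n) : R := `|p.1 - q.1| + `|p.2 - q.2|.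
have n0 p : D p -> 0 <= nrm p by move=> _; exact: ler01.
have n1 p : D p -> nrm p <= 1 by move=> _; exact: lexx.
have d0 p q : D p -> D q -> 0 <= dst p q by move=> _ _; exact: addr_ge0.
have s1 : small D nrm dst (fun p => p.1).
  exists (rho + 1); first exact: addr_ge0.
  split=> [p [h _]|p q _ _]; first by rewrite mulr1; apply: le_trans h _; rewrite lerDl.
  by rewrite /dst mulrDl mul1r; apply: ler_wpDl; rewrite ?mulr_ge0 ?addr_ge0// lerDl.
have s2 : small D nrm dst (fun p => p.2).
  exists (rho + 1); first exact: addr_ge0.
  split=> [p [_ h]|p q _ _]; first by rewrite mulr1; apply: le_trans h _; rewrite lerDl.
  by rewrite /dst mulrDl mul1r; apply: ler_wpDl; rewrite ?mulr_ge0 ?addr_ge0// lerDr.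
have [C C0 [_ h]] := small_mul G n0 n1 ler01 d0 s1 s2.
exists (C + 1); first by rewrite ltr_wpDl.
move=> x x' y y' hx hx' hy hy'; apply: le_trans (h (x, y) (x', y') _ _) _ => //.
by rewrite /dst/= ler_wpM2r ?addr_ge0// lerDl.
Qed.

Lemma sg_mul_near (y : 'rV[R]_n) (e : R) : 0 < e -> exists2 d : R, 0 < d &
  forall z w, `|z - y| <= d -> `|w| <= d -> `|z ** w - y| <= e.
Proof.
move=> e0; have [C C0 hC] := sg_mul_lipschitz (rho := `|y| + 1) (addr_ge0 (normr_ge0 _) ler01).
pose d := Num.min 1 (e / (2 * C)).
have d0 : 0 < d by rewrite lt_min ltr01 divr_gt0// mulr_gt0.
have d1 : d <= 1 by rewrite ge_min lexx.
have dC : C * (d + d) <= e.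
  have : d <= e / (2 * C) by rewrite ge_min lexx orbT.
  rewrite ler_pdivlMr ?mulr_gt0// => h; nra.
exists d => // z w zy wd.
have y0 := normr_ge0 y.
have := hC z y w 0; rewrite sg_mulg0 subr0 normr0 => /(_ _ _ _ _)/le_trans; apply.
- have := ler_normD (z - y) y; rewrite subrK => /le_trans; apply.
  by rewrite addrC lerD2l (le_trans zy).
- by rewrite lerDl.
- by apply: (le_trans wd); apply: (le_trans d1); rewrite lerDr.
- by rewrite addr_ge0.
- by apply: le_trans dC; rewrite ler_pM2l// lerD.
Qed.

(** It plays the role of the ball of radius m r of a homogeneous distance;
counting the letters makes it compatible with products and with dilations. *)
Definition reach (m : nat) r w := exists a,
  [/\ (size a <= m)%N, horizontal_seq G a, forall x, x \in a -> `|x| <= r & hword G a = w].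

Lemma reach0 m r : reach m r 0.
Proof. by exists [::]; split => // x; rewrite in_nil. Qed.

Lemma reach_mul m m' r w w' : reach m r w -> reach m' r w' -> reach (m + m') r (w ** w').
Proof.
move=> [a [sa ha na <-]] [a' [sa' ha' na' <-]]; exists (a ++ a'); split.
- by rewrite size_cat leq_add.
- by move=> x; rewrite mem_cat => /orP[/ha|/ha'].
- by move=> x; rewrite mem_cat => /orP[/na|/na'].
- exact: hword_cat.
Qed.

Lemma reach1 r h : horizontal G h -> `|h| <= r -> reach 1 r h.
Proof.
move=> hh hr; exists [:: h]; split => //=; last by rewrite sg_mulg0.
- by move=> x; rewrite inE => /eqP->.
- by move=> x; rewrite inE => /eqP->.
Qed.

Lemma le_reach m m' r r' w : (m <= m')%N -> r <= r' -> reach m r w -> reach m' r' w.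
Proof.
move=> mm rr [a [sa ha na wa]]; exists a; split => //; first exact: leq_trans mm.
by move=> x /na/le_trans; apply.
Qed.

Lemma reach_dilation m r s w : 0 <= s -> reach m r w -> reach m (s * r) (dilation G s w).
Proof.
move=> s0 [a [sa ha na <-]]; exists [seq s *: x | x <- a]; split.
- by rewrite size_map.
- by move=> _ /mapP[x /ha hx ->]; rewrite /horizontal/=; exact: memvZ.
- by move=> _ /mapP[x /na hx ->]; rewrite normrZ ger0_norm// ler_wpM2l.
- elim: a ha {sa na} => [_|x a IH ha] /=; first by rewrite linear0.
  rewrite dilation_mul (dilation_horizontal s) ?IH//.
    by move=> z za; apply: ha; rewrite in_cons za orbT.
  by apply: ha; rewrite mem_head.
Qed.

Lemma reach_small m (e : R) : 0 < e -> exists2 r : R, 0 < r & forall w, reach m r w -> `|w| <= e.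
Proof.
elim: m e => [|m IH] e e0.
  by exists 1 => // w [a []]; rewrite leqn0 size_eq0 => /eqP-> _ _ <-; rewrite normr0 ltW.
have [d d0 hd] := sg_mul_near 0 e0.
have [r r0 hr] := IH d d0.
exists (Num.min r d); first by rewrite lt_min r0.
move=> w [[|x a] [sa ha na <-]]; first by rewrite normr0 ltW.
rewrite /= -[X in `|X|]subr0; apply: hd.
  by rewrite subr0; have := na x; rewrite mem_head le_min => /(_ isT)/andP[].
apply: hr; exists a; split => //.
- by move=> z za; apply: ha; rewrite in_cons za orbT.
- move=> z za; have := na z; rewrite in_cons za orbT le_min => /(_ isT)/andP[].
  by [].
Qed.

Lemma reach_near (y : 'rV[R]_n) m (e : R) : 0 < e -> exists2 r : R, 0 < r &
  forall w, reach m r w -> `|y ** w - y| <= e.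
Proof.
move=> e0; have [d d0 hd] := sg_mul_near y e0.
have [r r0 hr] := reach_small m d0.
by exists r => // w /hr; apply: hd; rewrite subrr normr0 ltW.
Qed.

Lemma norm_nth_le a i : `|nth 0 a i| <= \sum_(x <- a) `|x|.
Proof.
have [ia|ai] := ltnP i (size a); last by rewrite nth_default// normr0; exact: sumr_ge0.
rewrite (big_nth 0) big_mkord (bigD1 (Ordinal ia))//= lerDl.
exact: sumr_ge0.
Qed.

Lemma norm_spread_le e (f : 'I_n -> nat) i (s : 'rV[R]_n) : `|spread e f i s| <= n%:R * `|s|.
Proof.
rewrite /spread normrM normrX normrN1 expr1n mul1r.
apply: le_trans (ler_norm_sum _ _ _) _.
have -> : n%:R * `|s| = \sum_(k < n) `|s| by rewrite sumr_const card_ord mulr_natl.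
rewrite big_mkcond/=; apply: ler_sum => k _.
by case: ifP => _; [exact: norm_coord_le|exact: normr_ge0].
Qed.

Lemma reach_pword Xs (t : nat -> R) (B : R) : horizontal_seq G Xs -> (forall i, `|t i| <= B) ->
  reach (size Xs) (B * \sum_(x <- Xs) `|x|) (pword G Xs t).
Proof.
move=> hXs tB; exists [seq t i *: nth 0 Xs i | i <- iota 0 (size Xs)]; split.
- by rewrite size_map size_iota.
- move=> x /mapP[i]; rewrite mem_iota add0n => /andP[_ iX] ->.
  by rewrite /horizontal/=; apply: memvZ; apply: hXs; exact: mem_nth.
- move=> _ /mapP[i _ ->]; rewrite normrZ ler_pM//; exact: norm_nth_le.
- by rewrite pword_hword.
Qed.

Lemma reach_opp m r w : reach m r w -> reach m r (- w).
Proof.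
move=> [a [sa ha na <-]]; exists (inverse_letters a); split.
- by rewrite /inverse_letters size_rev size_map.
- exact: horizontal_inverse.
- by move=> x; rewrite /inverse_letters mem_rev => /mapP[y /na hy ->]; rewrite normrN.
- exact: hword_inverse.
Qed.

(** The chart of a spanning word covers a neighbourhood of 0, and its values are
products of the inverse of the word and a perturbation of the word. Dilations
shorten the letters without changing their number. *)
Lemma reach_neighborhood : exists m, forall eta : R, 0 < eta ->
  exists2 rho : R, 0 < rho & forall w, `|w| <= rho -> reach m eta w.
Proof.
have [Xs [t [f [hXs [B tB] fX _ uM]]]] := spanning_word G.
have [rho rho0 onto] := word_chart_onto fX uM.
pose L := \sum_(x <- Xs) `|x|.
have L0 : 0 <= L by exact: sumr_ge0.
have B0 : 0 <= B by apply: le_trans (tB 0%N).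
have n0 : 0 <= (n%:R : R) by exact: ler0n.
pose K := (B + n%:R) * L.
have K0 : 0 <= K by rewrite mulr_ge0// addr_ge0.
have reachK w : `|w| <= rho -> reach (size Xs + size Xs) K w.
  move=> /onto[s s1 <-].
  have -> : word_chart G Xs t [::] f s =
      (- pword G Xs t) ** pword G Xs (fun i => t i + spread [::] f i s).
    by rewrite pwordD sg_mulKg.
  apply: reach_mul.
    apply: reach_opp; apply: le_reach (reach_pword hXs tB) => //.
    by rewrite /K ler_wpM2r// lerDl.
  apply: reach_pword => // i; apply: le_trans (ler_normD _ _) _.
  rewrite lerD//; apply: le_trans (norm_spread_le _ _ _ _) _.
  by rewrite ler_piMr.
exists (size Xs + size Xs)%N => eta eta0.
pose l := eta / (K + 1).
have l0 : 0 < l by rewrite divr_gt0// ltr_wpDl.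
have [C C0 hC] := norm_linear_le (dilation G l^-1).
exists (rho / (C + 1)); first by rewrite divr_gt0// ltr_wpDl.
move=> w; rewrite ler_pdivlMr ?ltr_wpDl// => hw.
have -> : w = dilation G l (dilation G l^-1 w).
  by rewrite dilationM mulfV ?dilation1// gt_eqF.
apply: le_reach (reach_dilation (ltW l0) (reachK _ _)) => //.
  by rewrite /l mulrAC ler_pdivrMr ?ltr_wpDl// ler_pM2l// lerDl.
apply: le_trans (hC _) _; apply: le_trans hw.
by rewrite mulrC ler_wpM2l// lerDl.
Qed.

End HorizontalReach.

(** * Measurable h-convex functions are locally bounded above *)

Section LocalBounds.
Variables (R : realType) (n : nat) (G : stratified_group R n).
Variables (Omega : set 'rV[R]_n) (u : 'rV[R]_n -> R).
Hypothesis Omega_open : open Omega.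
Hypothesis u_meas : lebesgue_measurable_fun Omega u.
Hypothesis u_conv : h_convex G Omega u.
Implicit Types (x y z w h s : 'rV[R]_n) (r : R).
Local Notation "x ** y" := (sg_mul G x y) (at level 40, left associativity).

Lemma h_convex_line x h l : horizontal G h ->
  (forall t, 0 <= t <= 1 -> Omega (x ** (t *: h))) -> 0 <= l <= 1 ->
  u (x ** (l *: h)) <= l * u (x ** h) + (1 - l) * u x.
Proof.
move=> hh hO l01.
have Ox : Omega x by have := hO 0; rewrite scale0r sg_mulg0; apply; rewrite lexx ler01.
have Oxh : Omega (x ** h) by have := hO 1; rewrite scale1r; apply; rewrite lexx ler01.
have := u_conv Ox Oxh; rewrite sg_invE sg_mulKg => /(_ hh).
move=> H; rewrite -(dilation_horizontal l hh); apply: H => //.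
by move=> _ [t /= t01 <-]; rewrite (dilation_horizontal t hh); apply: hO; move: t01; rewrite in_itv.
Qed.

Lemma h_convex_midpoint z h : horizontal G h ->
  (forall t, `|t| <= 1 -> Omega (z ** (t *: h))) ->
  u z <= (u (z ** h) + u (z ** (- h))) / 2.
Proof.
move=> hh hO.
have seg (t : R) : z ** (- h) ** (t *: (2 *: h)) = z ** ((2 * t - 1) *: h).
  by rewrite -sg_mulA -scaleN1r scalerA sg_mulZZ; congr (_ ** (_ *: _)); ring.
have h2 : horizontal G (2 *: h) by rewrite /horizontal/=; exact: memvZ.
have := @h_convex_line (z ** (- h)) (2 *: h) (1 / 2) h2.
have := seg 1; rewrite scale1r => ->.
rewrite seg (_ : 2 * (1 / 2) - 1 = 0 :> R) ?scale0r ?sg_mulg0; last by lra.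
rewrite (_ : 2 * 1 - 1 = 1 :> R) ?scale1r; last by lra.
move=> H; suff : u z <= 1 / 2 * u (z ** h) + (1 - 1 / 2) * u (z ** (- h)) by move=> ?; lra.
apply: H; last by apply/andP; split; lra.
move=> t /andP[t0 t1]; rewrite seg; apply: hO.
by rewrite ler_norml; apply/andP; split; lra.
Qed.

(** u(z) is at most the mean, hence the maximum, of the values at z h and z (-h);
iterate along the letters. *)
Lemma sign_bound Xs z (t : nat -> R) M : horizontal_seq G Xs ->
  (forall t', (forall i, `|t' i| <= `|t i|) -> Omega (z ** pword G Xs t')) ->
  (forall e, size e = size Xs -> u (z ** pword G Xs (flip_signs e t)) <= M) ->
  u z <= M.
Proof.
elim: Xs z t => [|X Xs IH] z t hXs hO hM.
  by have := hM [::] erefl; rewrite /= sg_mulg0.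
have hX : horizontal G X by apply: hXs; rewrite mem_head.
have hXs' : horizontal_seq G Xs by move=> x xX; apply: hXs; rewrite in_cons xX orbT.
have side b : u (z ** (((-1) ^+ nat_of_bool b * t 0%N) *: X)) <= M.
  apply: (IH _ (fun i => t i.+1)) => // [t' t't|e se].
    have := hO (fun i => if i is j.+1 then t' j else (-1) ^+ nat_of_bool b * t 0%N).
    rewrite /= sg_mulA; apply => -[|i] //=.
    by rewrite normrM normrX normrN1 expr1n mul1r.
  by have := hM (b :: e); rewrite /= se sg_mulA => /(_ erefl).
have := side false; have := side true; rewrite expr0 expr1 mul1r mulN1r scaleNr.
move=> h1 h2.
have := @h_convex_midpoint z (t 0%N *: X) (memvZ _ hX) => H.
suff : u z <= (u (z ** (t 0%N *: X)) + u (z ** - (t 0%N *: X))) / 2 by move=> ?; lra.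
apply: H => l l1.
have := hO (fun i => if i is 0%N then l * t 0%N else 0).
rewrite /= scalerA (_ : pword G Xs (fun=> 0) = 0).
  rewrite sg_mulg0; apply => -[|i] /=; last by rewrite normr0.
  by rewrite normrM ler_piMl.
by elim: (Xs) => //= Y Ys ->; rewrite scale0r sg_mul0g.
Qed.

Lemma cube_ballE y e z : 0 <= e -> cube (y - const_mx e) (2 * e) z <-> `|z - y| <= e.
Proof.
move=> e0; split=> [h|h i].
  rewrite [leLHS]/Num.norm/= mx_normrE; apply/bigmax_leP; split => // -[k j] _ /=.
  by rewrite ord1; have := h j; rewrite !mxE ler_distl => /andP[h1 h2]; apply/andP; split; lra.
have := le_trans (norm_coord_le (z - y) i) h; rewrite !mxE ler_distl.
by move=> /andP[h1 h2]; apply/andP; split; lra.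
Qed.

Lemma open_contains_ball y : Omega y -> exists2 e : R, 0 < e & forall z, `|z - y| <= e -> Omega z.
Proof.
move=> Oy; have /nbhs_ballP[e /= e0 eO] : nbhs y Omega by exact: open_nbhs_nbhs.
exists (e / 2); first exact: divr_gt0.
move=> z zy; apply: eO; rewrite -ball_normE/= distrC; apply: le_lt_trans zy _.
by rewrite ltr_pdivrMr// ltr_pMr// ltr1n.
Qed.

Lemma expanding_charts Xs f (t : nat -> R) (es : seq (seq bool)) :
  (forall k : 'I_n, (f k < size Xs)%N) ->
  (forall e, e \in es -> pframe G Xs (flip_signs e t) f \in unitmx) ->
  exists sg C : R, [/\ 0 < sg, 0 < C & forall e s s', e \in es ->
    `|s| <= sg -> `|s'| <= sg -> `|s - s'| <=
    C * `|word_chart G Xs (flip_signs e t) e f s - word_chart G Xs (flip_signs e t) e f s'|].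
Proof.
move=> fX; elim: es => [|e es IH] ues; first by exists 1, 1; split.
have [sg [C [sg0 C0 hC]]] := IH (fun e' he' => ues e' (@mem_behead _ (e :: es) e' he')).
have [sg' [C' [sg'0 _ C'0 hC']]] := word_chart_expanding e fX (ues e (mem_head _ _)).
exists (Num.min sg sg'), (C + C'); split; first by rewrite lt_min sg0.
  exact: addr_gt0.
move=> e' s s'; rewrite inE !le_min => ee /andP[h1 h2] /andP[h3 h4].
move: ee => /orP[/eqP->|ee].
  by apply: le_trans (hC' _ _ h2 h4) _; rewrite ler_wpM2r// lerDr ltW.
by apply: le_trans (hC _ _ _ ee h1 h3) _; rewrite ler_wpM2r// lerDl ltW.
Qed.

Lemma flip_signsD e (t : nat -> R) f s :
  flip_signs e (fun i => t i + spread [::] f i s) = (fun i => flip_signs e t i + spread e f i s).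
Proof.
by apply/funext => i; rewrite /flip_signs mulrDr /spread nth_nil expr0 mul1r.
Qed.

(** Let N be the number of letters of a spanning word. For z near y, the
parameters s for which the word with signs b, applied at z, hits the part of a cube
where u > M have measure at most a constant times that of this part; for M large,
the 2^N sets of bad parameters do not cover a small ball. A parameter
outside of all of them gives u(z) <= M by [sign_bound]. The constants do not depend
on z. *)
Lemma locally_bounded_above y : Omega y -> exists (eta M : R), 0 < eta /\
  forall z, `|z - y| <= eta -> u z <= M.
Proof.
move=> /open_contains_ball[e e0 eO].
have [Xs [t0 [f [hXs [B tB] fX _ uM]]]] := spanning_word G.
set N := size Xs in fX.
pose es := [seq val b | b <- enum {: N.-tuple bool}].
have [d d0 hd] := sg_mul_near G y e0.
have [r r0 hr] := reach_small G N d0.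
pose L := \sum_(x <- Xs) `|x|.
have L0 : 0 <= L by exact: sumr_ge0.
have L1 : 0 < L + 1 by rewrite ltr_wpDl.
pose rho := r / (2 * (L + 1)).
have rho0 : 0 < rho by rewrite divr_gt0// mulr_gt0.
have rhoL : (rho + rho) * L <= r.
  have : rho * (2 * (L + 1)) = r by rewrite divfK// gt_eqF// mulr_gt0.
  nra.
have [t [trho tes]] := generic_params es rho0 uM tB.
have [sg0 [C [sg0p C0 hC]]] := expanding_charts fX tes.
have nn : 0 < n%:R + 1 :> R by rewrite ltr_wpDl// ler0n.
pose sg := Num.min sg0 (rho / (n%:R + 1)).
have sgp : 0 < sg by rewrite lt_min sg0p divr_gt0.
have sgrho : n%:R * sg <= rho.
  apply: (@le_trans _ _ ((n%:R + 1) * sg)); first by rewrite ler_pM2r// lerDl.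
  by rewrite mulrC -ler_pdivlMr// ge_min lexx orbT.
have small z t' : `|z - y| <= d -> (forall i, `|t' i| <= rho + rho) ->
    `|z ** pword G Xs t' - y| <= e.
  move=> zy ht; apply: hd => //; apply: hr.
  by apply: le_reach (reach_pword hXs ht).
have [C1 C10 lip] := sg_mul_lipschitz G (addr_ge0 (normr_ge0 y) (ltW e0)).
have bound z : `|z - y| <= e -> `|z| <= `|y| + e.
  by move=> zy; rewrite -[z](subrK y); apply: le_trans (ler_normD _ _) _; rewrite addrC lerD2l.
pose phi z b s := z ** pword G Xs (flip_signs b (fun i => t i + spread [::] f i s)).
pose S : set 'rV[R]_n := [set s | `|s| <= sg].
have par b s i : S s -> `|flip_signs b (fun i => t i + spread [::] f i s) i| <= rho + rho.
  move=> Ss; rewrite /flip_signs normrM normrX normrN1 expr1n mul1r.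
  apply: le_trans (ler_normD _ _) _; apply: lerD; first exact: ltW.
  apply: le_trans (norm_spread_le _ _ _ _) _; apply: le_trans sgrho.
  by rewrite ler_wpM2l// ler0n.
have exp_phi z b : `|z - y| <= d -> b \in es -> forall s s', S s -> S s' ->
    `|s - s'| <= C * C1 * `|phi z b s - phi z b s'|.
  move=> zy bes s s' Ss Ss'.
  pose c := z ** pword G Xs (flip_signs b t).
  have cE s0 : phi z b s0 = c ** word_chart G Xs (flip_signs b t) b f s0.
    by rewrite /phi flip_signsD pwordD sg_mulA.
  apply: le_trans (hC b s s' bes _ _) _.
  - by apply: (le_trans Ss); rewrite ge_min lexx.
  - by apply: (le_trans Ss'); rewrite ge_min lexx.
  rewrite -mulrA ler_pM2l//.
  have := lip (- c) (- c) (phi z b s) (phi z b s').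
  rewrite subrr normr0 add0r !cE !sg_mulKg -!cE; apply.
  - rewrite normrN; apply: bound; apply: small => // i.
    rewrite /flip_signs normrM normrX normrN1 expr1n mul1r.
    by apply: (le_trans (ltW (trho i))); rewrite lerDl ltW.
  - rewrite normrN; apply: bound; apply: small => // i.
    rewrite /flip_signs normrM normrX normrN1 expr1n mul1r.
    by apply: (le_trans (ltW (trho i))); rewrite lerDl ltW.
  - by apply: bound; apply: small => // i; exact: par.
  - by apply: bound; apply: small => // i; exact: par.
pose V := (2 * sg) ^+ n.
have V0 : 0 < V by rewrite exprn_gt0// mulr_gt0.
pose K := #|(xpredT : pred (N.-tuple bool))|%:R * (2 * (C * C1)) ^+ n : R.
have K0 : 0 <= K by rewrite mulr_ge0// ?ler0n// exprn_ge0// !mulr_ge0// ltW.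
have K1 : 0 < K + 1 by rewrite ltr_wpDl.
have [|||M hM] := @superlevel_measure_small _ _ _ _ (y - const_mx e) (2 * e) (V / (K + 1)) u_meas.
- by rewrite mulr_ge0// ltW.
- by move=> z /(cube_ballE _ _ (ltW e0)); exact: eO.
- exact: divr_gt0.
exists d, M; split => // z zy.
rewrite leNgt; apply/negP => Mz.
set Bad := cube _ _ `&` _ in hM.
have cover : cube (0 - const_mx sg) (2 * sg) `<=`
    [set s | exists2 b : N.-tuple bool, xpredT b & (S `&` phi z b @^-1` Bad) s].
  move=> s /(cube_ballE _ _ (ltW sgp)); rewrite subr0 => Ss.
  apply: contrapT => nb.
  suff : u z <= M by rewrite leNgt Mz.
  apply: (@sign_bound Xs z (fun i => t i + spread [::] f i s)) => // [t' ht'|b sb].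
    apply: eO; apply: small => // i; apply: le_trans (ht' i) _.
    by have := par [::] s i Ss; rewrite /flip_signs nth_nil expr0 mul1r.
  rewrite leNgt; apply/negP => Mb; apply: nb.
  have sbN : size b == N by rewrite sb.
  exists (Tuple sbN) => //; split => //; split => //=.
  by apply/(cube_ballE _ _ (ltW e0)); apply: small => // i; exact: par.
have := le_trans (cube_measure_cube_ge _ _) (cube_measure_fin_subadditive cover).
move=> /(_ (mulr_ge0 (ler0n _ 2) (ltW sgp))).
apply/negP; rewrite -ltNge.
have -> : ((2 * sg) ^+ n)%:E = V%:E by [].
apply: (@le_lt_trans _ _ (\sum_(b : N.-tuple bool) ((2 * (C * C1)) ^+ n * (V / (K + 1)))%:E)%E).
  apply: lee_sum => b _.
  apply: le_trans (expanding_preimage_measure _ (mulr_gt0 C0 C10) (exp_phi z b zy _)) _.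
    by apply/mapP; exists b => //; rewrite mem_enum.
  by rewrite EFinM lee_wpmul2l ?lee_fin ?exprn_ge0 ?mulr_ge0 ?ltW.
rewrite sumEFin lte_fin sumr_const.
set c := #|_|; rewrite -(mulr_natl ((2 * (C * C1)) ^+ n * (V / (K + 1))) c) mulrA -/K.
rewrite mulrA ltr_pdivrMr//.
by rewrite mulrC ltr_pM2l// ltrDl.
Qed.

End LocalBounds.

(** * From local upper bounds to horizontal Lipschitz bounds *)

Section LocalLipschitz.
Variables (R : realType) (n : nat) (G : stratified_group R n).
Variables (Omega : set 'rV[R]_n) (u : 'rV[R]_n -> R).
Hypothesis Omega_open : open Omega.
Hypothesis u_conv : h_convex G Omega u.
Hypothesis u_above : forall y, Omega y -> exists (eta M : R), 0 < eta /\
  forall z, `|z - y| <= eta -> u z <= M.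
Implicit Types (x y z w h k : 'rV[R]_n) (r s t : R).
Local Notation "x ** y" := (sg_mul G x y) (at level 40, left associativity).

Lemma sg_div_near (y : 'rV[R]_n) rho : 0 < rho -> exists2 eta : R, 0 < eta &
  forall z, `|z - y| <= eta -> `|(- y) ** z| <= rho.
Proof.
move=> rho0; have [C C0 lip] := sg_mul_lipschitz G (addr_ge0 (normr_ge0 y) ler01).
exists (Num.min 1 (rho / C)); first by rewrite lt_min ltr01 divr_gt0.
move=> z; rewrite le_min ler_pdivlMr// mulrC => /andP[z1 zC].
have -> : (- y) ** z = (- y) ** z - (- y) ** y by rewrite sg_mulNg subr0.
have y1 : `|y| <= `|y| + 1 by rewrite lerDl.
apply: le_trans (lip (- y) (- y) z y _ _ _ _) _; rewrite ?normrN//.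
  by rewrite -[z](subrK y); apply: le_trans (ler_normD _ _) _; rewrite addrC lerD2l.
by rewrite subrr normr0 add0r.
Qed.

(** u(z h) >= 2 u(z) - u(z (-h)) >= 2 u(z) - M at each letter, that is,
M - u(z h) <= 2 (M - u(z)). *)
Lemma bounded_below_along a z r M : horizontal_seq G a -> (forall x, x \in a -> `|x| <= r) ->
  (forall w, reach G (size a) r w -> Omega (z ** w) /\ u (z ** w) <= M) ->
  M - u (z ** hword G a) <= 2 ^+ size a * (M - u z).
Proof.
elim: a z => [|h a IH] z ha na hM /=; first by rewrite sg_mulg0 expr0 mul1r.
have hh : horizontal G h by apply: ha; rewrite mem_head.
have nh : `|h| <= r by apply: na; rewrite mem_head.
rewrite sg_mulA exprSr -mulrA; apply: (@le_trans _ _ (2 ^+ size a * (M - u (z ** h)))).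
  apply: IH => [x xa|x xa|w hw].
  - by apply: ha; rewrite in_cons xa orbT.
  - by apply: na; rewrite in_cons xa orbT.
  - by rewrite -sg_mulA; apply: hM; apply: (reach_mul (m := 1) (reach1 hh nh) hw).
rewrite ler_wpM2l ?exprn_ge0//.
have one w : reach G 1 r w -> reach G (size (h :: a)) r w by apply: le_reach.
have := @h_convex_midpoint _ _ _ _ _ u_conv z h hh => H.
have hN : horizontal G (- h) by rewrite /horizontal/= rpredN.
have : u (z ** - h) <= M by have [|//] := hM (- h); apply: one; apply: reach1; rewrite ?normrN.
suff : u z <= (u (z ** h) + u (z ** - h)) / 2 by move=> *; lra.
apply: H => t t1; have [|//] := hM (t *: h); apply: one; apply: reach1.
  by rewrite /horizontal/=; exact: memvZ.
by rewrite normrZ; apply: le_trans nh; rewrite ler_piMl.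
Qed.

Lemma locally_bounded y : Omega y -> exists (eta K : R), 0 < eta /\
  forall z, `|z - y| <= eta -> Omega z /\ `|u z| <= K.
Proof.
move=> Oy; have [e e0 eO] := open_contains_ball Omega_open Oy.
have [e' [M [e'0 eM]]] := u_above Oy.
have [m hm] := reach_neighborhood G.
have e10 : 0 < Num.min e e' by rewrite lt_min e0.
have [r r0 hr] := reach_near G y m e10.
have [rho rho0 hrho] := hm r r0.
have [eta eta0 heta] := sg_div_near y rho0.
have near w : reach G m r w -> Omega (y ** w) /\ u (y ** w) <= M.
  by move=> /hr; rewrite le_min => /andP[/eO h1 /eM h2].
have My : 0 <= M - u y by rewrite subr_ge0; apply: eM; rewrite subrr normr0 ltW.
exists eta, (`|M| + 2 ^+ m * (M - u y)); split => // z /heta/hrho[a [sa ha na wa]].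
have zE : z = y ** hword G a by rewrite wa sg_mulNKg.
have [Oz uz] : Omega z /\ u z <= M by rewrite zE; apply: near; exists a.
split => //; have := @bounded_below_along a y r M ha na; rewrite -zE => H.
have {}H : M - u z <= 2 ^+ m * (M - u y).
  apply: le_trans (H _) _.
    by move=> w hw; apply: near; apply: le_reach hw.
  by rewrite ler_wpM2r// ler_eXn2l// ltr1n.
rewrite ler_norml; apply/andP; split.
  by have := lerNnormlW (lexx `|M|); lra.
have := ler_norm M; have : 0 <= 2 ^+ m * (M - u y) by rewrite mulr_ge0// exprn_ge0.
by lra.
Qed.

(** A convex function of one variable that is bounded by K on a segment has slopes
at most 2 K / r at distance r from its ends. *)
Lemma horizontal_lipschitz y : Omega y -> exists (eta r L : R),
  [/\ 0 < eta, 0 < r, 0 <= L, forall z, `|z - y| <= eta -> Omega z &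
   forall z h, horizontal G h -> `|z - y| <= eta -> `|h| <= r ->
     `|u (z ** h) - u z| <= L * `|h|].
Proof.
move=> /locally_bounded[e [K [e0 hK]]].
have [d d0 hd] := sg_mul_near G y e0.
have dm0 : 0 < Num.min d e by rewrite lt_min d0.
have [d' d'0 hd'] := sg_mul_near G y dm0.
have K0 : 0 <= K.
  have yy : `|y - y| <= e by rewrite subrr normr0 ltW.
  by have [_ uy] := hK y yy; exact: le_trans (normr_ge0 _) uy.
pose r := Num.min d d'.
have r0 : 0 < r by rewrite lt_min d0.
have one z h : horizontal G h -> `|z - y| <= d -> `|z - y| <= e -> `|h| <= r ->
    u (z ** h) - u z <= 2 * K / r * `|h|.
  move=> hh zy ze hr.
  have [->|h0] := eqVneq h 0; first by rewrite sg_mulg0 subrr normr0 mulr0.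
  have nh0 : 0 < `|h| by rewrite normr_gt0.
  pose k := (r / `|h|) *: h; pose l := `|h| / r.
  have l0 : 0 <= l by rewrite divr_ge0// ltW.
  have lk : l *: k = h.
    by rewrite /k scalerA /l mulrA divfK ?gt_eqF// divff ?scale1r// gt_eqF.
  have nk : `|k| = r by rewrite normrZ ger0_norm ?divr_ge0 ?ltW// divfK// gt_eqF.
  have seg (t : R) : 0 <= t <= 1 -> `|z ** (t *: k) - y| <= e.
    move=> /andP[t0 t1]; apply: hd => //; rewrite normrZ nk ger0_norm//.
    by apply: le_trans (_ : r <= d); [rewrite ler_piMl// ltW|rewrite ge_min lexx].
  have hk : horizontal G k by rewrite /horizontal/=; exact: memvZ.
  have := @h_convex_line _ _ _ _ _ u_conv z k l hk.
  rewrite lk => /(_ _ _)H.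
  have {}H : u (z ** h) <= l * u (z ** k) + (1 - l) * u z.
    apply: H; last by rewrite l0 ler_pdivrMr// mul1r.
    by move=> t /seg/hK[].
  have [_ uz] := hK z ze.
  have [_ uk] : Omega (z ** k) /\ `|u (z ** k)| <= K.
    by apply: hK; have := seg 1; rewrite scale1r ler01 lexx; apply.
  rewrite (_ : 2 * K / r * `|h| = l * (2 * K)); last by rewrite /l; ring.
  have : l * (u (z ** k) - u z) <= l * (2 * K).
    rewrite ler_wpM2l//; move: uz uk; rewrite !ler_norml => /andP[? ?] /andP[? ?]; lra.
  by move=> ?; lra.
exists (Num.min e (Num.min d d')), r, (2 * K / r); split => //.
- by rewrite !lt_min e0 d0.
- by rewrite divr_ge0 ?mulr_ge0// ltW.
- by move=> z; rewrite le_min => /andP[/hK[]].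
move=> z h hh; rewrite !le_min => /and3P[ze zd zd'] hr'.
have hr : `|h| <= r by rewrite le_min.
have /andP[_ hd'h] := hr'.
have := hd' z h zd' hd'h; rewrite le_min => /andP[zhd zhe].
rewrite ler_norml one// andbT.
have hN : horizontal G (- h) by rewrite /horizontal/= rpredN.
have := one (z ** h) (- h) hN zhd zhe; rewrite normrN => /(_ hr).
by rewrite -sg_mulA sg_mulgN sg_mulg0 => ?; lra.
Qed.

(** This expresses the Lipschitz property for the homogeneous distance: the
increment is measured by the lengths of the letters. *)
Lemma reach_lipschitz y : Omega y -> exists (eta r0 L : R),
  [/\ 0 < eta, 0 < r0, 0 <= L, forall z, `|z - y| <= eta -> Omega z &
   forall m z r w, r <= r0 -> (forall w', reach G m r w' -> `|z ** w' - y| <= eta) ->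
     reach G m r w -> `|u (z ** w) - u z| <= L * m%:R * `|r|].
Proof.
move=> /horizontal_lipschitz[eta [r0 [L [eta0 r00 L0 hO hL]]]].
exists eta, r0, L; split => // m z r w rr0 hz [a [sa ha na <-]].
have {}hz w' : reach G (size a) r w' -> `|z ** w' - y| <= eta.
  by move=> h; apply: hz; apply: le_reach h.
apply: (@le_trans _ _ (L * (size a)%:R * `|r|)); last first.
  by rewrite ler_wpM2r// ler_wpM2l// ler_nat.
elim: a {sa} z ha na hz => [|h a IH] z ha na hz /=.
  by rewrite sg_mulg0 subrr normr0 mulr0 mul0r.
have hh : horizontal G h by apply: ha; rewrite mem_head.
have nh : `|h| <= r by apply: na; rewrite mem_head.
rewrite sg_mulA -(subrK (u (z ** h)) (u (_ ** hword G a))) -addrA.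
apply: le_trans (ler_normD _ _) _.
rewrite -natr1 mulrDr mulrDl mulr1; apply: lerD.
  apply: IH => [x xa|x xa|w' hw'].
  - by apply: ha; rewrite in_cons xa orbT.
  - by apply: na; rewrite in_cons xa orbT.
  - by rewrite -sg_mulA; apply: hz; apply: (reach_mul (m := 1) (reach1 hh nh) hw').
apply: le_trans (hL _ _ hh _ _) _.
- by rewrite -[z](sg_mulg0 G); apply: hz; exact: reach0.
- exact: le_trans nh rr0.
- by rewrite ler_wpM2l//; apply: (le_trans nh); exact: ler_norm.
Qed.

Lemma segment_near y h (e : R) : 0 < e -> exists2 s0 : R, 0 < s0 &
  forall s, 0 <= s <= s0 -> `|y ** (s *: h) - y| <= e.
Proof.
move=> e0; have [d d0 hd] := sg_mul_near G y e0.
exists (d / (`|h| + 1)); first by rewrite divr_gt0// ltr_wpDl.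
move=> s /andP[s0]; rewrite ler_pdivlMr ?ltr_wpDl// => sd; apply: hd.
  by rewrite subrr normr0 ltW.
by rewrite normrZ ger0_norm//; apply: le_trans sd; rewrite ler_wpM2l// lerDl.
Qed.

(** * One-sided derivatives along horizontal lines *)

Definition admissible y h s := 0 < s /\ forall t, 0 <= t <= 1 -> Omega (y ** ((t * s) *: h)).

Definition diff_quotient y h s := (u (y ** (s *: h)) - u y) / s.

(** The one-sided derivative; an infimum suffices because the difference quotients
of a convex function are monotone. *)
Definition hderiv y h : R := inf [set diff_quotient y h s | s in admissible y h].

Lemma admissible_small y h : Omega y -> exists2 s0 : R, 0 < s0 &
  forall s, 0 < s <= s0 -> admissible y h s.
Proof.
move=> Oy; have [e e0 eO] := open_contains_ball Omega_open Oy.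
have [s0 s00 hs] := segment_near y h e0.
exists s0 => // s /andP[sp ss]; split => // t /andP[t0 t1].
apply: eO; apply: hs; rewrite mulr_ge0 ?(ltW sp)//=; apply: le_trans ss.
by rewrite ler_piMl// ltW.
Qed.

Lemma diff_quotient_monotone y h s s' : horizontal G h -> admissible y h s -> 0 < s' <= s ->
  diff_quotient y h s' <= diff_quotient y h s.
Proof.
move=> hh [s0 hs] /andP[s'0 s's].
have hk : horizontal G (s *: h) by rewrite /horizontal/=; exact: memvZ.
have := @h_convex_line _ _ _ _ _ u_conv y (s *: h) (s' / s) hk.
rewrite scalerA divfK ?gt_eqF// => H.
have {}H : u (y ** (s' *: h)) <= s' / s * u (y ** (s *: h)) + (1 - s' / s) * u y.
  apply: H; first by move=> t /hs; rewrite scalerA.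
  by rewrite (divr_ge0 (ltW s'0) (ltW s0))/= ler_pdivrMr// mul1r.
rewrite /diff_quotient ler_pdivrMr// (_ : _ / s * s' = s' / s * (u (y ** (s *: h)) - u y)); last by ring.
by lra.
Qed.

Lemma admissible_le y h s s' : admissible y h s -> 0 < s' <= s -> admissible y h s'.
Proof.
move=> [s0 hs] /andP[s'0 s's]; split => // t /andP[t0 t1].
rewrite (_ : t * s' = t * (s' / s) * s); last by rewrite mulrA divfK// gt_eqF.
have l0 : 0 <= s' / s by rewrite divr_ge0 ?ltW.
have l1 : s' / s <= 1 by rewrite ler_pdivrMr// mul1r.
by apply: hs; rewrite mulr_ge0//= mulr_ile1.
Qed.

Lemma diff_quotient_lower_bound y h : Omega y -> horizontal G h -> exists B,
  lbound [set diff_quotient y h s | s in admissible y h] B.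
Proof.
move=> Oy hh; have [eta [r [L [eta0 r0 L0 _ hL]]]] := horizontal_lipschitz Oy.
exists (- (L * `|h|)) => _ [s adm <-]; have [s0 _] := adm.
pose s' := Num.min s (r / (`|h| + 1)).
have h1 : 0 < `|h| + 1 by rewrite ltr_wpDl.
have s'0 : 0 < s' by rewrite lt_min s0 divr_gt0.
apply: (@le_trans _ _ (diff_quotient y h s')); last first.
  by apply: diff_quotient_monotone => //; rewrite s'0 ge_min lexx.
have hk : horizontal G (s' *: h) by rewrite /horizontal/=; exact: memvZ.
have nk : `|s' *: h| <= r.
  rewrite normrZ gtr0_norm//; apply: (@le_trans _ _ (s' * (`|h| + 1))).
    by rewrite ler_pM2l// lerDl.
  by rewrite -ler_pdivlMr// ge_min lexx orbT.
have := hL y _ hk; rewrite subrr normr0 => /(_ (ltW eta0) nk).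
rewrite normrZ gtr0_norm// ler_norml => /andP[h2 _].
rewrite /diff_quotient ler_pdivlMr//; apply: le_trans h2.
by rewrite mulNr mulrAC mulrA lerN2 mulrAC.
Qed.

Lemma hderiv_le y h s : Omega y -> horizontal G h -> admissible y h s ->
  hderiv y h <= diff_quotient y h s.
Proof.
move=> Oy hh adm; apply: ge_inf; last by exists s.
exact: diff_quotient_lower_bound.
Qed.

Lemma hderiv_ge y h c s0 : Omega y -> horizontal G h -> 0 < s0 ->
  (forall s, 0 < s <= s0 -> c <= diff_quotient y h s) -> c <= hderiv y h.
Proof.
move=> Oy hh s00 hc; apply: lb_le_inf.
  have [s1 s10 hs1] := admissible_small h Oy.
  by exists (diff_quotient y h s1); exists s1 => //; apply: hs1; rewrite s10 lexx.
move=> _ [s adm <-]; have [sp _] := adm.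
have m0 : 0 < Num.min s s0 by rewrite lt_min sp.
apply: le_trans (hc (Num.min s s0) _) _; first by rewrite m0 ge_min lexx orbT.
by apply: diff_quotient_monotone => //; rewrite m0 ge_min lexx.
Qed.

Lemma hderiv_adherent y h (e : R) : Omega y -> horizontal G h -> 0 < e ->
  exists2 s0 : R, 0 < s0 & forall s, 0 < s <= s0 ->
    admissible y h s /\ u (y ** (s *: h)) <= u y + s * (hderiv y h + e).
Proof.
move=> Oy hh e0; have [s1 s10 hs1] := admissible_small h Oy.
have hi : has_inf [set diff_quotient y h s | s in admissible y h].
  split; last exact: diff_quotient_lower_bound.
  by exists (diff_quotient y h s1); exists s1 => //; apply: hs1; rewrite s10 lexx.
have [_ [s0 adm <-] /ltW hs] := inf_adherent e0 hi.
have [s00 _] := adm; exists s0 => // s /andP[sp ss0].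
split; first by apply: admissible_le adm _; rewrite sp.
have ss : 0 < s <= s0 by rewrite sp.
have := le_trans (diff_quotient_monotone hh adm ss) hs.
by rewrite /diff_quotient ler_pdivrMr// -/(hderiv y h) => ?; lra.
Qed.

Lemma hderivZ y h a : Omega y -> horizontal G h -> 0 < a -> hderiv y (a *: h) = a * hderiv y h.
Proof.
have half b k : Omega y -> horizontal G k -> 0 < b -> b * hderiv y k <= hderiv y (b *: k).
  move=> Oy hk b0; have hbk : horizontal G (b *: k) by rewrite /horizontal/=; exact: memvZ.
  have [s0 s00 hs0] := admissible_small k Oy.
  apply: (@hderiv_ge _ _ _ (s0 / b)) => //; first exact: divr_gt0.
  move=> s /andP[sp]; rewrite ler_pdivlMr// => ss0.
  have sb0 : 0 < s * b by exact: mulr_gt0.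
  have := hderiv_le Oy hk (hs0 (s * b) _); rewrite sb0 ss0 => /(_ isT).
  rewrite /diff_quotient scalerA !ler_pdivlMr// => ?; lra.
move=> Oy hh a0; apply/eqP; rewrite eq_le half// andbT.
have hah : horizontal G (a *: h) by rewrite /horizontal/=; exact: memvZ.
have ai : 0 < a^-1 by rewrite invr_gt0.
have := half _ _ Oy hah ai.
by rewrite scalerA mulVf ?gt_eqF// scale1r ler_pdivrMl.
Qed.

End LocalLipschitz.

(** * Subadditivity of the horizontal derivative *)

Lemma near_right0 (R : realType) (P : R -> Prop) (s0 : R) : 0 < s0 ->
  (forall s, 0 < s <= s0 -> P s) -> \forall s \near 0^'+, P s.
Proof.
move=> s00 hP; near=> s; apply: hP; apply/andP; split.
  by near: s; exact: nbhs_right_gt.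
by near: s; exact: nbhs_right_le.
Unshelve. all: by end_near. Qed.

Lemma near_right0_mul_le (R : realType) (X Y : R) : 0 < Y -> \forall s \near 0^'+, s * X <= Y.
Proof.
move=> Y0; have X1 : 0 < `|X| + 1 by rewrite ltr_wpDl.
apply: (near_right0 (divr_gt0 Y0 X1)) => s /andP[s0].
rewrite ler_pdivlMr// => h; apply: le_trans h; rewrite ler_pM2l//.
by apply: le_trans (ler_norm X) _; rewrite lerDl.
Qed.

Section Subadditivity.
Variables (R : realType) (n : nat) (G : stratified_group R n).
Variables (Omega : set 'rV[R]_n) (u : 'rV[R]_n -> R).
Hypothesis Omega_open : open Omega.
Hypothesis u_conv : h_convex G Omega u.
Hypothesis u_above : forall y, Omega y -> exists (eta M : R), 0 < eta /\
  forall z, `|z - y| <= eta -> u z <= M.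
Implicit Types (x y z w h k : 'rV[R]_n) (r s t : R).
Local Notation "x ** y" := (sg_mul G x y) (at level 40, left associativity).
Local Notation dil := (dilation G).
Local Notation D := (hderiv G Omega u).

Lemma reach_hword a : horizontal_seq G a -> reach G (size a) (\sum_(x <- a) `|x|) (hword G a).
Proof.
move=> ha; exists a; split => // x xa.
by rewrite (perm_big _ (perm_to_rem xa)) big_cons lerDl; exact: sumr_ge0.
Qed.

Lemma sg_conj_near k (rho : R) : 0 < rho -> exists2 d : R, 0 < d &
  forall v, `|v| <= d -> `|sg_conj G k v| <= rho.
Proof.
move=> rho0; have [eta eta0 heta] := sg_div_near G k rho0.
have [C C0 lip] := sg_mul_lipschitz G (addr_ge0 (normr_ge0 k) ler01).
exists (Num.min 1 (eta / C)); first by rewrite lt_min ltr01 divr_gt0.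
move=> v; rewrite le_min ler_pdivlMr// mulrC => /andP[v1 vC].
rewrite /sg_conj -sg_mulA; apply: heta; apply: le_trans vC.
have k1 : `|k| <= `|k| + 1 by rewrite lerDl.
rewrite -{2}[k](sg_mul0g G); apply: le_trans (lip _ _ _ _ _ _ _ _) _ => //.
- by apply: (le_trans v1); rewrite lerDr.
- by rewrite normr0 addr_ge0.
- by rewrite !subrr normr0 addr0 subr0.
Qed.

(** The dilation by q maps the conjugate of w by k / q to the conjugate of
dil q w by k, which tends to 0 with q. *)
Lemma conj_sublinear w k (eta : R) m : horizontal G k ->
  (forall e : R, 0 < e -> exists2 rho : R, 0 < rho & forall w, `|w| <= rho -> reach G m e w) ->
  0 < eta -> exists2 q0 : R, 0 < q0 & forall q, 0 < q <= q0 ->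
    reach G m (q^-1 * eta) (sg_conj G (q^-1 *: k) w).
Proof.
move=> hk hm eta0; have [rho rho0 hrho] := hm eta eta0.
have [d d0 hd] := sg_conj_near k rho0.
have [C C0 hC] := dilation_contract G.
have Cw : 0 < C * `|w| + 1 by rewrite ltr_wpDl// mulr_ge0.
exists (Num.min 1 (d / (C * `|w| + 1))); first by rewrite lt_min ltr01 divr_gt0.
move=> q; rewrite le_min => /and3P[q0 q1].
rewrite ler_pdivlMr// => qd.
have -> : sg_conj G (q^-1 *: k) w = dil q^-1 (sg_conj G k (dil q w)).
  rewrite /sg_conj !dilation_mul dilationN (dilation_horizontal _ hk) dilationM.
  by rewrite mulVf ?gt_eqF// dilation1.
apply: reach_dilation; first by rewrite invr_ge0 ltW.
apply/hrho/hd; have q01 : 0 <= q <= 1 by rewrite ltW.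
apply: le_trans (hC q w q01) _; apply: le_trans qd.
rewrite -mulrA mulrCA mulrDr mulr1 lerDl ltW//.
Qed.

(** Convexity along the line through z = y delta_s(w) in the direction k bounds
the increment at distance s by q times the increment at distance s / q. There z
and y may be exchanged at a small cost: on the left because z is at distance O(s)
from y and q is small, on the right by [conj_sublinear]. Finally the increment
from y at distance s / q is about (s / q) D(k). *)
Lemma hderiv_word_step y a k (e : R) : Omega y -> horizontal_seq G a -> horizontal G k -> 0 < e ->
  \forall s \near 0^'+, u (y ** dil s (hword G a) ** (s *: k)) <=
    u (y ** dil s (hword G a)) + s * (D y k + e).
Proof.
move=> Oy ha hk e0.
have [eta [r0 [L [eta0 r00 L0 hO lip]]]] := reach_lipschitz Omega_open u_conv u_above Oy.
have [m hm] := reach_neighborhood G.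
set w := hword G a; pose A := \sum_(x <- a) `|x|.
have A0 : 0 <= A by exact: sumr_ge0.
have m0 : 0 <= (m%:R : R) by exact: ler0n.
pose N : R := (size a)%:R; have N0 : 0 <= N by exact: ler0n.
have e3 : 0 < e / 3 by exact: divr_gt0.
pose th := e / 3 / (L * m%:R + 1).
have Lm : 0 <= L * m%:R by exact: mulr_ge0.
have th0 : 0 < th by rewrite divr_gt0// ltr_wpDl.
have thL : L * m%:R * th <= e / 3.
  apply: (@le_trans _ _ ((L * m%:R + 1) * th)); first by rewrite ler_pM2r// lerDl.
  by rewrite mulrC divfK// gt_eqF// ltr_wpDl.
have [q0 q00 hq0] := conj_sublinear w hk hm th0.
have LNA : 0 <= L * N * A by rewrite !mulr_ge0.
pose q := Num.min (Num.min 1 q0) (e / 3 / (L * N * A + 1)).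
have qp : 0 < q by rewrite !lt_min ltr01 q00 divr_gt0// ltr_wpDl.
have q1 : q <= 1 by rewrite !ge_min lexx.
have qq0 : q <= q0 by rewrite !ge_min lexx orbT.
have qLNA : L * N * A * q <= e / 3.
  apply: (@le_trans _ _ ((L * N * A + 1) * q)); first by rewrite ler_pM2r// lerDl.
  by rewrite mulrC -ler_pdivlMr ?ltr_wpDl// ge_min lexx orbT.
have qi0 : 0 < q^-1 by rewrite invr_gt0.
set c := sg_conj G (q^-1 *: k) w.
have rc : reach G m (q^-1 * th) c by apply: hq0; rewrite qp.
have [d d0 hd] := sg_mul_near G y eta0.
have [r3 r30 hr3] := reach_small G m d0.
have ed0 : 0 < Num.min eta d by rewrite lt_min eta0.
have [ra ra0 hra] := reach_near G y (size a) ed0.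
have [s1 s10 hs1] := hderiv_adherent Omega_open u_conv u_above Oy hk e3.
have [s2 s20 hs2] := segment_near G y (q^-1 *: k) d0.
near=> s.
have sp : 0 < s by near: s; exact: nbhs_right_gt.
have sA0 : 0 <= s * A by rewrite mulr_ge0// ltW.
have sAra : s * A <= ra by near: s; exact: near_right0_mul_le.
have sAr0 : s * A <= r0 by near: s; exact: near_right0_mul_le.
have sth0 : 0 <= s * (q^-1 * th).
  by apply: mulr_ge0; [exact: ltW|apply: mulr_ge0; exact: ltW].
have sth3 : s * (q^-1 * th) <= r3 by near: s; exact: near_right0_mul_le.
have sthr0 : s * (q^-1 * th) <= r0 by near: s; exact: near_right0_mul_le.
have ss1 : s * q^-1 <= s1 by near: s; exact: near_right0_mul_le.
have ss2 : s <= s2 by near: s; exact: nbhs_right_le.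
have skd : s * `|q^-1 *: k| <= d by near: s; exact: near_right0_mul_le.
pose z := y ** dil s w.
have rw : reach G (size a) (s * A) (dil s w).
  by apply: reach_dilation; [exact: ltW|exact: reach_hword].
have zy : `|z - y| <= d.
  have := hra (dil s w) (le_reach (leqnn _) sAra rw).
  by rewrite le_min => /andP[].
(* The left endpoint z of the large-scale segment may be replaced by y. *)
have uz : u y - L * N * (s * A) <= u z.
  have near1 w' : reach G (size a) (s * A) w' -> `|y ** w' - y| <= eta.
    by move=> /(le_reach (leqnn _) sAra)/hra; rewrite le_min => /andP[].
  have := lip (size a) y (s * A) (dil s w) sAr0 near1 rw.
  by rewrite (ger0_norm sA0) ler_distl => /andP[].
(* The right endpoint z (s k / q) may be replaced by y (s k / q). *)
pose sk := (s * q^-1) *: k.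
have hsk : horizontal G sk by rewrite /horizontal/=; exact: memvZ.
have far : z ** sk = y ** sk ** dil s c.
  have -> : sk = dil s (q^-1 *: k).
    by rewrite (dilation_horizontal s) ?scalerA// /horizontal/=; exact: memvZ.
  rewrite /z -!sg_mulA -!dilation_mul /c /sg_conj; congr (_ ** dil s _).
  by rewrite -!(sg_mulA G) sg_mulNKg.
have ufar : u (z ** sk) <= u (y ** sk) + L * m%:R * (s * (q^-1 * th)).
  have rsc : reach G m (s * (q^-1 * th)) (dil s c) by apply: reach_dilation => //; exact: ltW.
  have near2 w' : reach G m (s * (q^-1 * th)) w' -> `|y ** sk ** w' - y| <= eta.
    move=> /(le_reach (leqnn _) sth3)/hr3 w'd; apply: hd => //.
    by rewrite /sk -scalerA; apply: hs2; rewrite ltW.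
  have := lip m (y ** sk) _ _ sthr0 near2 rsc.
  by rewrite -far (ger0_norm sth0) ler_distl => /andP[].
have uy : u (y ** sk) <= u y + s * q^-1 * (D y k + e / 3).
  by have [|//] := hs1 (s * q^-1); rewrite mulr_gt0.
have seg t : 0 <= t <= 1 -> Omega (z ** (t *: sk)).
  move=> /andP[t0 t1]; apply: hO; apply: hd => //.
  rewrite normrZ ger0_norm// /sk -scalerA normrZ (gtr0_norm sp); apply: le_trans skd.
  by rewrite ler_piMl// mulr_ge0// ltW.
have := h_convex_line u_conv hsk seg (_ : 0 <= q <= 1); rewrite (ltW qp) q1 => /(_ isT).
rewrite {1}/sk scalerA (_ : q * (s * q^-1) = s); last by rewrite mulrCA mulfV ?mulr1// gt_eqF.
move=> cvx; apply: le_trans cvx _.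
have E1 : q * (s * q^-1 * (D y k + e / 3)) = s * (D y k + e / 3).
  by rewrite !mulrA (mulrC q) mulfK// gt_eqF.
have E2 : q * (L * m%:R * (s * (q^-1 * th))) = s * (L * m%:R * th).
  rewrite (_ : q * _ = (q * q^-1) * (s * (L * m%:R * th))); last by ring.
  by rewrite mulfV ?mul1r// gt_eqF.
have E3 : q * (L * N * (s * A)) = s * (L * N * A * q) by ring.
have h1 : q * u (z ** sk) <= q * (u y + s * q^-1 * (D y k + e / 3) + L * m%:R * (s * (q^-1 * th))).
  by rewrite ler_pM2l//; apply: le_trans ufar _; rewrite lerD2r.
have h2 : q * (u y - L * N * (s * A)) <= q * u z by rewrite ler_pM2l.
have h3 : s * (L * m%:R * th) <= s * (e / 3) by rewrite ler_pM2l.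
have h4 : s * (L * N * A * q) <= s * (e / 3) by rewrite ler_pM2l.
rewrite (mulrDr q (u y + s * q^-1 * (D y k + e / 3))) (mulrDr q (u y)) E1 E2 in h1.
by rewrite mulrBr E3 in h2; rewrite -/z; lra.
Unshelve. all: by end_near. Qed.

Lemma hderiv_word y a (e : R) : Omega y -> horizontal_seq G a -> 0 < e ->
  \forall s \near 0^'+, u (y ** dil s (hword G a)) <= u y + s * (\sum_(k <- a) D y k + e).
Proof.
move=> Oy; elim/last_ind: a e => [|a k IH] e ha e0.
  near=> s; have sp : 0 < s by near: s; exact: nbhs_right_gt.
  rewrite /= linear0 sg_mulg0 big_nil add0r lerDl; apply: mulr_ge0; exact: ltW.
have e2 : 0 < e / 2 by exact: divr_gt0.
have ha' : horizontal_seq G a by move=> x xa; apply: ha; rewrite mem_rcons in_cons xa orbT.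
have hk : horizontal G k by apply: ha; rewrite mem_rcons mem_head.
near=> s.
have h1 : u (y ** dil s (hword G a) ** (s *: k)) <=
    u (y ** dil s (hword G a)) + s * (D y k + e / 2).
  by near: s; exact: hderiv_word_step.
have h2 : u (y ** dil s (hword G a)) <= u y + s * (\sum_(k <- a) D y k + e / 2).
  by near: s; exact: IH.
rewrite -cats1 hword_cat/= sg_mulg0 dilation_mul (dilation_horizontal s hk) sg_mulA.
rewrite big_cat big_seq1 /=.
have -> : s * (\sum_(i <- a) D y i + D y k + e) =
  s * (\sum_(i <- a) D y i + e / 2) + s * (D y k + e / 2) by field.
by lra.
Unshelve. all: by end_near. Qed.

Lemma hword_power x k M : hword G (flatten (nseq M [:: x; k])) = M%:R *: (x ** k).
Proof.
elim: M => [|M IH]; first by rewrite scale0r.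
rewrite /= IH sg_mulA -{1}[x ** k]scale1r sg_mulZZ.
by rewrite -[in RHS]natr1 addrC.
Qed.

(** The word (h/M) (k/M), repeated M times, equals M delta_(1/M)(h k) and tends to
the first-layer part h + k of h k. Its letters have total derivative D(h) + D(k),
and for large M the correction from the word to h + k is short. *)
Lemma hderiv_subadditive y h k : Omega y -> horizontal G h -> horizontal G k ->
  D y (h + k) <= D y h + D y k.
Proof.
move=> Oy hh hk; apply/ler_addgt0Pr => e e0.
have [eta [r0 [L [eta0 r00 L0 hO lip]]]] := reach_lipschitz Omega_open u_conv u_above Oy.
have [m hm] := reach_neighborhood G.
have Lm : 0 <= L * m%:R by rewrite mulr_ge0// ler0n.
have e2 : 0 < e / 2 by exact: divr_gt0.
pose th := e / 2 / (L * m%:R + 1).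
have th0 : 0 < th by rewrite divr_gt0// ltr_wpDl.
have thL : L * m%:R * th <= e / 2.
  apply: (@le_trans _ _ ((L * m%:R + 1) * th)); first by rewrite ler_pM2r// lerDl.
  by rewrite mulrC divfK// gt_eqF// ltr_wpDl.
have [rho rho0 hrho] := hm th th0.
pose p := h + k.
have hp : horizontal G p by rewrite /horizontal/=; exact: memvD.
have [eta' eta'0 heta'] := sg_div_near G p rho0.
have [C C0 hC] := dilation_near_hproj G.
pose M := (Num.truncn (C * `|h ** k| / eta')).+1.
have M0 : 0 < (M%:R : R) by rewrite ltr0n.
pose a := flatten (nseq M [:: M%:R^-1 *: h; M%:R^-1 *: k]).
have ha : horizontal_seq G a.
  move=> x /flattenP[b /nseqP[-> _]]; rewrite !inE.
  by move=> /orP[]/eqP->; rewrite /horizontal/=; exact: memvZ.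
pose w := hword G a.
have wE : w = M%:R *: dil M%:R^-1 (h ** k).
  by rewrite /w hword_power dilation_mul !(dilation_horizontal M%:R^-1).
have wp : `|w - p| <= eta'.
  have -> : w - p = M%:R *: (dil M%:R^-1 (h ** k) - M%:R^-1 *: hproj G (h ** k)).
    rewrite scalerBr scalerA mulfV ?gt_eqF// scale1r -wE hproj_mul.
    by rewrite !hproj_id.
  rewrite normrZ gtr0_norm//.
  apply: (@le_trans _ _ (M%:R * (C * M%:R^-1 ^+ 2 * `|h ** k|))).
    rewrite ler_pM2l//; apply: hC; rewrite invr_ge0 ltW//= invf_le1// ler1n//.
  rewrite (_ : _ * _ = (M%:R * M%:R^-1) * (C * `|h ** k|) / M%:R); last by ring.
  rewrite mulfV ?gt_eqF// mul1r ler_pdivrMr// [eta' * _]mulrC -ler_pdivrMr//.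
  by rewrite ltW// truncnS_gt.
pose v := (- w) ** p.
have rv : reach G m th v.
  apply: hrho; rewrite /v -[X in `|X|]opprK normrN sg_oppM opprK.
  exact: heta'.
have aE : \sum_(x <- a) D y x = D y h + D y k.
  have -> : \sum_(x <- a) D y x = M%:R * (D y (M%:R^-1 *: h) + D y (M%:R^-1 *: k)).
    rewrite /a; elim: (M) (M%:R^-1 *: h) (M%:R^-1 *: k) => [|M' IH] x1 x2.
      by rewrite big_nil mul0r.
    by rewrite /= !big_cons IH -[in RHS]natr1; ring.
  by rewrite !(hderivZ Omega_open u_conv u_above)// ?invr_gt0// -mulrDr mulrA mulfV ?mul1r// gt_eqF.
have [d d0 hd] := sg_mul_near G y eta0.
have [r3 r30 hr3] := reach_small G m d0.
have [ra ra0 hra] := reach_near G y (size a) d0.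
have [sa sa0 hsa] := admissible_small G Omega_open p Oy.
near (0 : R)^'+ => s.
have sp : 0 < s by near: s; exact: nbhs_right_gt.
have ss : s <= sa by near: s; exact: nbhs_right_le.
have sA : s * (\sum_(x <- a) `|x|) <= ra by near: s; exact: near_right0_mul_le.
have sth3 : s * th <= r3 by near: s; exact: near_right0_mul_le.
have sthr0 : s * th <= r0 by near: s; exact: near_right0_mul_le.
have uw : u (y ** dil s w) <= u y + s * (\sum_(k <- a) D y k + e / 2).
  by near: s; exact: hderiv_word.
have zy : `|y ** dil s w - y| <= d.
  apply: hra; apply: le_reach (leqnn _) sA _.
  by apply: reach_dilation; [exact: ltW|exact: reach_hword].
have rsv : reach G m (s * th) (dil s v) by apply: reach_dilation => //; exact: ltW.
have up : u (y ** (s *: p)) <= u (y ** dil s w) + L * m%:R * (s * th).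
  have -> : y ** (s *: p) = y ** dil s w ** dil s v.
    by rewrite -sg_mulA -dilation_mul /v sg_mulNKg (dilation_horizontal s hp).
  have near1 w' : reach G m (s * th) w' -> `|y ** dil s w ** w' - y| <= eta.
    by move=> /(le_reach (leqnn _) sth3)/hr3 w'd; apply: hd.
  have := lip m (y ** dil s w) _ _ sthr0 near1 rsv.
  by rewrite (ger0_norm (mulr_ge0 (ltW sp) (ltW th0))) ler_distl => /andP[].
have adm : admissible G Omega y p s by apply: hsa; rewrite sp.
apply: le_trans (hderiv_le Omega_open u_conv u_above Oy hp adm) _.
rewrite /diff_quotient ler_pdivrMr//; rewrite aE in uw.
have h3 : s * (L * m%:R * th) <= s * (e / 2) by rewrite ler_pM2l.
have E : L * m%:R * (s * th) = s * (L * m%:R * th) by ring.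
rewrite E in up.
have -> : (D y h + D y k + e) * s = s * (D y h + D y k + e / 2) + s * (e / 2) by field.
by lra.
Unshelve. all: by end_near. Qed.

End Subadditivity.

(** * Supporting linear forms and the mean value theorem *)

Section HahnBanach.
Variables (R : realType) (n : nat).
Implicit Types (x y e : 'rV[R]_n) (p : 'rV[R]_n -> R).

Definition sublinear p :=
  (forall x y, p (x + y) <= p x + p y) /\ (forall a x, 0 < a -> p (a *: x) = a * p x).

Lemma sublinear0 p : sublinear p -> p 0 = 0.
Proof. by move=> [_ /(_ 2 0 (ltr0Sn _ _))]; rewrite scaler0 => ?; lra. Qed.

Lemma sublinear_opp_ge p x : sublinear p -> - p (- x) <= p x.
Proof.
move=> sp; have [sub _] := sp; have := sub x (- x).
by rewrite subrr sublinear0// => ?; lra.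
Qed.

(** The infimum over t of p(x + t e) - t c is the largest sublinear minorant of p
that is linear along e with value c at e. *)
Lemma sublinear_pin p e c : sublinear p -> - p (- e) <= c <= p e -> exists p',
  [/\ sublinear p', forall x, p' x <= p x, p' e <= c & p' (- e) <= - c].
Proof.
move=> sp /andP[c1 c2]; have [sub hom] := sp; have p0 := sublinear0 sp.
have te t : t * c <= p (t *: e).
  case: (ltrgt0P t) => [t0|t0|->]; last by rewrite scale0r p0 mul0r.
    by rewrite hom// ler_pM2l.
  have nt : 0 < - t by rewrite oppr_gt0.
  by rewrite -[t *: e]opprK -scaleNr -scalerN hom// -[t * c]mulrNN ler_pM2l//; lra.
pose Q x := [set p (x + t *: e) - t * c | t in [set: R]].
have lb x : lbound (Q x) (- p (- x)).
  move=> _ [t _ <-]; have := sub (x + t *: e) (- x).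
  by rewrite addrAC subrr add0r; have := te t => ? ?; lra.
have hi x : has_inf (Q x).
  by split; [exists (p (x + 0 *: e) - 0 * c); exists 0|exists (- p (- x))].
pose p' x := inf (Q x).
have le t x : p' x <= p (x + t *: e) - t * c.
  by apply: ge_inf; [exists (- p (- x)); exact: lb|exists t].
exists p'; split.
- split=> [x y|a x a0].
    apply/ler_addgt0Pr => d d0; have d2 : 0 < d / 2 by exact: divr_gt0.
    have [_ [t _ <-] ht] := inf_adherent d2 (hi x).
    have [_ [t' _ <-] ht'] := inf_adherent d2 (hi y).
    apply: le_trans (le (t + t') (x + y)) _.
    have := sub (x + t *: e) (y + t' *: e).
    rewrite addrACA -scalerDl -/(p' x) -/(p' y) in ht ht' * => hs.
    have -> : p' x + p' y + d = (p' x + d / 2) + (p' y + d / 2) by field.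
    by rewrite /p'; lra.
  have half b z : 0 < b -> b * p' z <= p' (b *: z).
    move=> b0; apply: lb_le_inf; first by have [] := hi (b *: z).
    move=> _ [t _ <-].
    have -> : b *: z + t *: e = b *: (z + (t / b) *: e).
      by rewrite scalerDr scalerA mulrCA mulfV ?mulr1// gt_eqF.
    have -> : t * c = b * (t / b * c) by field; rewrite gt_eqF.
    by rewrite hom// -mulrBr ler_pM2l.
  apply/eqP; rewrite eq_le half// andbT.
  have := half a^-1 (a *: x); rewrite invr_gt0 scalerA mulVf ?gt_eqF// scale1r => /(_ a0).
  by rewrite ler_pdivrMl.
- by move=> x; have := le 0 x; rewrite scale0r addr0 mul0r subr0.
- by have := le (-1) e; rewrite scaleN1r subrr p0 mulN1r opprK add0r.
- by have := le 1 (- e); rewrite scale1r addNr p0 mul1r add0r.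
Qed.

(** A sublinear minorant that is linear along e stays so when it is decreased
further to another sublinear one. *)
Lemma sublinear_pin_seq p (es : seq 'rV[R]_n) : sublinear p -> exists p',
  [/\ sublinear p', forall x, p' x <= p x & forall e, e \in es -> p' (- e) <= - p' e].
Proof.
elim: es p => [|e es IH] p sp; first by exists p.
have [p1 [sp1 lep1 e1 e2]] : exists p', [/\ sublinear p', forall x, p' x <= p x,
    p' e <= p e & p' (- e) <= - p e].
  by apply: sublinear_pin => //; rewrite lexx sublinear_opp_ge.
have [p2 [sp2 lep2 he]] := IH p1 sp1.
exists p2; split => // [x|x]; first exact: le_trans (lep1 x).
rewrite inE => /orP[/eqP->|/he//].
have := sublinear_opp_ge (- e) sp2; rewrite opprK.
have := lep2 e; have := lep2 (- e); lra.
Qed.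

(** The Hahn-Banach theorem: after pinning at x0, and then along every basis
vector, the sublinear function is linear. *)
Lemma sublinear_support p x0 c : sublinear p -> - p (- x0) <= c <= p x0 ->
  exists f : 'cV[R]_n, (x0 *m f) 0 0 = c /\ forall x, (x *m f) 0 0 <= p x.
Proof.
move=> sp hc; have [p1 [sp1 lep1 e1 e2]] := sublinear_pin sp hc.
have [p2 [sp2 lep2 he]] := sublinear_pin_seq [seq delta_mx 0 i | i <- enum 'I_n] sp1.
have [sub hom] := sp2.
pose f : 'cV[R]_n := \col_i p2 (delta_mx 0 i).
have coord (a : R) i : p2 (a *: delta_mx 0 i) <= a * p2 (delta_mx 0 i).
  case: (ltrgt0P a) => [a0|a0|->]; last by rewrite scale0r sublinear0// mul0r.
    by rewrite hom.
  have na : 0 < - a by rewrite oppr_gt0.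
  rewrite -[a *: _]opprK -scaleNr -scalerN hom// -[a * p2 _]mulrNN ler_pM2l//.
  by apply: he; apply/mapP; exists i => //; rewrite mem_enum.
have upper x : p2 x <= (x *m f) 0 0.
  rewrite {1}(row_sum_delta x) mxE.
  have := @ler_sum R _ (index_enum 'I_n) xpredT (fun i => p2 (x 0 i *: delta_mx 0 i))
     (fun i => x 0 i * f i 0).
  move=> H; apply: le_trans (H _); last by move=> i _; rewrite mxE.
  elim/big_ind2: _ => //; first by rewrite sublinear0.
  by move=> a b a' b' h h'; apply: le_trans (sub _ _) _; exact: lerD.
have eqf x : p2 x = (x *m f) 0 0.
  apply/eqP; rewrite eq_le upper/=; have := upper (- x); have := sublinear_opp_ge x sp2.
  by rewrite mulNmx mxE => ? ?; lra.
exists f; split.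
  apply/eqP; rewrite eq_le -eqf; have := lep2 x0; have := lep2 (- x0).
  rewrite !eqf mulNmx mxE => h1 h2; apply/andP; split; lra.
by move=> x; rewrite -eqf; exact: le_trans (lep2 x) (lep1 x).
Qed.

End HahnBanach.

Section Conclusion.
Variables (R : realType) (n : nat) (G : stratified_group R n).
Implicit Types (x y z w h k : 'rV[R]_n) (r s t : R).
Local Notation "x ** y" := (sg_mul G x y) (at level 40, left associativity).

Lemma sg_dot_riesz (f : 'cV[R]_n) : exists q, forall x, sg_dot G q x = (x *m f) 0 0.
Proof.
pose M : 'M[R]_n := \matrix_(i, j) sg_dot G (delta_mx 0 i) (delta_mx 0 j).
have dotE q x : sg_dot G q x = (q *m M *m x^T) 0 0.
  rewrite {1}(row_sum_delta q) linear_sumlz.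
  rewrite -mulmxA mxE; apply: eq_bigr => i _.
  rewrite {1}(row_sum_delta x) linear_sumr mxE mulr_sumr; apply: eq_bigr => j _.
  by rewrite linearZl_LR/= linearZr_LR/= !mxE; ring.
have uM : M \in unitmx.
  rewrite unitmxE unitfE; apply/negP => /det0P[q q0 qM].
  have := @neq0_dnorm_gt0 _ _ _ (sg_dot G) q q0.
  by rewrite dotE qM mul0mx mxE ltxx.
exists (f^T *m invmx M) => x; rewrite dotE mulmxKV//.
by rewrite -[RHS]/((x *m f) 0 0) -[in RHS](trmxK (x *m f)) trmx_mul [RHS]mxE.
Qed.

Lemma sg_dot_hproj q h : horizontal G h -> sg_dot G (hproj G q) h = sg_dot G q h.
Proof.
move=> hh; rewrite -[in RHS](layer_proj_sum G q) linear_sumlz.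
rewrite (bigD1 (Ordinal (sg_step_gt0 G)))//= big1 ?addr0// => j j0.
apply: (sg_dot_layer (i := j.+1) (j := 1)) => //; last exact: layer_proj_in.
by move=> [jE]; case/eqP: j0; exact: val_inj.
Qed.

Variables (Omega : set 'rV[R]_n) (u : 'rV[R]_n -> R).
Hypothesis Omega_open : open Omega.
Hypothesis u_conv : h_convex G Omega u.
Hypothesis u_above : forall y, Omega y -> exists (eta M : R), 0 < eta /\
  forall z, `|z - y| <= eta -> u z <= M.
Local Notation D := (hderiv G Omega u).

(** The derivative at z, extended by the projection onto the first layer, is
sublinear; a linear form below it is represented by a horizontal vector, because
the layers are orthogonal. *)
Lemma subdifferential_support z h c : Omega z -> horizontal G h ->
  - D z (- h) <= c <= D z h ->
  exists2 p, h_subdifferential G Omega u z p & sg_dot G p h = c.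
Proof.
move=> Oz hh hc.
pose P x := D z (hproj G x).
have sP : sublinear P.
  split=> [x y|a x a0]; rewrite /P.
    by rewrite linearD; apply: (hderiv_subadditive Omega_open u_conv u_above) => //; exact: hproj_horizontal.
  by rewrite linearZ/= (hderivZ Omega_open u_conv u_above)//; exact: hproj_horizontal.
have hN : horizontal G (- h) by rewrite /horizontal/= rpredN.
have [|f [fh fP]] := @sublinear_support _ _ P h c sP.
  by rewrite /P !hproj_id.
have [q qE] := sg_dot_riesz f.
exists (hproj G q); last by rewrite sg_dot_hproj// qE.
split; first exact: hproj_horizontal.
move=> k hk seg; rewrite sg_dot_hproj// qE.
have adm : admissible G Omega z k 1.
  split => // t t01; have [|w Ow wE] := seg (t *: k); first by exists t; rewrite ?in_itv.
  by rewrite mulr1 -wE sg_invE sg_mulNKg.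
have := hderiv_le Omega_open u_conv u_above Oz hk adm.
rewrite /diff_quotient scale1r divr1; have := fP k; rewrite /P hproj_id// => ? ?; lra.
Qed.

(** Subtract from u its linear interpolation between the two ends and take a
minimum on the segment. If it is attained at an end then, by convexity, it is also
attained at the middle, so an interior point is available. *)
Lemma horizontal_mean_value x h : horizontal G h ->
  (forall t, 0 <= t <= 1 -> Omega (x ** (t *: h))) ->
  exists2 t, 0 <= t <= 1 &
    - D (x ** (t *: h)) (- h) <= u (x ** h) - u x <= D (x ** (t *: h)) h.
Proof.
move=> hh hO.
set c := u (x ** h) - u x.
pose g t := u (x ** (t *: h)) - t * c.
have g01 : g 1 = g 0 by rewrite /g scale1r scale0r sg_mulg0 /c; lra.
have shift t s : x ** (t *: h) ** (s *: h) = x ** ((t + s) *: h).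
  by rewrite -sg_mulA sg_mulZZ.
have cont : {within `[0, 1], continuous g}.
  apply: continuous_in_subspaceT => t; rewrite inE/= in_itv/= => t01.
  have [eta [r [L [eta0 r0 L0 _ hL]]]] := horizontal_lipschitz Omega_open u_conv u_above (hO t t01).
  apply: (@continuousB _ _ _ (fun t => u (x ** (t *: h))) (fun t => t * c)); last first.
    exact: mulrr_continuous.
  apply/cvgrPdist_le => e e0.
  have h1 : 0 < `|h| + 1 by rewrite ltr_wpDl.
  have L1 : 0 < L + 1 by rewrite ltr_wpDl.
  pose d := Num.min (r / (`|h| + 1)) (e / ((L + 1) * (`|h| + 1))).
  have d0 : 0 < d by rewrite lt_min !divr_gt0// mulr_gt0.
  near=> s.
  have sd : `|s - t| <= d.
    rewrite distrC; near: s; apply: (@cvgr_dist_le _ _ _ (nbhs t) _ id) => //.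
  have := hL (x ** (t *: h)) ((s - t) *: h) (memvZ _ hh).
  rewrite subrr normr0 => /(_ (ltW eta0)); rewrite shift (addrC t) subrK normrZ.
  have hr : `|s - t| * `|h| <= r.
    apply: (@le_trans _ _ (d * (`|h| + 1))); first by rewrite ler_pM// lerDl.
    by rewrite -ler_pdivlMr// ge_min lexx.
  move=> /(_ hr); rewrite distrC => /le_trans; apply.
  apply: (@le_trans _ _ ((L + 1) * (d * (`|h| + 1)))).
    by apply: ler_pM; rewrite ?mulr_ge0// ?lerDl// ler_pM// lerDl.
  by rewrite mulrCA -ler_pdivlMr ?mulr_gt0// ge_min lexx orbT.
have [t0 t001 tmin] := EVT_min ler01 cont.
rewrite in_itv/= in t001.
have cvx : g (1 / 2) <= g 0.
  have := h_convex_line u_conv hh hO (_ : 0 <= 1 / 2 <= 1).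
  move=> /(_ _)H; have {}H := H ltac:(apply/andP; split; lra).
  by move: H; rewrite /g scale0r sg_mulg0 mul0r /c => ?; lra.
have [t [t_gt0 t_lt1] tm] : exists2 t, 0 < t /\ t < 1 & forall s, 0 <= s <= 1 -> g t <= g s.
  have [/andP[h1 h2]|] := boolP ((0 < t0) && (t0 < 1)).
    by exists t0 => // s s01; apply: tmin; rewrite in_itv.
  move=> nt; exists (1 / 2); first by split; lra.
  move=> s s01; apply: (@le_trans _ _ (g t0)); last by apply: tmin; rewrite in_itv.
  have [/andP[h1 h2]] := conj t001 nt; rewrite negb_and -!leNgt => /orP[h3|h3].
    by have -> : t0 = 0 by apply/eqP; rewrite eq_le h1 h3.
  by have -> : t0 = 1; [apply/eqP; rewrite eq_le h2 h3|rewrite g01].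
exists t; first by rewrite (ltW t_gt0) (ltW t_lt1).
have Ot : Omega (x ** (t *: h)) by apply: hO; rewrite (ltW t_gt0) (ltW t_lt1).
have hN : horizontal G (- h) by rewrite /horizontal/= rpredN.
apply/andP; split.
  rewrite lerNl; apply: (hderiv_ge Omega_open u_conv (s0 := t)) => //.
  move=> s /andP[s0 st]; rewrite /diff_quotient scalerN -scaleNr shift ler_pdivlMr//.
  have := tm (t - s); rewrite /g; have -> : 0 <= t - s <= 1 by apply/andP; split; lra.
  by move=> /(_ isT) ?; lra.
apply: (hderiv_ge Omega_open u_conv (s0 := 1 - t)) => //; first by rewrite subr_gt0.
move=> s /andP[s0 st]; rewrite /diff_quotient shift ler_pdivlMr//.
have := tm (t + s); rewrite /g; have -> : 0 <= t + s <= 1 by apply/andP; split; lra.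
by move=> /(_ isT) ?; lra.
Unshelve. all: by end_near. Qed.

End Conclusion.

Theorem theorem1p4 (R : realType) (n : nat) (G : stratified_group R n)
    (Omega : set 'rV[R]_n) (u : 'rV[R]_n -> R) :
  open Omega ->
  lebesgue_measurable_fun Omega u ->
  h_convex G Omega u ->
  forall x h : 'rV[R]_n, Omega x ->
    segment h `<=` horizontal G `&` left_translate G (sg_inv G x) Omega ->
    exists (t : R) (p : 'rV[R]_n),
      [/\ 0 <= t <= 1,
          h_subdifferential G Omega u (sg_mul G x (dilation G t h)) p &
          u (sg_mul G x h) - u x = sg_dot G p h].
Proof.
move=> Oo um uc x h Ox seg.
have above := @locally_bounded_above _ _ G Omega u Oo um uc.
have mem t : 0 <= t <= 1 -> segment h (t *: h) by move=> t01; exists t; rewrite ?in_itv.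
have hh : horizontal G h.
  by have [] := seg (1 *: h) (mem 1 _); rewrite ?scale1r// ler01 lexx.
have hO t : 0 <= t <= 1 -> Omega (sg_mul G x (t *: h)).
  move=> /mem/seg[_ [w Ow wE]]; rewrite -wE sg_invE sg_mulNKg.
  exact: Ow.
have [t t01 ht] := horizontal_mean_value Oo uc above hh hO.
have [p hp pE] := subdifferential_support Oo uc above (hO t t01) hh ht.
by exists t, p; split => //; rewrite dilation_horizontal.
Qed.
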